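(* Let $\xi$ be a Lévy process with $\psi(u)=\log\mathbb E e^{u\xi(1)}<\infty$ for all $u\in\mathbb R$, $\xi(1)$ not a.s. constant, and let $\xi_i$, $i\in\mathbb N$, be independent copies of $\xi$. Let $\lambda_2=2\psi'(2)-\psi(2)$ and suppose $(s_N)$ is a non-negative sequence with $s_N\to\infty$ such that for some $\vartheta\in\mathbb R$, \[ \log N=\lambda_2 s_N+2\vartheta\sqrt{\psi''(2)s_N}+o(\sqrt{s_N}),\qquad N\to\infty. \] Let $Z_N(t)=\sum_{i=1}^N e^{\xi_i(s_N+t)}$. Then the finite-dimensional distributions of \[ \frac{Z_N(\cdot)-\mathbb E Z_N(\cdot)}{\sqrt{\operatorname{Var}Z_N(\cdot)}} \] converge weakly, as $N\to\infty$, to those of $\sqrt{\Phi(\vartheta)}\,\mathcal X(\cdot)$, where $\Phi$ is the standard normal distribution function and $\{\mathcal X(t),t\in\mathbb R\}$ is a zero-mean Gaussian process with covariance $\operatorname{Cov}(\mathcal X(t_1),\mathcal X(t_2))=e^{(\psi(1)-\psi(2)/2)|t_2-t_1|}$.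
   Context: A Lévy process is a process with stationary independent increments and càdlàg sample paths, started at $0$. *)

(* Defs.v *)
From HB Require Import structures.
From mathcomp Require Import all_boot all_order all_algebra.
From mathcomp Require Import all_classical all_reals all_analysis.
Set Implicit Arguments. Unset Strict Implicit. Unset Printing Implicit Defensive.
Import Order.TTheory GRing.Theory Num.Theory.
Import numFieldNormedType.Exports.
Local Open Scope classical_set_scope.
Local Open Scope ring_scope.

Section Defs.
Context {d : measure_display} {T : measurableType d} {R : realType}.
Variable P : probability T R.

(** A (real) stochastic process indexed by time is a map [R -> T -> R];
    only times [t >= 0] are meaningful for Lévy processes. *)

Definition sigma_rv (X : T -> R) : set (set T) :=
  <<s [set X @^-1` B | B in (measurable : set (set R))] >>.

Definition sigma_proc (xi : R -> T -> R) : set (set T) :=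
  <<s \bigcup_(t in [set t : R | 0 <= t])
        [set xi t @^-1` B | B in (measurable : set (set R))] >>.

Definition mutually_independent {I : eqType} (J : set I)
    (F : I -> set (set T)) :=
  forall (s : seq I), uniq s -> (forall i, i \in s -> J i) ->
  forall A : I -> set T, (forall i, i \in s -> F i (A i)) ->
  P (\big[setI/setT]_(i <- s) A i) = (\prod_(i <- s) P (A i))%E.

Definition cadlag (f : R -> R) :=
  (forall t, 0 <= t -> f x @[x --> t^'+] --> f t) /\
  (forall t, 0 < t -> exists l : R, f x @[x --> t^'-] --> l).

Definition levy_process (xi : R -> T -> R) :=
  [/\ (forall t, 0 <= t -> measurable_fun setT (xi t)),
      {ae P, forall w, xi 0 w = 0},
      (forall s t, 0 <= s -> s <= t -> forall B : set R, measurable B ->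
         P ((fun w => xi t w - xi s w) @^-1` B) = P (xi (t - s) @^-1` B)),
      (forall (n : nat) (u : nat -> R), 0 <= u 0%N ->
         (forall j, (j < n)%N -> u j <= u j.+1) ->
         mutually_independent [set j | (j < n)%N]
           (fun j => sigma_rv (fun w => xi (u j.+1) w - xi (u j) w))) &
      {ae P, forall w, cadlag (fun t => xi t w)} ].

Definition same_fdd (xi eta : R -> T -> R) :=
  forall (n : nat) (t : 'I_n -> R) (B : 'I_n -> set R),
    (forall j, 0 <= t j) -> (forall j, measurable (B j)) ->
    P (\bigcap_(j in [set: 'I_n]) (xi (t j) @^-1` B j)) =
    P (\bigcap_(j in [set: 'I_n]) (eta (t j) @^-1` B j)).

Definition lmgf (X : T -> R) (u : R) : R := ln (fine ('M_P X u)).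

Definition centered_gaussian_process (X : R -> T -> R) (C : R -> R -> R) :=
  (forall t, measurable_fun setT (X t)) /\
  forall (n : nat) (t a : 'I_n -> R) (B : set R), measurable B ->
    let v := \sum_(j < n) \sum_(l < n) a j * a l * C (t j) (t l) in
    P ((fun w => \sum_(j < n) a j * X (t j) w) @^-1` B) =
      (if v == 0 then \d_(0 : R) B else normal_prob 0 (Num.sqrt v) B).

End Defs.

Definition std_normal_cdf {R : realType} (x : R) : R :=
  fine (normal_prob 0 1 [set y : R | y <= x]).

Definition fdd_converge {d d' : measure_display} {T : measurableType d}
    {T' : measurableType d'} {R : realType}
    (P : probability T R) (Y : nat -> R -> T -> R)
    (P' : probability T' R) (X : R -> T' -> R) :=
  forall (k : nat) (t : 'I_k -> R) (f : 'rV[R]_k -> R),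
    continuous f -> (exists M : R, forall x, `|f x| <= M) ->
    (fun N => 'E_P[fun w => f (\row_(j < k) Y N (t j) w)])%E @ \oo -->
      ('E_P'[fun w => f (\row_(j < k) X (t j) w)])%E.

Definition normalized_Z {d : measure_display} {T : measurableType d}
    {R : realType} (P : probability T R) (xis : nat -> R -> T -> R)
    (s : nat -> R) (N : nat) (t : R) (w : T) : R :=
  let Z := fun w => \sum_(i < N) expR (xis i (s N + t) w) in
  (Z w - fine ('E_P[Z])%E) / Num.sqrt (fine ('V_P[Z])%E).

(* Main.v *)
(** By independence and the Cramer-Wold device everything reduces to the
    characteristic function of one summand [Y], a linear combination of the
    [e^{xi(s + t_j)}] divided by the standard deviations of the [Z_N(t_j)] and
    centred: if [N (E cos Y - 1) -> - Phi(theta) v / 2] and [N E sin Y -> 0], with [v]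
    the variance of the limiting linear combination of [X], then the characteristic
    function of the sum of [N] copies tends to [exp (- Phi(theta) v / 2)].
    Fix a time [tau = s + t_0] before all the [s + t_j], let
    [e^{2 x_N} = N e^{psi(2) s}], and let [y_N] tend to infinity more slowly than
    [sqrt s].  Summands with [xi(tau) > x_N + y_N] are negligible in probability and in
    mean, by exponential Markov bounds; on [xi(tau) <= x_N - y_N] third moments are
    negligible and [cos Y - 1] may be replaced by [- Y^2 / 2].  So only the second moment
    truncated at [xi(tau) <= x_N +- y_N] matters.  Because the increments after [tau] are
    independent of [xi(tau)], this truncated moment factors into its untruncated limit
    and the probability of [xi(tau) <= x_N +- y_N] under the tilt by
    [e^{2 xi(tau) - tau psi(2)}].  Under this tilt [xi(tau)] has mean [tau psi'(2)] and
    variance [tau psi''(2)] and is asymptotically normal, so by the assumption on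
    [log N] that probability tends to [Phi(theta)] for either sign.
    The passage from characteristic functions to weak convergence uses tightness (second
    moments equal to 1) and the uniform approximation of a bounded continuous function
    on a cube by bounded trigonometric polynomials. *)

Require Import Defs.
From HB Require Import structures.
From mathcomp Require Import all_boot all_order all_algebra.
From mathcomp Require Import all_classical all_reals all_analysis.
From mathcomp Require Import measurable_realfun ring lra.
Import Order.TTheory GRing.Theory Num.Theory.
Import numFieldNormedType.Exports.
Local Open Scope classical_set_scope.
Local Open Scope ring_scope.

Set Implicit Arguments.
Unset Strict Implicit.
Unset Printing Implicit Defensive.

(** * Real-valued expectations *)

Section RealExpectation.
Context {d : measure_display} {T : measurableType d} {R : realType}.
Variable P : probability T R.
Implicit Types (f g : T -> R) (a : R).

(** Why [Phi(theta)]: inserting the assumption on [log N] gives [x_N = psi'(2) s + theta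
    sqrt(psi''(2) s) + o(sqrt s)], so the level at which a single summand reaches the standard
    deviation of the whole sum lies [theta] tilted standard deviations above the tilted mean.
    Characteristic functions stay real: pairs (E cos, E sin) together with a phase [b]. The tilt is
    a weight of mean 1, not a new measure; the weak convergence lemma carries such weights and so
    serves both the central limit theorem under the tilt and, with weight 1, the final step. The
    copies are never compared through their joint laws. Each has the exponent [psi]; all limits for
    one summand are proved for a process that may change with [N], and applying them to the index
    with the largest error makes them uniform over the [N] summands. Nonnegativity of [Phi(theta) v]
    is not derived from the covariance kernel: half of this number is a limit of
    [N (1 - E cos Y)]. *)

Definition intble f := P.-integrable setT (EFin \o f).
(* [fine] sends an infinite integral to [0], so identities for [Ex] need [intble]. *)
Definition Ex f : R := fine (\int[P]_x (f x)%:E)%E.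

Lemma intble_meas f : intble f -> measurable_fun setT f.
Proof. by move=> /integrableP[/measurable_EFinP]. Qed.

Lemma intble_dom f g : measurable_fun setT f -> (forall x, `|f x| <= g x) ->
  intble g -> intble f.
Proof.
move=> mf fg; apply: le_integrable => //; first exact/measurable_EFinP.
by move=> x _ /=; rewrite lee_fin (le_trans (fg x)) ?ler_norm.
Qed.

Lemma intble_cst a : intble (fun=> a).
Proof. exact: finite_measure_integrable_cst. Qed.

Lemma intble_bounded f a : measurable_fun setT f -> (forall x, `|f x| <= a) ->
  intble f.
Proof. by move=> mf fa; apply: (intble_dom mf fa); exact: intble_cst. Qed.

Lemma intbleD f g : intble f -> intble g -> intble (fun x => f x + g x).
Proof. by move=> fi gi; exact: (integrableD measurableT fi gi). Qed.

Lemma intbleZ a f : intble f -> intble (fun x => a * f x).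
Proof. by move=> fi; exact: (integrableZl measurableT a fi). Qed.

Lemma intbleN f : intble f -> intble (fun x => - f x).
Proof. by move=> /(intbleZ (-1)); under eq_fun do rewrite mulN1r. Qed.

Lemma intbleB f g : intble f -> intble g -> intble (fun x => f x - g x).
Proof. by move=> fi gi; apply: intbleD => //; exact: intbleN. Qed.

Lemma intble_abs f : intble f -> intble (fun x => `|f x|).
Proof. by move=> fi; exact: (integrable_abse fi). Qed.

Lemma intble_sum I (r : seq I) (Q : pred I) (F : I -> T -> R) :
  (forall i, Q i -> intble (F i)) ->
  intble (fun x => \sum_(i <- r | Q i) F i x).
Proof.
move=> Fi; rewrite /intble.
have -> : EFin \o (fun x => \sum_(i <- r | Q i) F i x) =
    (fun x => \sum_(i <- r | Q i) (F i x)%:E)%E.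
  by apply/funext => x /=; rewrite sumEFin.
by apply: (integrable_sum measurableT) => i Qi; exact: Fi.
Qed.

Lemma intble_ge0 f : measurable_fun setT f -> (forall x, 0 <= f x) ->
  (\int[P]_x (f x)%:E < +oo)%E -> intble f.
Proof.
move=> mf f0 foo; apply/integrableP; split; first exact/measurable_EFinP.
by under eq_integral => x _ do rewrite /= ger0_norm//.
Qed.

Lemma intble_int f : intble f -> (\int[P]_x (f x)%:E)%E = (Ex f)%:E.
Proof.
by move=> fi; rewrite fineK//; exact: (integrable_fin_num measurableT fi).
Qed.

Lemma eq_Ex f g : f =1 g -> Ex f = Ex g.
Proof. by move=> /funext ->. Qed.

Lemma ExD f g : intble f -> intble g -> Ex (fun x => f x + g x) = Ex f + Ex g.
Proof. by move=> fi gi; exact: (RintegralD measurableT fi gi). Qed.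

Lemma ExZ a f : intble f -> Ex (fun x => a * f x) = a * Ex f.
Proof. by move=> fi; exact: (RintegralZl a measurableT fi). Qed.

Lemma ExN f : intble f -> Ex (fun x => - f x) = - Ex f.
Proof.
by move=> fi; rewrite -mulN1r -ExZ//; apply: eq_Ex => x; rewrite mulN1r.
Qed.

Lemma ExB f g : intble f -> intble g -> Ex (fun x => f x - g x) = Ex f - Ex g.
Proof. by move=> fi gi; rewrite ExD ?ExN//; exact: intbleN. Qed.

Lemma Ex_cst a : Ex (fun=> a) = a.
Proof.
have := Rintegral_cst P measurableT a.
have -> : fine (P setT) = 1 by rewrite probability_setT.
by rewrite mulr1.
Qed.

Lemma Ex_sum I (r : seq I) (Q : pred I) (F : I -> T -> R) :
  (forall i, Q i -> intble (F i)) ->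
  Ex (fun x => \sum_(i <- r | Q i) F i x) = \sum_(i <- r | Q i) Ex (F i).
Proof.
move=> Fi; elim: r => [|i r ih].
  by rewrite big_nil; under eq_Ex do rewrite big_nil; exact: Ex_cst.
rewrite big_cons; under eq_Ex do rewrite big_cons.
case: ifP => Qi; last exact: ih.
by rewrite ExD ?ih//; [exact: Fi|exact: intble_sum].
Qed.

Lemma le_Ex f g : intble f -> intble g -> (forall x, f x <= g x) -> Ex f <= Ex g.
Proof. by move=> fi gi fg; exact: (le_Rintegral measurableT fi gi (fun x _ => fg x)). Qed.

Lemma Ex_ge0 f : (forall x, 0 <= f x) -> 0 <= Ex f.
Proof. by move=> f0; apply: fine_ge0; apply: integral_ge0 => x _; rewrite lee_fin. Qed.

Lemma normr_Ex_le f g : intble f -> intble g -> (forall x, `|f x| <= g x) ->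
  `|Ex f| <= Ex g.
Proof.
move=> fi gi fg; apply: le_trans (le_normr_Rintegral measurableT fi) _.
by apply: le_Ex => //; exact: intble_abs.
Qed.

Lemma intble_ae f g : measurable_fun setT g -> {ae P, forall x, f x = g x} ->
  intble f -> intble g.
Proof.
move=> mg fg fi; have mf := intble_meas fi.
apply/integrableP; split; first exact/measurable_EFinP.
move/integrableP : fi => [_]; congr (_ < _)%E.
apply: ae_eq_integral => //=.
- by do 2 apply: measurableT_comp => //.
- by do 2 apply: measurableT_comp => //.
- by apply: filterS fg => x /= -> _.
Qed.

Lemma Ex_ae f g : measurable_fun setT f -> measurable_fun setT g ->
  {ae P, forall x, f x = g x} -> Ex f = Ex g.
Proof.
move=> mf mg fg; congr fine; apply: ae_eq_integral => //.
- exact/measurable_EFinP.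
- exact/measurable_EFinP.
- by apply: filterS fg => x /= -> _.
Qed.

Lemma Ex_indic (A : set T) : measurable A -> Ex (\1_A) = fine (P A).
Proof. by move=> mA; rewrite /Ex integral_indic// setIT. Qed.

Lemma Ex_eq0 f : intble f -> (forall x, 0 <= f x) -> Ex f = 0 ->
  {ae P, forall x, f x = 0}.
Proof.
move=> fi f0 E0; have mf := intble_meas fi.
have /(ae_eq_integral_abs P measurableT) : measurable_fun setT (EFin \o f).
  exact/measurable_EFinP.
case=> + _; have -> : (\int[P]_x `|(EFin \o f) x|)%E = 0%E.
  under eq_integral => x _ do rewrite /= ger0_norm//.
  by rewrite intble_int// E0.
move=> /(_ erefl); apply: filterS => x /= /(_ I) [].
by [].
Qed.

End RealExpectation.

Lemma measurable_cos_comp {d} {T : measurableType d} {R : realType} (f : T -> R) :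
  measurable_fun setT f -> measurable_fun setT (fun x => cos (f x)).
Proof.
by move=> mf; apply: measurableT_comp mf; apply: continuous_measurable_fun; exact: continuous_cos.
Qed.

Lemma measurable_sin_comp {d} {T : measurableType d} {R : realType} (f : T -> R) :
  measurable_fun setT f -> measurable_fun setT (fun x => sin (f x)).
Proof.
by move=> mf; apply: measurableT_comp mf; apply: continuous_measurable_fun; exact: continuous_sin.
Qed.

Lemma measurable_expR_comp {d} {T : measurableType d} {R : realType} (f : T -> R) :
  measurable_fun setT f -> measurable_fun setT (fun x => expR (f x)).
Proof. by move=> mf; apply: measurableT_comp mf; exact: measurable_expR. Qed.

(** * Products of independent factors *)

Section Independence.
Context {d : measure_display} {T : measurableType d} {R : realType}.
Variable P : probability T R.

Import HBNNSimple.

Lemma nnsfun_sum d' (U : measurableType d') (f : {nnsfun U >-> R}) : exists k (s : 'I_k -> R),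
  (forall i, 0 <= s i) /\
  forall x, f x = \sum_(i < k) s i * \1_(f @^-1` [set s i]) x.
Proof.
eexists; eexists; split; last by move=> x; exact: fimfunEord.
move=> i /=; set y := nth _ _ _.
have : y \in (range f : set R).
  by rewrite -in_fset_set; [exact: (mem_nth 0 (ltn_ord i))|exact: fimfunP].
by rewrite inE => -[x _ <-].
Qed.

(** The same simple functions of the value approximate [g] and [g'] from below; the hypothesis
    treats their level sets and monotone convergence concludes. Used for independence, with [h] the
    product of the remaining factors, and for densities, with [mu] the Lebesgue measure and [h] the
    normal density. *)
Lemma ge0_integral_weight {d'} {T' : measurableType d'}
    (mu : {measure set T -> \bar R}) (nu : {measure set T' -> \bar R})
    (g h : T -> R) (g' : T' -> R) (C : \bar R) :
  measurable_fun setT g -> measurable_fun setT h -> measurable_fun setT g' ->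
  (forall x, 0 <= g x) -> (forall x, 0 <= g' x) -> (forall x, 0 <= h x) ->
  (0 <= C)%E ->
  (forall B : set R, measurable B ->
    (\int[mu]_x (\1_(g @^-1` B) x * h x)%:E = C * nu (g' @^-1` B))%E) ->
  (\int[mu]_x (g x * h x)%:E = C * \int[nu]_x (g' x)%:E)%E.
Proof.
move=> mg mh mg' g0 g'0 h0 C0 gh.
(* The absolute value stands in for the identity, since approximation from below needs a function
   that is nonnegative on the whole line. *)
have mid : measurable_fun setT (fun y : R => (`|y|)%:E).
  by apply/measurable_EFinP; exact: normr_measurable.
pose psi := nnsfun_approx measurableT mid.
have mpsi n : measurable_fun setT (fun x => psi n (g x)).
  by apply: (measurableT_comp _ mg).
have mpsi' n : measurable_fun setT (fun x => psi n (g' x)).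
  by apply: (measurableT_comp _ mg').
have psi_cvg (x : R) : 0 <= x -> (psi n x)%:E @[n --> \oo] --> x%:E.
  move=> x0; have := @cvg_nnsfun_approx _ _ _ _ measurableT _ mid (fun y _ => normr_ge0 y) x I.
  by rewrite ger0_norm.
have psi_nd (x : R) : {homo (fun n => psi n x) : m n / (m <= n)%N >-> m <= n}.
  by move=> m n mn; have /lefP := @nd_nnsfun_approx _ _ _ _ measurableT _ mid m n mn; exact.
have step n : (\int[mu]_x (psi n (g x) * h x)%:E = C * \int[nu]_x (psi n (g' x))%:E)%E.
  have mB y : measurable (psi n @^-1` [set y] : set R) by [].
  have [k [s [s0 psiE]]] := nnsfun_sum (psi n).
  have mI (i : 'I_k) : measurable_fun setT (fun x => s i * \1_(g' @^-1` (psi n @^-1` [set s i])) x).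
    apply: measurable_funM => //; apply: measurable_indic.
    by rewrite -[X in measurable X]setTI; exact: mg'.
  transitivity (\int[mu]_x (\sum_(i < k) (s i)%:E *
      (\1_(g @^-1` (psi n @^-1` [set s i])) x * h x)%:E))%E.
    apply: eq_integral => x _; rewrite psiE mulr_suml -sumEFin.
    by apply: eq_bigr => i _; rewrite -EFinM mulrA.
  rewrite ge0_integral_sum//; last 2 first.
  - move=> i; apply/measurable_EFinP; apply: measurable_funM => //.
    apply: measurable_funM => //; apply: measurable_indic.
    by rewrite -[X in measurable X]setTI; exact: mg.
  - by move=> i x _; rewrite -EFinM lee_fin !mulr_ge0.
  have -> : (\int[nu]_x (psi n (g' x))%:E = \sum_(i < k) (s i)%:E * nu (g' @^-1` (psi n @^-1` [set s i])))%E.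
    transitivity (\int[nu]_x (\sum_(i < k) (s i)%:E *
      (\1_(g' @^-1` (psi n @^-1` [set s i])) x)%:E))%E.
      apply: eq_integral => x _; rewrite psiE -sumEFin.
      by apply: eq_bigr => i _; rewrite -EFinM.
    rewrite ge0_integral_sum//; last first.
    - by move=> i x _; rewrite -EFinM lee_fin !mulr_ge0.
    - move=> i; under eq_fun do rewrite -EFinM; apply/measurable_EFinP; exact: mI.
    apply: eq_bigr => i _.
    have mA : measurable (g' @^-1` (psi n @^-1` [set s i])).
      by rewrite -[X in measurable X]setTI; exact: mg'.
    rewrite ge0_integralZl_EFin//; last first.
      by apply/measurable_EFinP; exact: measurable_indic.
    by rewrite integral_indic// setIT.
  rewrite ge0_sume_distrr; last by move=> i _; rewrite mule_ge0 ?lee_fin.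
  apply: eq_bigr => i _.
  rewrite ge0_integralZl_EFin//; last 2 first.
  - by move=> x _; rewrite lee_fin mulr_ge0.
  - apply/measurable_EFinP; apply: measurable_funM => //; apply: measurable_indic.
    by rewrite -[X in measurable X]setTI; exact: mg.
  by rewrite gh// muleCA.
have L1 : (\int[mu]_x (psi n (g x) * h x)%:E)%E @[n --> \oo] -->
    (\int[mu]_x (g x * h x)%:E)%E.
  have : (\int[mu]_x (g x * h x)%:E)%E = (\int[mu]_x limn (fun n => (psi n (g x) * h x)%:E))%E.
    apply: eq_integral => x _; apply/esym/cvg_lim => //.
    rewrite EFinM; under eq_fun do rewrite EFinM.
    by apply: cvgeZr => //; exact/psi_cvg.
  move=> ->; apply: (@cvg_monotone_convergence _ _ _ mu _ measurableT (fun n x => (psi n (g x) * h x)%:E)).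
  - by move=> n; apply/measurable_EFinP; exact: measurable_funM.
  - by move=> n x _; rewrite lee_fin mulr_ge0.
  - by move=> x _ m n mn; rewrite lee_fin ler_wpM2r//; exact: psi_nd.
have L2 : (\int[nu]_x (psi n (g' x))%:E)%E @[n --> \oo] --> (\int[nu]_x (g' x)%:E)%E.
  have : (\int[nu]_x (g' x)%:E)%E = (\int[nu]_x limn (fun n => (psi n (g' x))%:E))%E.
    by apply: eq_integral => x _; apply/esym/cvg_lim => //; exact/psi_cvg.
  move=> ->; apply: (@cvg_monotone_convergence _ _ _ nu _ measurableT (fun n x => (psi n (g' x))%:E)).
  - by move=> n; apply/measurable_EFinP; exact: mpsi'.
  - by move=> n x _; rewrite lee_fin.
  - by move=> x _ m n mn; rewrite lee_fin; exact: psi_nd.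
have Ig0 : (0 <= \int[nu]_x (g' x)%:E)%E by apply: integral_ge0 => x _; rewrite lee_fin.
apply: (cvg_unique _ L1) => //.
rewrite (_ : (fun n => _) = fun n => (C * \int[nu]_x (psi n (g' x))%:E)%E); last first.
  by apply/funext => n; exact: step.
(* [C] and the integral may be infinite, so the cases where one of them is zero are settled apart,
   before the product of limits is taken. *)
have [->|Cn0] := eqVneq C 0%E.
  by rewrite mul0e; apply: cvg_near_cst; apply: nearW => n; rewrite mul0e.
have [E0|En0] := eqVneq (\int[nu]_x (g' x)%:E)%E 0%E.
  rewrite E0 mule0; apply: cvg_near_cst; apply: nearW => n.
  have -> : (\int[nu]_x (psi n (g' x))%:E)%E = 0%E; last by rewrite mule0.
  apply/eqP; rewrite eq_le; apply/andP; split; last first.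
    by apply: integral_ge0 => x _; rewrite lee_fin.
  rewrite -E0; apply: ge0_le_integral => //.
  - by move=> x _; rewrite lee_fin.
  - by apply/measurable_EFinP; exact: mpsi'.
  - exact/measurable_EFinP.
  - move=> x _; have /cvg_lim <- := psi_cvg (g' x) (g'0 x) => //.
    rewrite (cvg_lim _ (ereal_nondecreasing_cvgn _))//.
      by apply: ereal_sup_ubound; exists n.
    by move=> m k mk; rewrite lee_fin; exact: psi_nd.
apply: cvgeM => //; last exact: cvg_cst.
move: En0 Cn0 Ig0 C0; rewrite /mule_def.
by case: C gh step => [r| |]//= _ _; case: (\int[nu]_x (g' x)%:E)%E => [r'| |]//=.
Qed.

Context {I : eqType} (J : set I) (F : I -> set (set T)).
Hypothesis indF : mutually_independent P J F.
Hypothesis measF : forall i, J i -> F i `<=` measurable.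

Definition adapted (i : I) (f : T -> R) :=
  forall B : set R, measurable B -> F i (f @^-1` B).

Lemma adapted_measurable i f : J i -> adapted i f -> measurable_fun setT f.
Proof. by move=> Ji af _ B mB; rewrite setTI; apply: measF Ji _ (af _ mB). Qed.

Let upd {V : Type} (g : I -> V) i f := fun j => if j == i then f else g j.

Let updE {V : Type} (g : I -> V) i f : upd g i f i = f.
Proof. by rewrite /upd eqxx. Qed.

Let big_upd {V : Type} {idx : V} {op : V -> V -> V} {W : Type}
    (r : seq I) (g : I -> W) i f (k : I -> W -> V) :
  i \notin r -> \big[op/idx]_(j <- r) k j (upd g i f j) = \big[op/idx]_(j <- r) k j (g j).
Proof.
move=> ir; rewrite big_seq [RHS]big_seq; apply: eq_bigr => j jr; rewrite /upd.
by case: eqP => // ji; rewrite -ji jr in ir.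
Qed.

(** Interpolates between independence of events ([r1] empty) and the product formula for functions
    ([r2] empty). A function leaves [r1] through [ge0_integral_weight], whose hypothesis for a set
    [B] is the induction hypothesis with the preimage of [B] put into [r2]. *)
Lemma ge0_integral_prod_indic (r1 r2 : seq I) (g : I -> T -> R) (A : I -> set T) :
  uniq (r1 ++ r2) -> (forall i, i \in r1 ++ r2 -> J i) ->
  (forall i, i \in r1 -> adapted i (g i)) -> (forall i x, 0 <= g i x) ->
  (forall i, i \in r2 -> F i (A i)) ->
  (\int[P]_x ((\prod_(i <- r1) g i x) * \prod_(i <- r2) \1_(A i) x)%:E =
   (\prod_(i <- r1) \int[P]_x (g i x)%:E) * \prod_(i <- r2) P (A i))%E.
Proof.
elim: r1 r2 A => [|i r1 ih] r2 A; rewrite ?cat0s.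
  move=> ur rJ _ _ rA; rewrite big_nil mul1e.
  have mA : measurable (\big[setI/setT]_(i <- r2) A i).
    by rewrite big_seq; apply: bigsetI_measurable => i ir; apply: measF (rJ _ ir) _ (rA _ ir).
  rewrite -(indF ur rJ rA).
  have -> : P (\big[setI/setT]_(i <- r2) A i) =
      (\int[P]_x (\1_(\big[setI/setT]_(i <- r2) A i) x)%:E)%E.
    by rewrite integral_indic// setIT.
  apply: eq_integral => x _; congr EFin; rewrite big_nil mul1r.
  elim: r2 {ur rJ rA mA} => [|j r2 ih2]; rewrite ?big_nil ?indicT// !big_cons ih2.
  by rewrite indicI.
rewrite cat_cons cons_uniq mem_cat negb_or => /andP[/andP[ir1 ir2] ur] rJ ag g0 rA.
have Ji : J i by apply: rJ; rewrite mem_head.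
have mg j : j \in i :: r1 -> measurable_fun setT (g j).
  move=> jr; apply: (@adapted_measurable j); last exact: ag.
  by apply: rJ; rewrite -cat_cons mem_cat jr.
have mAj j : j \in r2 -> measurable (A j).
  by move=> jr; apply: (@measF j); [apply: rJ; rewrite in_cons mem_cat jr !orbT|exact: rA].
under eq_integral do rewrite big_cons -mulrA.
rewrite (@ge0_integral_weight _ _ P P (g i) _ (g i)
   ((\prod_(i0 <- r1) (\int[P]_x (g i0 x)%:E)) * \prod_(i0 <- r2) P (A i0))%E).
- by rewrite big_cons muleC muleA.
- by apply: mg; rewrite mem_head.
- apply: measurable_funM.
  + by apply: measurable_prod => j jr; apply: mg; rewrite in_cons jr orbT.
  + by apply: measurable_prod => j jr; apply: measurable_indic; exact: mAj.
- by apply: mg; rewrite mem_head.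
- exact: g0.
- exact: g0.
- by move=> x; rewrite mulr_ge0// prodr_ge0.
- rewrite mule_ge0//; apply: prode_ge0 => j _ //.
  by apply: integral_ge0 => x _; rewrite lee_fin.
move=> B mB; have aB : F i (g i @^-1` B) by apply: ag => //; rewrite mem_head.
have := ih (i :: r2) (upd A i (g i @^-1` B)).
rewrite !big_cons (@big_upd _ _ _ _ _ _ _ _ (fun=> P))// updE.
rewrite muleCA [in RHS]muleC => <-.
- apply: eq_integral => x _; rewrite big_cons (@big_upd _ _ _ _ _ _ _ _ (fun=> (fun E => \1_E x)))//.
  by rewrite updE mulrCA.
- have pe : perm_eq (r1 ++ i :: r2) (i :: r1 ++ r2).
    by have /permPl := perm_catCA r1 [:: i] r2.
  by rewrite (perm_uniq pe)/= mem_cat negb_or ir1 ir2.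
- move=> j; rewrite mem_cat in_cons => jr; apply: rJ; rewrite in_cons mem_cat.
  by case/or3P: jr => ->; rewrite ?orbT.
- by move=> j jr; apply: ag; rewrite in_cons jr orbT.
- exact: g0.
- move=> j; rewrite in_cons /upd; case: eqP => [->//|_ /= jr]; exact: rA.
Qed.

Lemma ge0_integral_prod (r : seq I) (g : I -> T -> R) :
  uniq r -> (forall i, i \in r -> J i) ->
  (forall i, i \in r -> adapted i (g i)) -> (forall i x, 0 <= g i x) ->
  (\int[P]_x (\prod_(i <- r) g i x)%:E = \prod_(i <- r) \int[P]_x (g i x)%:E)%E.
Proof.
move=> ur rJ ag g0.
have := @ge0_integral_prod_indic r [::] g (fun=> setT).
rewrite cats0 big_nil mule1 => <- //.
by apply: eq_integral => x _; rewrite big_nil mulr1.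
Qed.

Lemma intble_prod_ge0 (r : seq I) (g : I -> T -> R) :
  uniq r -> (forall i, i \in r -> J i) ->
  (forall i, i \in r -> adapted i (g i)) -> (forall i x, 0 <= g i x) ->
  (forall i, i \in r -> intble P (g i)) ->
  intble P (fun x => \prod_(i <- r) g i x) /\
  Ex P (fun x => \prod_(i <- r) g i x) = \prod_(i <- r) Ex P (g i).
Proof.
move=> ur rJ ag g0 gi.
have E : (\int[P]_x (\prod_(i <- r) g i x)%:E = (\prod_(i <- r) Ex P (g i))%:E)%E.
  rewrite ge0_integral_prod// -prodEFin big_seq [RHS]big_seq.
  by apply: eq_bigr => i ir; rewrite intble_int//; exact: gi.
split; last by rewrite /Ex E.
apply: intble_ge0; last by rewrite E ltry.
- by apply: measurable_prod => j jr; apply: intble_meas; exact: gi.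
- by move=> x; rewrite prodr_ge0.
Qed.

Lemma Ex_prod (r : seq I) (g : I -> T -> R) :
  uniq r -> (forall i, i \in r -> J i) ->
  (forall i, i \in r -> adapted i (g i)) ->
  (forall i, i \in r -> intble P (g i)) ->
  intble P (fun x => \prod_(i <- r) g i x) /\
  Ex P (fun x => \prod_(i <- r) g i x) = \prod_(i <- r) Ex P (g i).
Proof.
(* [r2] collects the factors known to be nonnegative. The head of [r1] is split into its positive
   and negative parts, each of which joins [r2] in its turn. *)
suff H (r1 r2 : seq I) : uniq (r1 ++ r2) -> (forall i, i \in r1 ++ r2 -> J i) ->
  (forall i, i \in r1 ++ r2 -> adapted i (g i)) ->
  (forall i, i \in r1 ++ r2 -> intble P (g i)) ->
  (forall i x, i \in r2 -> 0 <= g i x) ->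
  intble P (fun x => \prod_(i <- r1 ++ r2) g i x) /\
  Ex P (fun x => \prod_(i <- r1 ++ r2) g i x) = \prod_(i <- r1 ++ r2) Ex P (g i).
  by move=> ur rJ ra ri; have := H r [::]; rewrite cats0; apply.
elim: r1 r2 g => [|i r1 ih] r2 g.
  rewrite cat0s => ur rJ ra ri g0.
  pose g' i x := `|g i x|.
  have gg' i : i \in r2 -> g i = g' i.
    by move=> ir; apply/funext => x; rewrite /g' ger0_norm ?g0.
  have <- : (fun x => \prod_(i <- r2) g' i x) = (fun x => \prod_(i <- r2) g i x).
    by apply/funext => x; rewrite big_seq [RHS]big_seq; apply: eq_bigr => i /gg' ->.
  have <- : \prod_(i <- r2) Ex P (g' i) = \prod_(i <- r2) Ex P (g i).
    by rewrite big_seq [RHS]big_seq; apply: eq_bigr => i /gg' ->.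
  apply: intble_prod_ge0 => //.
  - by move=> i ir; rewrite -gg'//; exact: ra.
  - by move=> i x; rewrite /g'.
  - by move=> i ir; rewrite -gg'//; exact: ri.
rewrite cat_cons cons_uniq mem_cat negb_or => /andP[/andP[ir1 ir2] ur] rJ ra ri g0.
pose p x := Num.max (g i x) 0; pose n x := Num.max (- g i x) 0.
have gpn x : g i x = p x - n x.
  rewrite /p /n; case: (leP (g i x) 0) => h.
    by rewrite max_l ?oppr_ge0// sub0r opprK.
  by rewrite max_r ?subr0// oppr_le0 ltW.
have gi : intble P (g i) by apply: ri; rewrite mem_head.
have ai : adapted i (g i) by apply: ra; rewrite mem_head.
have mgi := intble_meas gi.
have key q : intble P q -> adapted i q -> (forall x, 0 <= q x) ->
    intble P (fun x => q x * \prod_(j <- r1 ++ r2) g j x) /\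
    Ex P (fun x => q x * \prod_(j <- r1 ++ r2) g j x) =
    Ex P q * \prod_(j <- r1 ++ r2) Ex P (g j).
  move=> qi qa q0.
  have pe : perm_eq (r1 ++ i :: r2) (i :: r1 ++ r2).
    by have /permPl := perm_catCA r1 [:: i] r2.
  have := ih (i :: r2) (upd g i q).
  rewrite (perm_uniq pe) cons_uniq mem_cat negb_or ir1 ir2 ur.
  rewrite (perm_big _ pe) big_cons (@big_upd _ _ _ _ _ _ _ _ (fun=> Ex P)); last by rewrite mem_cat negb_or ir1.
  rewrite updE.
  have -> : (fun x => \prod_(i0 <- r1 ++ i :: r2) upd g i q i0 x) =
      (fun x => q x * \prod_(j <- r1 ++ r2) g j x).
    apply/funext => x; rewrite (perm_big _ pe) big_cons.
    rewrite (@big_upd _ _ _ _ _ _ _ _ (fun=> (fun f => f x))); last by rewrite mem_cat negb_or ir1.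
    by rewrite updE.
  apply => //.
  - by move=> j; rewrite (perm_mem pe); exact: rJ.
  - by move=> j; rewrite (perm_mem pe) /upd; case: eqP => [->//|_]; exact: ra.
  - by move=> j; rewrite (perm_mem pe) /upd; case: eqP => [->//|_]; exact: ri.
  - by move=> j x; rewrite in_cons /upd; case: eqP => //= _; exact: g0.
have mabs : intble P (fun x => `|g i x|) by exact: intble_abs.
have mmax (q : T -> R) : measurable_fun setT q -> measurable_fun setT (fun x : T => Num.max (q x) 0).
  by move=> mq; apply: measurable_maxr.
have adm (phi : R -> R) : measurable_fun setT phi -> adapted i (phi \o g i).
  by move=> mphi B mB; rewrite comp_preimage; apply: ai; rewrite -[X in measurable X]setTI; exact: mphi.
have [||| pi pE] := key p.
- apply: intble_dom mabs; first exact: mmax.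
  by move=> x; rewrite /p ger0_norm ?le_max ?lexx ?orbT// ge_max normr_ge0 ler_norm.
- by apply: (adm (fun y => Num.max y 0)); exact: measurable_maxr.
- by move=> x; rewrite le_max lexx orbT.
have [||| ni nE] := key n.
- apply: intble_dom mabs; first by apply: mmax; exact: measurable_funN.
  by move=> x; rewrite /n ger0_norm ?le_max ?lexx ?orbT// ge_max normr_ge0 -normrN ler_norm.
- apply: (adm (fun y => Num.max (- y) 0)); apply: measurable_maxr => //.
- by move=> x; rewrite le_max lexx orbT.
have Eq : (fun x => \prod_(i <- i :: r1 ++ r2) g i x) =
  (fun x => p x * \prod_(j <- r1 ++ r2) g j x - n x * \prod_(j <- r1 ++ r2) g j x).
  by apply/funext => x; rewrite big_cons gpn mulrBl.
rewrite Eq; split; first exact: intbleB.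
rewrite ExB// pE nE -mulrBl big_cons; congr (_ * _).
rewrite -ExB; first by apply: eq_Ex => x; rewrite -gpn.
- apply: intble_dom mabs; first exact: mmax.
  by move=> x; rewrite /p ger0_norm ?le_max ?lexx ?orbT// ge_max normr_ge0 ler_norm.
- apply: intble_dom mabs; first by apply: mmax; exact: measurable_funN.
  by move=> x; rewrite /n ger0_norm ?le_max ?lexx ?orbT// ge_max normr_ge0 -normrN ler_norm.
Qed.

End Independence.

(** * Transfer of laws and Cauchy's functional equation *)

Lemma same_law_integral {d d'} {T : measurableType d} {T' : measurableType d'}
    {R : realType} (P : probability T R) (P' : probability T' R)
    (X : T -> R) (Y : T' -> R) :
  measurable_fun setT X -> measurable_fun setT Y ->
  (forall B : set R, measurable B -> P (X @^-1` B) = P' (Y @^-1` B)) ->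
  forall phi : R -> R, measurable_fun setT phi ->
  (\int[P]_x (phi (X x))%:E = \int[P']_y (phi (Y y))%:E)%E.
Proof.
move=> mX mY XY phi mphi.
have pos (f : R -> \bar R) : measurable_fun setT f -> (forall y, 0 <= f y)%E ->
    (\int[P]_x (f (X x)) = \int[P']_y (f (Y y)))%E.
  move=> mf f0.
  pose mXm := isMeasurableFun.Build _ _ _ _ _ mX.
  pose X' : {mfun T >-> R} := HB.pack X mXm.
  pose mYm := isMeasurableFun.Build _ _ _ _ _ mY.
  pose Y' : {mfun T' >-> R} := HB.pack Y mYm.
  rewrite -(@ge0_integral_distribution _ _ _ _ _ P X' f)//.
  rewrite -(@ge0_integral_distribution _ _ _ _ _ P' Y' f)//.
  by apply: eq_measure_integral => A mA _; exact: XY.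
have mphiE : measurable_fun setT (EFin \o phi) by exact/measurable_EFinP.
rewrite integralE [RHS]integralE; congr (_ - _)%E.
  have := pos _ (measurable_funepos mphiE) (funepos_ge0 _).
  by rewrite !unlock.
have := pos _ (measurable_funeneg mphiE) (funeneg_ge0 _).
by rewrite !unlock.
Qed.

Lemma same_law_Ex {d d'} {T : measurableType d} {T' : measurableType d'}
    {R : realType} (P : probability T R) (P' : probability T' R)
    (X : T -> R) (Y : T' -> R) :
  measurable_fun setT X -> measurable_fun setT Y ->
  (forall B : set R, measurable B -> P (X @^-1` B) = P' (Y @^-1` B)) ->
  forall phi : R -> R, measurable_fun setT phi ->
  Ex P (fun x => phi (X x)) = Ex P' (fun y => phi (Y y)).
Proof. by move=> mX mY XY phi mphi; rewrite /Ex (same_law_integral mX mY XY). Qed.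

Lemma same_law_intble {d d'} {T : measurableType d} {T' : measurableType d'}
    {R : realType} (P : probability T R) (P' : probability T' R)
    (X : T -> R) (Y : T' -> R) :
  measurable_fun setT X -> measurable_fun setT Y ->
  (forall B : set R, measurable B -> P (X @^-1` B) = P' (Y @^-1` B)) ->
  forall phi : R -> R, measurable_fun setT phi ->
  intble P' (fun y => phi (Y y)) -> intble P (fun x => phi (X x)).
Proof.
move=> mX mY XY phi mphi /integrableP[_ fin]; apply/integrableP; split.
  by apply/measurable_EFinP; exact: (measurableT_comp mphi mX).
have := same_law_integral mX mY XY (measurableT_comp (@normr_measurable R setT) mphi).
by move=> /= ->.
Qed.

(** Subtract the linear candidate: [g t = m t - t * m 1] is additive and vanishes at [1/M] with
    [1/M <= del], hence has period [1/M] and is bounded below everywhere. A negative value would be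
    multiplied by every integer, so [g >= 0]; finally [g t + g (n - t) = g n = 0] forces
    [g t = 0]. *)
Lemma additive_bounded_below_linear {R : realType} (m : R -> R) (c del : R) :
  0 < del -> (forall s t, 0 <= s -> 0 <= t -> m (s + t) = m s + m t) ->
  (forall t, 0 < t -> t <= del -> - c <= m t) ->
  forall t, 0 <= t -> m t = t * m 1.
Proof.
move=> del0 madd mlb.
pose g t := m t - t * m 1.
have gD s t : 0 <= s -> 0 <= t -> g (s + t) = g s + g t.
  by move=> s0 t0; rewrite /g madd//; ring.
have g0 : g 0 = 0.
  by have := gD 0 0 (lexx _) (lexx _); rewrite addr0 => /eqP; rewrite eq_sym -subr_eq0 addrK => /eqP.
have gM n t : 0 <= t -> g (n%:R * t) = n%:R * g t.
  move=> t0; elim: n => [|n ih]; first by rewrite !mul0r g0.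
  by rewrite -natr1 !mulrDl !mul1r gD ?ih ?mulr_ge0.
pose M := (Num.truncn del^-1).+1.
have M0 : 0 < M%:R :> R by rewrite ltr0n.
have Mdel : M%:R^-1 <= del.
  rewrite -[leRHS]invrK lef_pV2 ?posrE ?invr_gt0//.
  by apply/ltW; rewrite /M truncnS_gt.
have gMV : g M%:R^-1 = 0.
  have := gM M M%:R^-1; rewrite mulfV ?gt_eqF// {1}/g mul1r subrr.
  by rewrite invr_ge0 ltW// => /(_ isT)/esym/eqP; rewrite mulf_eq0 gt_eqF//= => /eqP.
pose K := `|c| + del * `|m 1|.
have K0 : 0 <= K by rewrite addr_ge0// mulr_ge0// ltW.
have glow x : 0 <= x -> - K <= g x.
  move=> x0; pose j := Num.truncn (x * M%:R).
  have xM0 : 0 <= x * M%:R by rewrite mulr_ge0// ltW.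
  have /andP[j1 j2] := truncn_itv xM0; rewrite -/j in j1 j2.
  pose r := x - j%:R * M%:R^-1.
  have r0 : 0 <= r by rewrite subr_ge0 ler_pdivrMr.
  have rd : r <= del.
    apply: le_trans Mdel; rewrite lerBlDr -[X in X + _]mul1r -mulrDl.
    by rewrite ler_pdivlMr// addrC natr1 ltW.
  have xE : x = j%:R * M%:R^-1 + r by rewrite addrC subrK.
  have MV0 : 0 <= M%:R^-1 :> R by rewrite invr_ge0 ltW.
  rewrite xE gD ?mulr_ge0// gM// gMV mulr0 add0r.
  have [->|rn0] := eqVneq r 0; first by rewrite g0 oppr_le0.
  have rp : 0 < r by rewrite lt_neqAle eq_sym rn0.
  have := mlb _ rp rd; rewrite /g /K.
  have := ler_norm c; have := ler_norm (m 1).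
  have : r * m 1 <= del * `|m 1|.
    apply: (@le_trans _ _ (r * `|m 1|)); first by rewrite ler_wpM2l ?ler_norm.
    by rewrite ler_wpM2r.
  lra.
have gge0 x : 0 <= x -> 0 <= g x.
  move=> x0; rewrite leNgt; apply/negP => gx0.
  pose n := (Num.truncn (K / - g x)).+1.
  have := glow (n%:R * x); rewrite gM// mulr_ge0// => /(_ isT).
  apply/negP; rewrite -ltNge ltrNr -mulrN.
  by rewrite -ltr_pdivrMr ?oppr_gt0// /n truncnS_gt.
move=> t t0.
suff : g t = 0 by rewrite /g => /eqP; rewrite subr_eq0 => /eqP.
apply/eqP; rewrite eq_le gge0// andbT.
pose n := (Num.truncn t).+1.
have nt : 0 <= n%:R - t by rewrite subr_ge0 ltW// truncnS_gt.
have : g (t + (n%:R - t)) = 0.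
  by rewrite addrC subrK -[n%:R]mulr1 gM// /g mul1r subrr mulr0.
by rewrite gD// => /eqP; rewrite addr_eq0 => /eqP ->; rewrite oppr_le0 gge0.
Qed.

(** * Exponential moments of a Levy process *)

Section Levy.
Context {d : measure_display} {T : measurableType d} {R : realType}.
Variables (P : probability T R) (xi : R -> T -> R).
Hypothesis levy : levy_process P xi.

Lemma levy_measurable t : 0 <= t -> measurable_fun setT (xi t).
Proof. by case: levy => + _ _ _ _; exact. Qed.

Lemma levy_incr_measurable s t : 0 <= s -> s <= t ->
  measurable_fun setT (fun w => xi t w - xi s w).
Proof.
by move=> s0 st; apply: measurable_funB; apply: levy_measurable; rewrite ?(le_trans s0).
Qed.

Lemma levy_incr_law s t : 0 <= s -> s <= t -> forall B : set R, measurable B ->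
  P ((fun w => xi t w - xi s w) @^-1` B) = P (xi (t - s) @^-1` B).
Proof. by case: levy => _ _ + _ _; exact. Qed.

Section Increments.
Variables (n : nat) (u : nat -> R) (phi : nat -> R -> R).
Hypothesis u0 : 0 <= u 0%N.
Hypothesis umono : forall j, (j < n)%N -> u j <= u j.+1.
Hypothesis mphi : forall j, measurable_fun setT (phi j).

Let uge0 j : (j <= n)%N -> 0 <= u j.
Proof.
elim: j => // j ih jn; apply: le_trans (ih (ltnW jn)) _; exact: umono.
Qed.

Let D j w := xi (u j.+1) w - xi (u j) w.

Let mD j : (j < n)%N -> measurable_fun setT (D j).
Proof. by move=> jn; apply: levy_incr_measurable; [exact/uge0/ltnW|exact: umono]. Qed.

Let indD : mutually_independent P [set j | (j < n)%N] (fun j => sigma_rv (D j)).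
Proof. by case: levy => _ _ _ + _; exact. Qed.

Let measD j : [set j | (j < n)%N] j -> sigma_rv (D j) `<=` measurable.
Proof.
move=> /= jn; apply: smallest_sub; first exact: sigma_algebra_measurable.
by move=> _ [B mB <-]; rewrite -[X in measurable X]setTI; exact: (mD jn).
Qed.

Let adD j : adapted (fun j => sigma_rv (D j)) j (phi j \o D j).
Proof.
move=> B mB; rewrite comp_preimage; apply: sub_gen_smallest.
exists (phi j @^-1` B) => //; rewrite -[X in measurable X]setTI; exact: mphi.
Qed.

Lemma levy_incr_Ex_prod :
  (forall j, (j < n)%N -> intble P (fun w => phi j (xi (u j.+1 - u j) w))) ->
  intble P (fun w => \prod_(0 <= j < n) phi j (xi (u j.+1) w - xi (u j) w)) /\
  Ex P (fun w => \prod_(0 <= j < n) phi j (xi (u j.+1) w - xi (u j) w)) =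
  \prod_(0 <= j < n) Ex P (fun w => phi j (xi (u j.+1 - u j) w)).
Proof.
move=> ii.
have jn j : j \in index_iota 0 n -> (j < n)%N by rewrite mem_index_iota.
have md j : (j < n)%N -> measurable_fun setT (xi (u j.+1 - u j)).
  by move=> jl; apply: levy_measurable; rewrite subr_ge0 umono.
have law j (jl : (j < n)%N) := levy_incr_law (uge0 (ltnW jl)) (umono jl).
have [] := @Ex_prod _ _ _ P _ _ _ indD measD (index_iota 0 n) (fun j => phi j \o D j).
- exact: iota_uniq.
- by move=> j /jn.
- by move=> j _; exact: adD.
- move=> j /jn jl; apply: (@same_law_intble _ _ _ _ _ P P (D j) (xi (u j.+1 - u j))) => //.
  + exact: mD.
  + exact: md.
  + exact: law.
  + exact: ii.
move=> i1 E1; split; first exact: i1.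
rewrite -[LHS]/(Ex P (fun x => \prod_(0 <= i < n) (phi i \o D i) x)) E1.
rewrite big_seq [RHS]big_seq; apply: eq_bigr => j /jn jl.
by apply: (same_law_Ex (mD jl) (md _ jl) (law _ jl)).
Qed.

Lemma levy_incr_ge0_prod : (forall j y, 0 <= phi j y) ->
  (\int[P]_w (\prod_(0 <= j < n) phi j (xi (u j.+1) w - xi (u j) w))%:E =
  \prod_(0 <= j < n) \int[P]_w (phi j (xi (u j.+1 - u j) w))%:E)%E.
Proof.
move=> phi0.
have jn j : j \in index_iota 0 n -> (j < n)%N by rewrite mem_index_iota.
have md j : (j < n)%N -> measurable_fun setT (xi (u j.+1 - u j)).
  by move=> jl; apply: levy_measurable; rewrite subr_ge0 umono.
have law j (jl : (j < n)%N) := levy_incr_law (uge0 (ltnW jl)) (umono jl).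
have := @ge0_integral_prod _ _ _ P _ _ _ indD measD (index_iota 0 n) (fun j => phi j \o D j).
move=> E1; rewrite -[LHS]/(\int[P]_x (\prod_(0 <= i < n) (phi i \o D i) x)%:E)%E E1.
- rewrite big_seq [RHS]big_seq; apply: eq_bigr => j /jn jl.
  exact: (same_law_integral (mD jl) (md _ jl) (law _ jl) (mphi j)).
- exact: iota_uniq.
- by move=> j /jn.
- by move=> j _; exact: adD.
- by move=> j x; exact: phi0.
Qed.

End Increments.

Lemma levy0_ae : {ae P, forall w, xi 0 w = 0}.
Proof. by case: levy. Qed.

Lemma measurable_expM u : measurable_fun setT (fun y : R => expR (u * y)).
Proof. by apply: measurable_expR_comp; exact: measurable_funM. Qed.

(** No logarithm is taken, despite the name. The value is extended real because finiteness at times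
    other than 1 is a conclusion, drawn in [lmgfE_expR]. *)
Definition lmgfE u t := (\int[P]_w (expR (u * xi t w))%:E)%E.

Lemma lmgfED u s t : 0 <= s -> 0 <= t -> lmgfE u (s + t) = (lmgfE u s * lmgfE u t)%E.
Proof.
move=> s0 t0; pose uu j := if j is j'.+1 then if j' is _.+1 then s + t else s else 0.
have := @levy_incr_ge0_prod 2 uu (fun=> fun y => expR (u * y)).
rewrite /uu /= lexx => /(_ isT).
have H : forall j : nat, (j < 2)%N -> uu j <= uu j.+1 by case=> [|[]]//= _; rewrite ?lerDl.
move=> /(_ H (fun=> measurable_expM u) (fun _ _ => expR_ge0 _)).
under eq_integral do rewrite big_mkord !big_ord_recl big_ord0 mulr1/=.
rewrite big_mkord !big_ord_recl big_ord0 mule1/=.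
rewrite subr0 (addrC s) addrK => <-.
apply: ae_eq_integral => //.
- apply/measurable_EFinP; apply: (measurableT_comp (measurable_expM u)).
  by apply: levy_measurable; rewrite addr_ge0.
- apply/measurable_EFinP; apply: measurable_funM; apply: (measurableT_comp (measurable_expM u));
    by apply: levy_incr_measurable => //; rewrite ?lerDr.
- apply: filterS levy0_ae => w /= w0 _; rewrite w0 subr0 -expRD.
  by congr (expR _)%:E; ring.
Qed.

Lemma lmgfE_gt0 u t : 0 <= t -> (0 < lmgfE u t)%E.
Proof.
move=> t0; rewrite lt_neqAle; apply/andP; split; last first.
  by apply: integral_ge0 => w _; rewrite lee_fin expR_ge0.
apply/eqP => /esym E0.
have me : measurable_fun setT (fun w => expR (u * xi t w)).
  by apply: (measurableT_comp (measurable_expM u)); exact: levy_measurable.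
have ei : intble P (fun w => expR (u * xi t w)).
  by apply: intble_ge0 => //; rewrite [X in (X < _)%E]E0.
have : {ae P, forall w, expR (u * xi t w) = 0}.
  by apply: Ex_eq0 => //; rewrite /Ex [X in fine X]E0.
move=> ae0; have : Ex P (fun=> 1) = Ex P (fun=> 0).
  apply: Ex_ae => //; apply: filterS ae0 => w /= /eqP.
  by rewrite gt_eqF ?expR_gt0.
by rewrite !Ex_cst => /eqP; rewrite oner_eq0.
Qed.

(** Truncating the exponential at 1 makes dominated convergence available before any moment is known
    to be finite: along times decreasing to 0 the truncated expectations tend to 1 by right
    continuity of the paths. The constant [2^-1] could be any positive number below 1. *)
Lemma levy_lower u : exists2 del : R, 0 < del &
  forall t, 0 < t -> t <= del -> (2^-1%:E <= lmgfE u t)%E.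
Proof.
apply: contrapT => nex.
have H n : exists t, 0 < t /\ t <= n.+1%:R^-1 /\ ~ (2^-1%:E <= lmgfE u t)%E.
  apply: contrapT => H; apply: nex; exists n.+1%:R^-1; first by rewrite invr_gt0.
  move=> t t0 tn; apply: contrapT => tH; apply: H; exists t; split => //; split => //.
have /choice[t tP] := H.
have t0 n : 0 < t n by case: (tP n).
have tcvg : t @ \oo --> (0 : R)^'+.
  have tc : t @ \oo --> (0 : R).
    apply: (@squeeze_cvgr _ _ _ _ (fun=> 0) (fun n => n.+1%:R^-1)) => //.
    - by apply: nearW => n; rewrite ltW//=; case: (tP n) => _ [].
    - exact: cvg_cst.
    - exact: cvg_harmonic.
  move=> A /= [e e0 eA]; have : \forall n \near \oo, ball (0:R) e (t n).
    exact: tc _ (nbhsx_ballx 0 e e0).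
  move=> tb; suff : \forall n \near \oo, A (t n) by [].
  by near=> n; apply: eA => //; near: n.
pose f n w := Num.min (expR (u * xi (t n) w)) 1.
have mf n : measurable_fun setT (f n).
  apply: measurable_minr => //; apply: (measurableT_comp (measurable_expM u)).
  by apply: levy_measurable; exact: ltW.
have f0 n w : 0 <= f n w by rewrite /f le_min expR_ge0 ler01.
have [] := @dominated_convergence _ T R P setT measurableT (fun n w => (f n w)%:E)
  (fun=> 1%E) (fun=> 1%E).
- by move=> n; apply/measurable_EFinP; exact: mf.
- exact: measurable_cst.
- have cad : {ae P, forall w, cadlag (fun t => xi t w)} by case: levy.
  apply: filterS2 cad levy0_ae => w [cadw _] w0 _.
  have := cadw 0 (lexx _); rewrite w0 => /= cw.
  have := cvg_comp _ _ tcvg cw => /= cw'.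
  apply: cvg_EFin; first exact: nearW.
  have ec : (fun n => expR (u * xi (t n) w)) @ \oo --> (1 : R).
    rewrite -[X in _ --> X]expR0 -[X in expR X](mulr0 u).
    apply: (cvg_comp (fun n => u * xi (t n) w) expR); last exact: continuous_expR.
    by apply: cvgMl_tmp; exact: cw'.
  apply/cvgrPdist_le => e e0; move/cvgrPdist_le : ec => /(_ _ e0).
  apply: filterS => n /=; apply: le_trans.
  rewrite /f; case: (leP (expR (u * xi (t n) w)) 1) => //.
  by rewrite subrr normr0.
- exact: intble_cst.
- apply: nearW => w n _ /=; rewrite lee_fin ger0_norm//.
  by rewrite /f ge_min lexx orbT.
move=> _ _; rewrite integral_cst//= probability_setT mule1 => /= c1.
have := c1 [set x | (2^-1%:E < x)%E]; case.
  by apply: open_ereal_gt'; rewrite lte_fin invf_lt1 ?ltr1n.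
move=> n _ /(_ n (leqnn _))/=; case: (tP n) => _ [_]; apply: contra_not => hn.
apply: le_trans (ltW hn) _; apply: ge0_le_integral => //.
- by move=> w _; rewrite lee_fin.
- by apply/measurable_EFinP; exact: mf.
- by apply/measurable_EFinP; apply: (measurableT_comp (measurable_expM u)); apply: levy_measurable; exact: ltW.
- by move=> w _; rewrite lee_fin /f ge_min lexx.
Unshelve. all: by end_near. Qed.

(* [t |-> ln (lmgfE u t)] is additive and, by right continuity of the paths at 0,
   bounded below near 0; such a solution of Cauchy's equation is linear. *)
Lemma lmgfE_expR u c : lmgfE u 1 = (expR c)%:E ->
  forall t, 0 <= t -> lmgfE u t = (expR (t * c))%:E.
Proof.
move=> M1.
have Mn n : lmgfE u n.+1%:R = (expR (n.+1%:R * c))%:E.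
  elim: n => [|n ih]; first by rewrite mul1r.
  by rewrite -natr1 lmgfED// ih M1 -EFinM -expRD mulrDl mul1r.
(* At an integer [n > t] the value is finite, and it is the product of the values at [t] and at
   [n - t]. Both are positive, so neither can be infinite. *)
have Mfin t : 0 <= t -> lmgfE u t \is a fin_num.
  move=> t0; have nt : 0 <= (Num.truncn t).+1%:R - t by rewrite subr_ge0 ltW// truncnS_gt.
  have := Mn (Num.truncn t); rewrite -(subrK t (Num.truncn t).+1%:R) lmgfED//.
  have := lmgfE_gt0 u nt; have := lmgfE_gt0 u t0.
  case: (lmgfE u t) => [r| |]//= _.
  by case: (lmgfE u _) => [r| |]//= r0; rewrite ?gt0_muley.
have [m mE] : exists m : R -> R, forall t, 0 <= t -> lmgfE u t = (expR (m t))%:E.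
  exists (fun t => ln (fine (lmgfE u t))) => t t0.
  by rewrite lnK ?fineK ?Mfin// posrE fine_gt0// lmgfE_gt0//= ltey_eq Mfin.
have m1 : m 1 = c by apply: (can_inj (@expRK R)); apply: EFin_inj; rewrite -mE.
have [del del0 low] := levy_lower u.
have lin := @additive_bounded_below_linear _ m (- ln 2^-1) del del0.
move=> t t0; rewrite mE// lin//.
- by rewrite m1.
- move=> a b a0 b0; apply: (can_inj (@expRK R)).
  by apply: EFin_inj; rewrite expRD EFinM -(mE a a0) -(mE b b0) -(mE _ (addr_ge0 a0 b0)) lmgfED.
- move=> a a0 ad; rewrite opprK -ler_expR lnK ?posrE ?invr_gt0//.
  by rewrite -lee_fin -(mE _ (ltW a0)) low.
Qed.

End Levy.

Section LevyMgf.
Context {d : measure_display} {T : measurableType d} {R : realType}.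
Variables (P : probability T R) (xi : R -> T -> R) (psi : R -> R).

(** The interface through which [xi] and its copies enter the rest of the proof: finiteness of the
    exponential moments and the common exponent in one condition, imposed at time 1 and extended to
    all times by [lmgfE_expR]. *)
Definition levy_exponent :=
  levy_process P xi /\ forall u, lmgfE P xi u 1 = (expR (psi u))%:E.

Hypothesis levy : levy_exponent.

Lemma levy_exp_intble u t : 0 <= t -> intble P (fun w => expR (u * xi t w)).
Proof.
case: levy => lv M1 t0; apply: intble_ge0.
- by apply: (measurableT_comp (measurable_expM u)); exact: (levy_measurable lv t0).
- by move=> x; exact: expR_ge0.
- by have := lmgfE_expR lv (M1 u) t0; rewrite /lmgfE => ->; rewrite ltry.
Qed.

Lemma levy_exp_Ex u t : 0 <= t -> Ex P (fun w => expR (u * xi t w)) = expR (t * psi u).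
Proof.
by case: levy => lv M1 t0; have := lmgfE_expR lv (M1 u) t0; rewrite /lmgfE /Ex => ->.
Qed.

End LevyMgf.

(** * Taylor bounds and derivatives of moment generating functions *)

Section Calculus.
Context {R : realType}.
Implicit Types (x z : R).

Lemma expR_taylor1 z : `|expR z - 1 - z| <= z ^+ 2 * expR `|z|.
Proof.
have h1 := expR_ge1Dx z; have h2 := expR_ge1Dx (- z).
have e0 : 0 < expR z := expR_gt0 z.
have h3 : expR z - 1 <= z * expR z.
  have : expR z * (1 - z) <= 1 by rewrite -[leRHS](mulfV (lt0r_neq0 e0)) -expRN ler_pM2l.
  by rewrite mulrBr mulr1 [z * _]mulrC; lra.
rewrite ger0_norm; last lra.
have h5 : expR z - 1 - z <= z * (expR z - 1) by rewrite mulrBr mulr1; lra.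
apply: le_trans h5 _; have [z0|z0] := leP 0 z.
  have -> : z ^+ 2 * expR `|z| = z * (z * expR z) by rewrite ger0_norm//; ring.
  by rewrite ler_wpM2l.
have e1 : 1 <= expR `|z| by rewrite -expR0 ler_expR.
apply: (@le_trans _ _ (z ^+ 2)); last by rewrite ler_peMr// sqr_ge0.
have -> : z * (expR z - 1) = (- z) * (1 - expR z) by ring.
have -> : z ^+ 2 = (- z) * (- z) by ring.
have h4 : 1 - expR z <= - z by lra.
by rewrite ler_wpM2l// oppr_ge0 ltW.
Qed.

Lemma expR_norm_le x : expR `|x| <= expR x + expR (- x).
Proof.
have [x0|x0] := leP 0 x; first by rewrite ger0_norm// lerDl expR_ge0.
by rewrite ltr0_norm// lerDr expR_ge0.
Qed.

Lemma normX_le_expR x n : `|x| ^+ n <= n`!%:R * expR `|x|.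
Proof.
case: n => [|n]; first by rewrite expr0 mul1r -expR0 ler_expR.
have := @expR_ge1Dxn R `|x| n (normr_ge0 x).
move=> h; rewrite mulrC -ler_pdivrMr ?ltr0n ?fact_gt0//.
by apply: le_trans h; rewrite lerDr.
Qed.

(** Turns differentiation under an expectation into a pointwise Taylor bound: a remainder that is
    quadratic in [h] with an integrable coefficient is simply integrated. *)
Lemma quadratic_is_derive (f : R -> R) u l C :
  (forall h, `|h| <= 1 -> `|f (u + h) - f u - h * l| <= C * h ^+ 2) ->
  is_derive u 1 f l.
Proof.
move=> H.
have C1 : 0 < `|C| + 1 by rewrite ltr_wpDl.
have cv : (fun h => h^-1 *: ((f \o shift u) (h *: 1) - f u)) @ (0 : R)^' --> l.
  apply/cvgrPdist_le => e e0; near=> h.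
  have hn0 : h != 0 by near: h; exact: nbhs_dnbhs_neq.
  have h1 : `|h| <= Num.min 1 (e / (`|C| + 1)).
    by near: h; apply: dnbhs0_le; rewrite lt_min ltr01 divr_gt0.
  rewrite le_min in h1; case/andP: h1 => h1 h2.
  have hp : 0 < `|h| by rewrite normr_gt0.
  have -> : l - h^-1 *: ((f \o shift u) (h *: 1) - f u) =
      - h^-1 * (f (u + h) - f u - h * l).
    by rewrite /= [h *: 1]mulr1 [h + u]addrC /GRing.scale/=; field.
  rewrite normrM normrN normfV ler_pdivrMl//.
  apply: le_trans (H h h1) _.
  rewrite -real_normK ?num_real// expr2 mulrA [leRHS]mulrC ler_pM2r//.
  rewrite (le_trans (ler_wpM2r (normr_ge0 h) (ler_norm C)))//.
  move: h2; rewrite ler_pdivlMr// => h2.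
  by apply: le_trans h2; rewrite mulrC ler_wpM2l// lerDl.
by apply: DeriveDef; [apply/cvg_ex; exists l|exact/cvg_lim].
Unshelve. all: by end_near. Qed.

Lemma is_derive_comp (f g : R -> R) x df dg :
  is_derive x 1 f df -> is_derive (f x) 1 g dg ->
  is_derive x 1 (fun y => g (f y)) (dg * df).
Proof.
move=> [fx <-] [gx <-]; have fd := fx; have gd := gx; split.
  move/derivable1_diffP in fx; move/derivable1_diffP in gx.
  by apply/derivable1_diffP; exact: differentiable_comp.
have := derive1_comp fd gd; rewrite !derive1E => <-.
by [].
Qed.

End Calculus.

Section MgfDerivative.
Context {d : measure_display} {T : measurableType d} {R : realType}.
Variables (P : probability T R) (X : T -> R).
Hypothesis mX : measurable_fun setT X.
Hypothesis Xexp : forall u, intble P (fun w => expR (u * X w)).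

(** The power is absorbed by [|x|^k <= k! e^{|x|} <= k! (e^x + e^{-x})], at the price of shifting
    [u] by one in both directions. *)
Lemma intble_norm_pow_exp k u : intble P (fun w => `|X w| ^+ k * expR (u * X w)).
Proof.
apply: (@intble_dom _ _ _ _ _ (fun w => k`!%:R * (expR ((u + 1) * X w) + expR ((u - 1) * X w)))).
- apply: measurable_funM; last by apply: measurable_expR_comp; exact: measurable_funM.
  by apply: measurable_funX; apply: measurableT_comp mX; exact: normr_measurable.
- move=> w; rewrite ger0_norm; last by rewrite mulr_ge0 ?exprn_ge0 ?expR_ge0.
  have -> : expR ((u + 1) * X w) + expR ((u - 1) * X w) =
     (expR (X w) + expR (- X w)) * expR (u * X w).
    by rewrite [RHS]mulrDl -!expRD; congr (expR _ + expR _); ring.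
  rewrite mulrA ler_wpM2r ?expR_ge0//.
  apply: le_trans (normX_le_expR _ _) _.
  by rewrite ler_wpM2l// expR_norm_le.
- by apply: intbleZ; apply: intbleD; exact: Xexp.
Qed.

Lemma intble_pow_exp k u : intble P (fun w => X w ^+ k * expR (u * X w)).
Proof.
apply: (@intble_dom _ _ _ _ _ (fun w => `|X w| ^+ k * expR (u * X w))).
- apply: measurable_funM; last by apply: measurable_expR_comp; exact: measurable_funM.
  exact: measurable_funX.
- by move=> w; rewrite normrM normrX (ger0_norm (expR_ge0 _)).
- exact: intble_norm_pow_exp.
Qed.

Definition mgf_pow (k : nat) (u : R) : R := Ex P (fun w => X w ^+ k * expR (u * X w)).

Lemma is_derive_mgf_pow (k : nat) (u : R) : is_derive u (1 : R) (mgf_pow k) (mgf_pow k.+1 u).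
Proof.
pose b w := `|X w| ^+ k.+2 * expR ((u + 1) * X w) + `|X w| ^+ k.+2 * expR ((u - 1) * X w).
have bi : intble P b by apply: intbleD; exact: intble_norm_pow_exp.
apply: (@quadratic_is_derive _ _ _ _ (Ex P b)) => h h1.
rewrite /mgf_pow -ExZ ?[X in intble _ X]/=; last exact: intble_pow_exp.
rewrite -ExB; try exact: intble_pow_exp.
rewrite -ExB; first last.
- by apply: intbleZ; exact: intble_pow_exp.
- by apply: intbleB; exact: intble_pow_exp.
rewrite mulrC -ExZ//; apply: normr_Ex_le.
- apply: intbleB; first by apply: intbleB; exact: intble_pow_exp.
  by apply: intbleZ; exact: intble_pow_exp.
- exact: intbleZ.
move=> w; have -> : X w ^+ k * expR ((u + h) * X w) - X w ^+ k * expR (u * X w) -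
   h * (X w ^+ k.+1 * expR (u * X w)) =
   X w ^+ k * (expR (h * X w) - 1 - h * X w) * expR (u * X w).
  by rewrite mulrDl expRD exprS; ring.
rewrite normrM (ger0_norm (expR_ge0 _)) normrM normrX.
have -> : h ^+ 2 * b w = `|X w| ^+ k * (`|h * X w| ^+ 2 * (expR (X w) + expR (- X w))) * expR (u * X w).
  rewrite normrM exprMn real_normK ?num_real// /b.
  by rewrite !mulrDl !expRD mulN1r mul1r (exprS _ k.+1) (exprS _ k); ring.
rewrite ler_wpM2r ?expR_ge0// ler_wpM2l ?exprn_ge0//.
apply: le_trans (expR_taylor1 _) _.
rewrite real_normK ?num_real// ler_wpM2l ?sqr_ge0//.
apply: le_trans (expR_norm_le _).
by rewrite ler_expR normrM ler_piMl.
Qed.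

End MgfDerivative.

(** * The exponential tilt at 2 *)

Section Exponent.
Context {d : measure_display} {T : measurableType d} {R : realType}.
Variables (P : probability T R) (xi : R -> T -> R) (psi : R -> R).
Hypothesis lexp : levy_exponent P xi psi.

Let levy : levy_process P xi. Proof. by case: lexp. Qed.

Let mpow := fun t k u => mgf_pow P (xi t) k u.

Let mpow0 t u : 0 <= t -> mpow t 0 u = expR (t * psi u).
Proof.
move=> t0; rewrite -(levy_exp_Ex lexp u t0); apply: eq_Ex => w.
by rewrite expr0 mul1r.
Qed.

Let mpow_derive t k (u : R) : 0 <= t -> is_derive u (1:R) (mpow t k) (mpow t k.+1 u).
Proof.
move=> t0; apply: is_derive_mgf_pow; first exact: (levy_measurable levy).
by move=> v; exact: (levy_exp_intble lexp).
Qed.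

Let psi1 u := mpow 1 1 u * expR (- psi u).

Let psiE u : psi u = ln (mpow 1 0 u).
Proof. by rewrite mpow0// mul1r expRK. Qed.

Let psi_derive (u : R) : is_derive u (1:R) psi (psi1 u).
Proof.
have -> : psi = fun u => ln (mpow 1 0 u) by apply/funext => v; exact: psiE.
have m0 : mpow 1 0 u = expR (psi u) by rewrite mpow0// mul1r.
have := @is_derive_comp R (mpow 1 0) (@ln R) u (mpow 1 1 u) (mpow 1 0 u)^-1.
rewrite /psi1 mulrC expRN -m0; apply; first exact: mpow_derive.
by apply: is_derive1_ln; rewrite m0 expR_gt0.
Qed.

Lemma derive1_psi : derive1 psi = psi1.
Proof. by apply/funext => u; rewrite derive1E; have [_ ->] := psi_derive u. Qed.

Lemma is_derive_psi (u : R) : is_derive u (1:R) psi (derive1 psi u).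
Proof. by rewrite derive1_psi; exact: psi_derive. Qed.

Lemma is_derive2_psi (u : R) : is_derive u (1:R) (derive1 psi) (derive1n 2 psi u).
Proof.
rewrite /derive1n/= derive1_psi derive1E.
have [] : is_derive u (1:R) psi1 (mpow 1 1 u *: (expR (- psi u) * - psi1 u) + expR (- psi u) *: mpow 1 2 u).
  apply: is_deriveM; first exact: mpow_derive.
  apply: (@is_derive_comp R (fun v => - psi v) expR).
  by apply: is_deriveN; exact: psi_derive.
by move=> ? ?; split.
Qed.

(** The derivative of [mpow t 0] is computed twice: as the next moment, by [mpow_derive], and from
    the closed form [e^{t psi}]. Comparing the two expresses moments at time [t] through [psi];
    [pow2] repeats this one order higher. *)
Let pow1 t u : 0 <= t -> mpow t 1 u = t * derive1 psi u * expR (t * psi u).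
Proof.
move=> t0; have [_ <-] := mpow_derive 0 u t0.
have -> : mpow t 0 = fun v => expR (t * psi v) by apply/funext => v; exact: mpow0.
have [_ ->] // : is_derive u (1:R) (fun v => expR (t * psi v)) (expR (t * psi u) * (t *: derive1 psi u)).
  apply: (@is_derive_comp R (fun v => t * psi v) expR).
  exact: (@is_deriveZ _ _ _ psi t _ _ _ (is_derive_psi u)).
by rewrite mulrC.
Qed.

Let pow2 t u : 0 <= t ->
  mpow t 2 u = (t * derive1n 2 psi u + (t * derive1 psi u) ^+ 2) * expR (t * psi u).
Proof.
move=> t0; have [_ <-] := mpow_derive 1 u t0.
have -> : mpow t 1 = fun v => (t * derive1 psi v) * expR (t * psi v).
  by apply/funext => v; exact: pow1.
have [_ ->] // : is_derive u (1:R) (fun v => (t * derive1 psi v) * expR (t * psi v))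
   ((t * derive1 psi u) *: (expR (t * psi u) * (t *: derive1 psi u)) + expR (t * psi u) *: (t *: derive1n 2 psi u)).
  apply: is_deriveM.
    exact: (@is_deriveZ _ _ _ (derive1 psi) t _ _ _ (is_derive2_psi u)).
  apply: (@is_derive_comp R (fun v => t * psi v) expR).
  exact: (@is_deriveZ _ _ _ psi t _ _ _ (is_derive_psi u)).
by rewrite /GRing.scale/=; ring.
Qed.

(** The density of the Esscher transform with parameter 2 at time [t], always used as a weight in
    expectations under [P]. *)
Definition tilt t w := expR (2 * xi t w - t * psi 2).

Lemma tilt_ge0 t w : 0 <= tilt t w. Proof. exact: expR_ge0. Qed.

Let tiltE t w : tilt t w = expR (- (t * psi 2)) * expR (2 * xi t w).
Proof. by rewrite /tilt expRD mulrC. Qed.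

Lemma tilt_pow_intble t k : 0 <= t -> intble P (fun w => tilt t w * xi t w ^+ k).
Proof.
move=> t0.
have -> : (fun w => tilt t w * xi t w ^+ k) =
    (fun w => expR (- (t * psi 2)) * (xi t w ^+ k * expR (2 * xi t w))).
  by apply/funext => w; rewrite tiltE; ring.
apply: intbleZ; apply: intble_pow_exp; first exact: (levy_measurable levy).
by move=> u; exact: (levy_exp_intble lexp).
Qed.

Let tilt_pow t k : 0 <= t ->
  Ex P (fun w => tilt t w * xi t w ^+ k) = expR (- (t * psi 2)) * mpow t k 2.
Proof.
move=> t0; rewrite /mpow /mgf_pow -ExZ; first by apply: eq_Ex => w; rewrite tiltE; ring.
apply: intble_pow_exp; first exact: (levy_measurable levy).
by move=> u; exact: (levy_exp_intble lexp).
Qed.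

Lemma tilt_intble t : 0 <= t -> intble P (tilt t).
Proof.
move=> t0; have := tilt_pow_intble 0 t0.
by rewrite [X in intble _ X](_ : _ = tilt t)//; apply/funext => w; rewrite mulr1.
Qed.

Lemma Ex_tilt t : 0 <= t -> Ex P (tilt t) = 1.
Proof.
move=> t0; have := tilt_pow 0 t0; rewrite mpow0// -expRD addNr expR0 => <-.
by apply: eq_Ex => w; rewrite mulr1.
Qed.

Let expNK (a b : R) : expR (- a) * (b * expR a) = b.
Proof. by rewrite mulrCA -expRD addNr expR0 mulr1. Qed.

Lemma Ex_tilt1 t : 0 <= t -> Ex P (fun w => tilt t w * xi t w) = t * derive1 psi 2.
Proof.
move=> t0; have := tilt_pow 1 t0; rewrite pow1// expNK => <-.
by apply: eq_Ex => w; rewrite expr1.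
Qed.

Lemma Ex_tilt2 t : 0 <= t -> Ex P (fun w => tilt t w * xi t w ^+ 2) =
  t * derive1n 2 psi 2 + (t * derive1 psi 2) ^+ 2.
Proof.
by move=> t0; rewrite tilt_pow// pow2// expNK.
Qed.

Lemma tilt_centered t : 0 <= t ->
  intble P (fun w => tilt t w * (xi t w - t * derive1 psi 2)) /\
  Ex P (fun w => tilt t w * (xi t w - t * derive1 psi 2)) = 0.
Proof.
move=> t0; have i0 := tilt_intble t0.
have i1 : intble P (fun w => tilt t w * xi t w) by exact: (tilt_pow_intble 1 t0).
have -> : (fun w => tilt t w * (xi t w - t * derive1 psi 2)) =
  (fun w => tilt t w * xi t w - (t * derive1 psi 2) * tilt t w).
  by apply/funext => w; ring.
split; first by apply: intbleB => //; exact: intbleZ.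
by rewrite ExB ?ExZ//; [rewrite Ex_tilt1// Ex_tilt//; ring|exact: intbleZ].
Qed.

Lemma tilt_variance t : 0 <= t ->
  intble P (fun w => tilt t w * (xi t w - t * derive1 psi 2) ^+ 2) /\
  Ex P (fun w => tilt t w * (xi t w - t * derive1 psi 2) ^+ 2) = t * derive1n 2 psi 2.
Proof.
move=> t0; have i0 := tilt_intble t0.
have i1 : intble P (fun w => tilt t w * xi t w) by exact: (tilt_pow_intble 1 t0).
have i2 := tilt_pow_intble 2 t0.
set m := t * derive1 psi 2.
have -> : (fun w => tilt t w * (xi t w - m) ^+ 2) =
  (fun w => tilt t w * xi t w ^+ 2 - (2 * m) * (tilt t w * xi t w) + m ^+ 2 * tilt t w).
  by apply/funext => w; ring.
have i3 : intble P (fun w => 2 * m * (tilt t w * xi t w)) by exact: intbleZ.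
have i4 : intble P (fun w => m ^+ 2 * tilt t w) by exact: intbleZ.
have i5 := intbleB i2 i3.
split; first exact: intbleD.
by rewrite ExD// ExB// !ExZ// Ex_tilt// Ex_tilt1// Ex_tilt2// /m; ring.
Qed.

(** From [|x - m|^3 <= 4 (|x|^3 + |m|^3)] and [|x|^3 <= 6 (e^x + e^{-x})], whence 24. Multiplying
    [e^x] and [e^{-x}] by the tilt changes the exponent 2 into 3 and 1, with means
    [e^{t (psi 3 - psi 2)}] and [e^{t (psi 1 - psi 2)}]; for [0 <= t <= 1] the absolute values
    dominate. *)
Definition tilt3_bound : R :=
  24 * (expR `|psi 3 - psi 2| + expR `|psi 1 - psi 2|) + 4 * `|derive1 psi 2| ^+ 3.

Lemma tilt_third t : 0 <= t -> t <= 1 ->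
  intble P (fun w => tilt t w * `|xi t w - t * derive1 psi 2| ^+ 3) /\
  Ex P (fun w => tilt t w * `|xi t w - t * derive1 psi 2| ^+ 3) <= tilt3_bound.
Proof.
move=> t0 t1; set m := t * derive1 psi 2.
have mx := levy_measurable levy t0.
pose b w := 24 * (expR (- (t * psi 2)) * (expR (3 * xi t w) + expR (1 * xi t w))) + 4 * `|m| ^+ 3 * tilt t w.
have i3 := levy_exp_intble lexp 3 t0; have i1 := levy_exp_intble lexp 1 t0.
have iS := intbleZ (expR (- (t * psi 2))) (intbleD i3 i1).
have ib : intble P b.
  by apply: intbleD; apply: intbleZ => //; exact: tilt_intble.
have le w : tilt t w * `|xi t w - m| ^+ 3 <= b w.
  have cube : `|xi t w - m| ^+ 3 <= 4 * (`|xi t w| ^+ 3 + `|m| ^+ 3).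
    have := ler_normB (xi t w) m.
    have := normr_ge0 (xi t w - m); have := normr_ge0 (xi t w); have := normr_ge0 m.
    move: (`|xi t w - m|) (`|xi t w|) (`|m|) => z x y y0 x0 z0 zxy.
    apply: (@le_trans _ _ ((x + y) ^+ 3)); first by rewrite lerXn2r ?nnegrE ?addr_ge0.
    rewrite -subr_ge0 (_ : _ - _ = 3 * (x + y) * (x - y) ^+ 2); last by ring.
    by rewrite mulr_ge0 ?sqr_ge0// mulr_ge0 ?addr_ge0.
  have e3 : `|xi t w| ^+ 3 <= 6 * (expR (xi t w) + expR (- xi t w)).
    apply: le_trans (normX_le_expR _ _) _; rewrite ler_wpM2l//.
    exact: expR_norm_le.
  apply: (@le_trans _ _ (tilt t w * (24 * (expR (xi t w) + expR (- xi t w)) + 4 * `|m| ^+ 3))).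
    by rewrite ler_wpM2l ?tilt_ge0//; lra.
  rewrite /b mulrDr; apply: lerD; last by rewrite mulrC.
  rewrite mulrCA ler_wpM2l//.
  have -> : 3 * xi t w = 2 * xi t w + xi t w by ring.
  have -> : 1 * xi t w = 2 * xi t w - xi t w by ring.
  by rewrite tiltE !expRD le_eqVlt; apply/orP; left; apply/eqP; ring.
have il : intble P (fun w => tilt t w * `|xi t w - m| ^+ 3).
  apply: intble_dom ib.
  - apply: measurable_funM; first exact: intble_meas (tilt_intble t0).
    apply: measurable_funX; apply: (measurableT_comp (@normr_measurable R setT)).
    exact: measurable_funB.
  - by move=> w; rewrite ger0_norm// mulr_ge0 ?tilt_ge0 ?exprn_ge0.
split => //; apply: le_trans (le_Ex il ib le) _.
rewrite /b ExD; try by apply: intbleZ => //; exact: tilt_intble.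
rewrite ExZ// ExZ; last exact: intbleD.
rewrite ExD// ExZ; last exact: tilt_intble.
rewrite Ex_tilt// mulr1 (levy_exp_Ex lexp 3 t0) (levy_exp_Ex lexp 1 t0) mulrDr -!expRD.
apply: lerD; rewrite ler_wpM2l//.
  apply: lerD; rewrite ler_expR -mulrN -mulrDr addrC; apply: le_trans (ler_norm _) _;
    by rewrite normrM (ger0_norm t0) ler_piMl.
rewrite lerXn2r ?nnegrE// /m normrM ler_piMl// ger0_norm//.
Qed.

Hypothesis nonconstant : ~ exists c : R, {ae P, forall w, xi 1 w = c}.

(** This is the tilted variance of [xi 1]. The weight is strictly positive, so a zero variance would
    make [xi 1] almost surely equal to [derive1 psi 2]. *)
Lemma derive2_psi_gt0 : 0 < derive1n 2 psi 2.
Proof.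
have [i E] := tilt_variance (@ler01 R); rewrite !mul1r in i E.
have ge0 w : 0 <= tilt 1 w * (xi 1 w - derive1 psi 2) ^+ 2.
  by rewrite mulr_ge0 ?tilt_ge0 ?sqr_ge0.
rewrite lt_neqAle eq_sym -{2}E Ex_ge0// andbT; apply/eqP => E0.
rewrite E0 in E; apply: nonconstant; exists (derive1 psi 2).
apply: filterS (Ex_eq0 i ge0 E) => w /eqP.
by rewrite mulf_eq0 gt_eqF ?expR_gt0//= expf_eq0/= subr_eq0 => /eqP.
Qed.

(** The variance of [e^{xi 1}] is [e^{psi 2} - e^{2 psi 1}] and cannot vanish. This gap keeps the
    variance of the sums positive at positive times and makes the means of the scaled summands
    negligible. *)
Lemma psi2_gt : 2 * psi 1 < psi 2.
Proof.
have i2 := levy_exp_intble lexp 2 ler01; have i1 := levy_exp_intble lexp 1 ler01.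
pose c := expR (psi 1).
pose f w := (expR (1 * xi 1 w) - c) ^+ 2.
have fE : f = fun w => expR (2 * xi 1 w) - 2 * c * expR (1 * xi 1 w) + c ^+ 2.
  apply/funext => w; rewrite /f mul1r.
  by rewrite (_ : 2 * xi 1 w = xi 1 w + xi 1 w) ?expRD; ring.
have if_ : intble P f.
  rewrite fE; apply: intbleD; last exact: intble_cst.
  by apply: intbleB => //; exact: intbleZ.
have E : Ex P f = expR (psi 2) - expR (2 * psi 1).
  rewrite fE ExD; [|by apply: intbleB => //; exact: intbleZ|exact: intble_cst].
  rewrite ExB//; last exact: intbleZ.
  rewrite ExZ// Ex_cst (levy_exp_Ex lexp 2 ler01) (levy_exp_Ex lexp 1 ler01) !mul1r /c.
  by rewrite (_ : 2 * psi 1 = psi 1 + psi 1) ?expRD; ring.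
rewrite -ltr_expR -subr_gt0 -E lt_neqAle Ex_ge0 ?andbT; last by move=> w; exact: sqr_ge0.
apply/eqP => /esym E0; apply: nonconstant; exists (psi 1).
apply: filterS (Ex_eq0 if_ _ E0); last by move=> w; exact: sqr_ge0.
by move=> w /eqP; rewrite expf_eq0/= subr_eq0 mul1r => /eqP /expR_inj.
Qed.

End Exponent.

(** * Trigonometric moments *)

Section TrigBounds.
Context {R : realType}.
Implicit Types (x y b rho : R) (l : seq (R * R)).

(** One rung of a ladder: each of the next four bounds on sine and cosine has the previous
    expression as derivative, starting from [cos <= 1]. *)
Lemma ge0_of_derive_ge0 (f f' : R -> R) : (forall x, is_derive x (1:R) f (f' x)) ->
  (forall x, 0 <= x -> 0 <= f' x) -> f 0 = 0 -> forall x, 0 <= x -> 0 <= f x.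
Proof.
move=> df f'0 f0 x; rewrite le_eqVlt => /predU1P[<-|x0]; first by rewrite f0.
have [] := @MVT R f f' _ _ x0 (fun z _ => df z).
  apply: continuous_subspaceT => z; apply/differentiable_continuous/derivable1_diffP.
  by have [] := df z.
move=> c; rewrite in_itv/= => /andP[c0 _]; rewrite f0 !subr0 => ->.
by rewrite mulr_ge0 ?f'0 ?ltW.
Qed.

Lemma is_derive_poly1 (c x : R) n : is_derive x (1:R) (fun y => y ^+ n.+1 * c) (n.+1%:R * x ^+ n * c).
Proof.
have := @is_deriveZ _ _ _ _ c x 1 _ (@is_deriveX _ _ _ n.+1 x 1 _ (is_derive_id x 1)).
rewrite (_ : (c \*: _) = fun y : R => y ^+ n.+1 * c); last first.
  by apply/funext => y; rewrite /GRing.scale/= fctE mulrC.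
by rewrite /GRing.scale/= mulr1 mulrC.
Qed.

Lemma sin_le x : 0 <= x -> sin x <= x.
Proof.
move=> x0; rewrite -subr_ge0.
have df (z : R) : is_derive z (1:R) (fun y => y - sin y) (1 - cos z).
  exact: (is_deriveB (is_derive_id z 1) (is_derive_sin z)).
apply: (ge0_of_derive_ge0 df) x0; last by rewrite sin0 subr0.
by move=> z _; rewrite subr_ge0 cos_le1.
Qed.

Lemma cos_ge_pos x : 0 <= x -> 0 <= cos x - 1 + x ^+ 2 / 2.
Proof.
have df (z : R) : is_derive z (1:R) (fun y => cos y - 1 + y ^+ 2 / 2) (z - sin z).
  have := is_deriveD (is_deriveB (is_derive_cos z) (is_derive_cst (1:R) (z:R) (1:R))) (is_derive_poly1 2^-1 z 1).
  by move=> H; apply: (is_derive_eq H); rewrite subr0 expr1; field.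
apply: (ge0_of_derive_ge0 df); last by rewrite cos0 expr0n/= mul0r addr0 subrr.
by move=> z z0; rewrite subr_ge0 sin_le.
Qed.

Lemma sin_ge_pos x : 0 <= x -> 0 <= sin x - x + x ^+ 3 / 6.
Proof.
have df (z : R) : is_derive z (1:R) (fun y => sin y - y + y ^+ 3 / 6) (cos z - 1 + z ^+ 2 / 2).
  have := is_deriveD (is_deriveB (is_derive_sin z) (is_derive_id z 1)) (is_derive_poly1 6^-1 z 2).
  by move=> H; apply: (is_derive_eq H); field.
apply: (ge0_of_derive_ge0 df); last by rewrite sin0 expr0n/= mul0r addr0 subrr.
by move=> z z0; exact: cos_ge_pos.
Qed.

Lemma cos_le_pos x : 0 <= x -> 0 <= 1 - cos x - x ^+ 2 / 2 + x ^+ 4 / 24.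
Proof.
have df (z : R) : is_derive z (1:R) (fun y => 1 - cos y - y ^+ 2 / 2 + y ^+ 4 / 24) (sin z - z + z ^+ 3 / 6).
  have := is_deriveD (is_deriveB (is_deriveB (is_derive_cst (1:R) (z:R) (1:R)) (is_derive_cos z))
    (is_derive_poly1 2^-1 z 1)) (is_derive_poly1 24^-1 z 3).
  by move=> H; apply: (is_derive_eq H); rewrite expr1; field.
apply: (ge0_of_derive_ge0 df); last by rewrite cos0 !expr0n/= !mul0r subrr subr0 addr0.
by move=> z z0; exact: sin_ge_pos.
Qed.

Lemma cos_taylor2 y : `|cos y - 1 + y ^+ 2 / 2| <= y ^+ 2.
Proof.
rewrite -(cos_norm y) -[y ^+ 2]real_normK ?num_real//.
have y0 := normr_ge0 y; move: (`|y|) y0 => {}y y0.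
have := cos_ge_pos y0; have := cos_le1 y; have := sqr_ge0 y.
by move=> h1 h2 h3; rewrite ger0_norm//; lra.
Qed.

Lemma cos_taylor3 y : `|cos y - 1 + y ^+ 2 / 2| <= `|y| ^+ 3.
Proof.
rewrite -(cos_norm y) -[y ^+ 2]real_normK ?num_real//.
have y0 := normr_ge0 y; move: (`|y|) y0 => {}y y0.
have := cos_ge_pos y0; have := cos_le1 y; have := sqr_ge0 y; have := cos_le_pos y0.
move=> h0 h1 h2 h3; rewrite ger0_norm//.
have [y1|y1] := leP y 1.
  have : y ^+ 4 <= y ^+ 3 by rewrite exprS ler_piMl ?exprn_ge0.
  have : 0 <= y ^+ 3 by rewrite exprn_ge0.
  lra.
have : y ^+ 2 <= y ^+ 3 by rewrite (exprS _ 2) ler_peMl ?sqr_ge0// ltW.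
lra.
Qed.

Lemma sin_taylor2 y : `|sin y - y| <= y ^+ 2.
Proof.
suff H (z : R) : 0 <= z -> `|sin z - z| <= z ^+ 2.
  have [y0|y0] := leP 0 y; first exact: H.
  by have := H (- y); rewrite sinN -opprD normrN sqrrN oppr_ge0 ltW//; apply.
move=> z0; have h1 := sin_le z0; have h2 := sin_ge_pos z0.
rewrite distrC ger0_norm ?subr_ge0//.
have [z6|z6] := leP z 6.
  have : z ^+ 3 <= 6 * z ^+ 2 by rewrite exprS ler_wpM2r ?sqr_ge0.
  lra.
have := sin_geN1 z; have : 6 * z <= z ^+ 2 by rewrite expr2 ler_wpM2r// ltW.
lra.
Qed.

Lemma sin_taylor3 y : `|sin y - y| <= `|y| ^+ 3.
Proof.
suff H (z : R) : 0 <= z -> `|sin z - z| <= z ^+ 3.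
  have [y0|y0] := leP 0 y; first by rewrite [X in _ <= X ^+ 3]ger0_norm//; exact: H.
  have := H (- y); rewrite sinN -opprD normrN [X in _ -> _ <= X ^+ 3]ltr0_norm// oppr_ge0 ltW//.
  exact.
move=> z0; have h1 := sin_le z0; have h2 := sin_ge_pos z0.
rewrite distrC ger0_norm ?subr_ge0//.
have : 0 <= z ^+ 3 by rewrite exprn_ge0.
lra.
Qed.

(* [E cos (Y_1 + ... + Y_n + b)] for independent [Y_i] in terms of the list of the
   pairs [(E cos Y_i, E sin Y_i)]. *)
Fixpoint trig_conv l b : R :=
  if l is (c, s) :: l' then c * trig_conv l' b + s * trig_conv l' (b + pi / 2)
  else cos b.

Lemma trig_convDpi l b : trig_conv l (b + pi / 2 + pi / 2) = - trig_conv l b.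
Proof.
elim: l b => [|[c s] l ih] b /=.
  by rewrite -addrA -splitr cosDpi.
by rewrite !ih; ring.
Qed.

(** [trig_conv l b] and [- trig_conv l (b + pi / 2)] are the real and imaginary parts of [e^{ib}]
    times the product of the [c + i s]. Hence the sum of squares is multiplicative along the
    list. *)
Lemma trig_conv_sqr_le1 l b : (forall p, p \in l -> p.1 ^+ 2 + p.2 ^+ 2 <= 1) ->
  trig_conv l b ^+ 2 + trig_conv l (b + pi / 2) ^+ 2 <= 1.
Proof.
elim: l b => [|[c s] l ih] b H /=.
  by rewrite cosDpihalf sqrrN cos2Dsin2.
rewrite trig_convDpi.
have := ih b (fun p pl => H p (mem_behead (s := (c, s) :: l) pl)).
have /= := H (c, s) (mem_head _ _).
move: (trig_conv l b) (trig_conv l (b + pi / 2)) => u v h1 h2.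
rewrite [leLHS](_ : _ = (c ^+ 2 + s ^+ 2) * (u ^+ 2 + v ^+ 2)); last by ring.
by rewrite mulr_ile1// addr_ge0 ?sqr_ge0.
Qed.

Lemma trig_conv_le1 l b : (forall p, p \in l -> p.1 ^+ 2 + p.2 ^+ 2 <= 1) ->
  `|trig_conv l b| <= 1.
Proof.
move=> H0; have H := @trig_conv_sqr_le1 l b H0.
rewrite -(@expr_le1 _ 2)// real_normK ?num_real//; apply: le_trans H.
by rewrite lerDl sqr_ge0.
Qed.

(** The classical comparison of two products of complex numbers in the unit disc: the factors are
    replaced by [rho] one at a time, and the remaining ones have modulus at most 1. *)
Lemma trig_conv_dist l b rho : (forall p, p \in l -> p.1 ^+ 2 + p.2 ^+ 2 <= 1) ->
  0 <= rho <= 1 ->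
  `|trig_conv l b - rho ^+ size l * cos b| <= \sum_(p <- l) (`|p.1 - rho| + `|p.2|).
Proof.
move=> + /andP[r0 r1]; elim: l b => [|[c s] l ih] b H /=.
  by rewrite big_nil mul1r subrr normr0.
have Hl p (pl : p \in l) := H p (mem_behead (s := (c, s) :: l) pl).
rewrite big_cons /= exprS.
have -> : c * trig_conv l b + s * trig_conv l (b + pi / 2) - rho * rho ^+ size l * cos b =
  (c - rho) * trig_conv l b + s * trig_conv l (b + pi / 2) +
  rho * (trig_conv l b - rho ^+ size l * cos b) by ring.
apply: le_trans (ler_normD _ _) _; apply: lerD.
  apply: le_trans (ler_normD _ _) _; rewrite !normrM.
  by apply: lerD; rewrite ler_piMr// trig_conv_le1.
by rewrite normrM ger0_norm//; apply: le_trans (ih b Hl); rewrite ler_piMl.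
Qed.

End TrigBounds.

Section TrigExpectation.
Context {d : measure_display} {T : measurableType d} {R : realType}.
Variables (P : probability T R).

(** With [q = c^2 + s^2], linearity gives [q = E w (c cos y + s sin y)]. The bracket is at most
    [(1 + q) / 2], as [z <= (1 + z^2) / 2] and by Cauchy-Schwarz in the plane; since [w] has mean 1,
    [q <= (1 + q) / 2]. *)
Lemma Ex_trig_sqr_le1 (w y : T -> R) : (forall x, 0 <= w x) ->
  measurable_fun setT y -> intble P w -> Ex P w = 1 ->
  Ex P (fun x => w x * cos (y x)) ^+ 2 + Ex P (fun x => w x * sin (y x)) ^+ 2 <= 1.
Proof.
move=> w0 my wi w1; have mw := intble_meas wi.
have ci : intble P (fun x => w x * cos (y x)).
  apply: (intble_dom _ _ wi); first by apply: measurable_funM => //; exact: measurable_cos_comp.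
  by move=> x; rewrite normrM ger0_norm// ler_piMr// cos_max.
have si : intble P (fun x => w x * sin (y x)).
  apply: (intble_dom _ _ wi); first by apply: measurable_funM => //; exact: measurable_sin_comp.
  by move=> x; rewrite normrM ger0_norm// ler_piMr// sin_max.
set c := Ex P (fun x => w x * cos _); set s := Ex P (fun x => w x * sin _).
set q := c ^+ 2 + s ^+ 2.
have : q <= Ex P (fun x => (q + 1) / 2 * w x).
  rewrite [leLHS](_ : q = Ex P (fun x => c * (w x * cos (y x)) + s * (w x * sin (y x)))); last first.
    by rewrite ExD ?ExZ//; exact: intbleZ.
  apply: le_Ex.
  - by apply: intbleD; exact: intbleZ.
  - exact: intbleZ.
  move=> x; rewrite [X in _ <= X]mulrC.
  rewrite [leLHS](_ : _ = w x * (c * cos (y x) + s * sin (y x))); last by ring.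
  rewrite ler_wpM2l//.
  have := cos2Dsin2 (y x); have := sqr_ge0 (c * cos (y x) + s * sin (y x) - 1).
  have := sqr_ge0 (c * sin (y x) - s * cos (y x)).
  rewrite /q; move: (cos (y x)) (sin (y x)) => u v h1 h2 h3.
  have e : (c * u + s * v) ^+ 2 = (c ^+ 2 + s ^+ 2) * (u ^+ 2 + v ^+ 2) - (c * v - s * u) ^+ 2 by ring.
  rewrite h3 mulr1 in e.
  have e2 : (c * u + s * v - 1) ^+ 2 = (c * u + s * v) ^+ 2 - 2 * (c * u + s * v) + 1 by ring.
  lra.
by rewrite ExZ// w1; lra.
Qed.

(* The product formula is an assumption so as to cover both independent copies
   ([w = 1]) and the increments of a single process under the tilt. *)
Lemma Ex_prod_cos_sum (I : eqType) (r : seq I) (w y : I -> T -> R) b :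
  uniq r ->
  (forall g : I -> T -> R,
    (forall i, i \in r -> g i = (fun x => w i x * cos (y i x)) \/
                          g i = (fun x => w i x * sin (y i x))) ->
    intble P (fun x => \prod_(i <- r) g i x) /\
    Ex P (fun x => \prod_(i <- r) g i x) = \prod_(i <- r) Ex P (g i)) ->
  Ex P (fun x => (\prod_(i <- r) w i x) * cos (\sum_(i <- r) y i x + b)) =
  trig_conv [seq (Ex P (fun x => w i x * cos (y i x)), Ex P (fun x => w i x * sin (y i x))) | i <- r] b.
Proof.
move=> ur mult.
pose g (sg : I -> bool) i := if sg i then (fun x => w i x * sin (y i x)) else (fun x => w i x * cos (y i x)).
(* [r2] holds the indices already expanded and [sg] records whether cosine or sine was chosen there.
   One more index is released by the addition formula, a sine in the remaining sum being a cosine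
   with phase increased by [pi / 2], up to sign. *)
suff H r1 r2 sg b' : perm_eq r (r1 ++ r2) ->
  intble P (fun x => (\prod_(i <- r1) w i x * cos (\sum_(i <- r1) y i x + b')) * \prod_(i <- r2) g sg i x) /\
  Ex P (fun x => (\prod_(i <- r1) w i x * cos (\sum_(i <- r1) y i x + b')) * \prod_(i <- r2) g sg i x) =
  trig_conv [seq (Ex P (fun x => w i x * cos (y i x)), Ex P (fun x => w i x * sin (y i x))) | i <- r1] b'
  * \prod_(i <- r2) Ex P (g sg i).
  have := H r [::] (fun=> false) b; rewrite cats0 perm_refl => /(_ isT)[_].
  rewrite big_nil mulr1 => <-; apply: eq_Ex => x.
  by rewrite big_nil mulr1.
elim: r1 r2 sg b' => [|i r1 ih] r2 sg b' pe.
  rewrite cat0s in pe.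
  have [] := mult (g sg).
    by move=> i _; rewrite /g; case: (sg i); [right|left].
  rewrite (perm_big _ pe)/= => i1 E1.
  have E2 : (fun x => \prod_(i <- r) g sg i x) = fun x => \prod_(i <- r2) g sg i x.
    by apply/funext => x; rewrite (perm_big _ pe).
  rewrite E2 in i1 E1.
  under eq_fun do rewrite !big_nil mul1r add0r.
  by split; [exact: intbleZ|rewrite ExZ// E1].
have pe' : perm_eq r (r1 ++ i :: r2).
  apply: perm_trans pe _; rewrite perm_sym.
  by have /permPl := perm_catCA r1 [:: i] r2.
have ir2 : i \notin r2.
  by move: ur; rewrite (perm_uniq pe)/= mem_cat negb_or => /andP[/andP[]].
pose sg' (e : bool) j := if j == i then e else sg j.
have gs e (F : (T -> R) -> R) : \prod_(j <- r2) F (g (sg' e) j) = \prod_(j <- r2) F (g sg j).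
  rewrite big_seq [RHS]big_seq; apply: eq_bigr => j jr.
  by rewrite /g /sg'; case: eqP => // ji; rewrite -ji jr in ir2.
have gi e : g (sg' e) i = if e then (fun x => w i x * sin (y i x)) else (fun x => w i x * cos (y i x)).
  by rewrite /g /sg' eqxx.
have [ic Ec] := ih (i :: r2) (sg' false) b' pe'.
have [is_ Es] := ih (i :: r2) (sg' true) (b' + pi / 2) pe'.
have E : (fun x => (\prod_(j <- i :: r1) w j x * cos (\sum_(j <- i :: r1) y j x + b')) * \prod_(j <- r2) g sg j x) =
 (fun x => (\prod_(j <- r1) w j x * cos (\sum_(j <- r1) y j x + b')) * \prod_(j <- i :: r2) g (sg' false) j x +
   (\prod_(j <- r1) w j x * cos (\sum_(j <- r1) y j x + (b' + pi / 2))) * \prod_(j <- i :: r2) g (sg' true) j x).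
  apply/funext => x; rewrite !big_cons !gi (gs false (fun f => f x)) (gs true (fun f => f x)).
  by rewrite addrA cosDpihalf -addrA cosD; ring.
rewrite E; split; first exact: intbleD.
by rewrite ExD// Ec Es !big_cons !gi !gs /=; ring.
Qed.

End TrigExpectation.

(** * Approximation by trigonometric polynomials *)

Section TrigPoly.
Context {R : realType} {k : nat}.
Implicit Types (x a : 'rV[R]_k) (f g : 'rV[R]_k -> R) (b c : R).

Inductive trig_poly : ('rV[R]_k -> R) -> Prop :=
| trig_poly_cos a b : trig_poly (fun x => cos (\sum_j a 0 j * x 0 j + b))
| trig_polyD f g : trig_poly f -> trig_poly g -> trig_poly (fun x => f x + g x)
| trig_polyZ c f : trig_poly f -> trig_poly (fun x => c * f x).

Lemma trig_poly_cst c : trig_poly (fun=> c).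
Proof.
have := trig_polyZ c (trig_poly_cos 0 0).
rewrite (_ : (fun x => _) = fun=> c)//; apply/funext => x.
by rewrite big1 ?addr0 ?cos0 ?mulr1// => j _; rewrite mxE mul0r.
Qed.

Lemma trig_polyM f g : trig_poly f -> trig_poly g -> trig_poly (fun x => f x * g x).
Proof.
move=> tf tg; elim: tf => [a b|f1 f2 _ h1 _ h2|c f1 _ h1]; last 2 first.
- by under eq_fun do rewrite mulrDl; exact: trig_polyD.
- by under eq_fun do rewrite -mulrA; exact: trig_polyZ.
elim: tg => [a' b'|f1 f2 _ h1 _ h2|c f1 _ h1]; last 2 first.
- by under eq_fun do rewrite mulrDr; exact: trig_polyD.
- by under eq_fun do rewrite mulrCA; exact: trig_polyZ.
have := trig_polyZ 2^-1 (trig_polyD (trig_poly_cos (a + a') (b + b')) (trig_poly_cos (a - a') (b - b'))).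
rewrite [X in trig_poly X -> _](_ : _ = fun x => cos (\sum_j a 0 j * x 0 j + b) * cos (\sum_j a' 0 j * x 0 j + b'))//.
apply/funext => x.
have -> : \sum_j (a + a') 0 j * x 0 j + (b + b') =
  (\sum_j a 0 j * x 0 j + b) + (\sum_j a' 0 j * x 0 j + b').
  rewrite addrACA -big_split/=; congr (_ + _); apply: eq_bigr => j _.
  by rewrite mxE mulrDl.
have -> : \sum_j (a - a') 0 j * x 0 j + (b - b') =
  (\sum_j a 0 j * x 0 j + b) - (\sum_j a' 0 j * x 0 j + b').
  rewrite opprD addrACA -sumrB/=; congr (_ + _); apply: eq_bigr => j _.
  by rewrite !mxE mulrBl.
by rewrite cosD cosB; field.
Qed.

Lemma trig_poly_prod (I : Type) (r : seq I) (F : I -> 'rV[R]_k -> R) :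
  (forall i, trig_poly (F i)) -> trig_poly (fun x => \prod_(i <- r) F i x).
Proof.
move=> tF; elim: r => [|i r ih].
  by under eq_fun do rewrite big_nil; exact: trig_poly_cst.
by under eq_fun do rewrite big_cons; exact: trig_polyM.
Qed.

Lemma trig_poly_sum (I : Type) (r : seq I) (F : I -> 'rV[R]_k -> R) :
  (forall i, trig_poly (F i)) -> trig_poly (fun x => \sum_(i <- r) F i x).
Proof.
move=> tF; elim: r => [|i r ih].
  by under eq_fun do rewrite big_nil; exact: trig_poly_cst.
by under eq_fun do rewrite big_cons; exact: trig_polyD.
Qed.

Lemma trig_poly_sin c (j : 'I_k) : trig_poly (fun x => sin (c * x 0 j)).
Proof.
have := trig_poly_cos (\row_i (if i == j then c else 0)) (- (pi / 2)).
rewrite [X in trig_poly X -> _](_ : _ = fun x => sin (c * x 0 j))//.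
apply/funext => x; rewrite (bigD1 j)//= big1 ?mxE ?eqxx ?addr0 ?cosBpihalf//.
by move=> i ij; rewrite mxE (negbTE ij) mul0r.
Qed.

Lemma trig_poly_bounded g : trig_poly g -> exists M, forall x, `|g x| <= M.
Proof.
elim=> [a b|f1 f2 _ [M1 h1] _ [M2 h2]|c f1 _ [M h]].
- by exists 1 => x; exact: cos_max.
- by exists (M1 + M2) => x; apply: le_trans (ler_normD _ _) _; exact: lerD.
- by exists (`|c| * M) => x; rewrite normrM ler_wpM2l.
Qed.

End TrigPoly.

(** * Bernstein polynomials and uniform approximation on a cube *)

Section Bernstein.
Context {R : realType}.
Implicit Types (q c : R) (g : nat -> R).

(* The binomial probability [C(n, i) q^i (1 - q)^(n - i)], in a form suited to induction on [n]. *)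
Fixpoint bern n q i : R :=
  if n is n'.+1 then (1 - q) * bern n' q i + q * (if i is i'.+1 then bern n' q i' else 0)
  else (i == 0%N)%:R.

Lemma bern_ge0 n q i : 0 <= q <= 1 -> 0 <= bern n q i.
Proof.
move=> /andP[q0 q1]; elim: n i => [|n ih] i /=; first by case: (i == _).
by rewrite addr_ge0// mulr_ge0 ?subr_ge0//; case: i.
Qed.

Lemma bern_gt n q i : (n < i)%N -> bern n q i = 0.
Proof.
elim: n i => [|n ih] i /=; first by case: i.
by case: i => // i ni; rewrite !ih ?mulr0 ?addr0// ltnW.
Qed.

Lemma bern_sumS n q g : \sum_(i < n.+2) bern n.+1 q i * g i =
  (1 - q) * (\sum_(i < n.+1) bern n q i * g i) +
  q * (\sum_(i < n.+1) bern n q i * g i.+1).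
Proof.
under eq_bigr do rewrite /= mulrDl.
rewrite big_split/=; congr (_ + _).
  rewrite big_ord_recr/= bern_gt// mulr0 mul0r addr0 mulr_sumr.
  by apply: eq_bigr => i _; rewrite mulrA.
rewrite big_ord_recl/= mulr0 mul0r add0r mulr_sumr.
by apply: eq_bigr => i _; rewrite mulrA.
Qed.

Lemma bern_sum n q : \sum_(i < n.+1) bern n q i = 1.
Proof.
suff : \sum_(i < n.+1) bern n q i * (fun=> 1) (i : nat) = 1.
  by under eq_bigr do rewrite mulr1.
elim: n => [|n ih]; first by rewrite big_ord1 /= mulr1.
by rewrite (bern_sumS n q (fun=> 1)) ih; ring.
Qed.

(** The centre [c] stays free for the induction: in the recursion, raising the index by one amounts
    to lowering [c] by one. *)
Lemma bern_sum2 n q c :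
  \sum_(i < n.+1) bern n q i * (i%:R - c) ^+ 2 = n%:R * q * (1 - q) + (n%:R * q - c) ^+ 2.
Proof.
elim: n c => [|n ih] c; first by rewrite big_ord1 /=; ring.
rewrite (bern_sumS n q (fun i => (i%:R - c) ^+ 2)) ih.
under [X in q * X]eq_bigr => i _.
  have -> : i.+1%:R - c = i%:R - (c - 1) :> R by rewrite -natr1; ring.
  over.
by rewrite ih -natr1; ring.
Qed.

Lemma bern_variance n q : 0 <= q <= 1 -> 
  \sum_(i < n.+2) bern n.+1 q i * (i%:R / n.+1%:R - q) ^+ 2 <= n.+1%:R^-1.
Proof.
move=> /andP[q0 q1].
have -> : \sum_(i < n.+2) bern n.+1 q i * (i%:R / n.+1%:R - q) ^+ 2 =
  n.+1%:R^-1 ^+ 2 * \sum_(i < n.+2) bern n.+1 q i * (i%:R - n.+1%:R * q) ^+ 2.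
  rewrite mulr_sumr; apply: eq_bigr => i _; rewrite [RHS]mulrCA; congr (_ * _).
  have : n.+1%:R != 0 :> R by rewrite pnatr_eq0.
  by move: (n.+1%:R : R) => y y0; field.
have yn0 : n.+1%:R != 0 :> R by rewrite pnatr_eq0.
rewrite bern_sum2 subrr expr0n/= addr0.
rewrite [leLHS](_ : _ = n.+1%:R^-1 * (q * (1 - q))); last first.
  by move: (n.+1%:R : R) yn0 => y y0; field.
by rewrite ler_piMr ?invr_ge0// mulr_ile1 ?subr_ge0// lerBlDr lerDl.
Qed.

End Bernstein.

Section UniformApproximation.
Context {R : realType}.

Lemma compact_uniform_continuity {X : pseudoMetricType R} (K : set X) (f : X -> R) (e : R) :
  compact K -> continuous f -> 0 < e ->
  exists2 del : R, 0 < del & forall x y, K x -> ball x del y -> `|f x - f y| <= e.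
Proof.
move=> /compact_near_coveringP cK cf e0.
have [] := cK R (0 : R)^'+ (fun del x => forall y, ball x del y -> `|f x - f y| <= e) _ _.
  move=> x Kx.
  have /cvgrPdist_lt/(_ (e / 2)) := cf x; rewrite divr_gt0// => /(_ isT).
  move=> /nbhs_ballP[r /= r0 br].
  exists (ball x (r / 2), [set del | del < r / 2]) => /=.
    split; first by apply: nbhsx_ballx; rewrite divr_gt0.
    by apply: nbhs_right_lt; rewrite divr_gt0.
  move=> [x' del] /= [bx' dr] y bxy.
  have h1 : `|f x - f x'| < e / 2.
    by apply: br; apply: le_ball bx'; rewrite ler_pdivrMr// ler_pMr// ler1n.
  have h2 : `|f x - f y| < e / 2.
    apply: br; rewrite (splitr r); apply: ball_triangle bx' _.
    by apply: le_ball bxy; exact: ltW.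
  rewrite (_ : f x' - f y = (f x - f y) - (f x - f x')); last by ring.
  by apply: le_trans (ler_normB _ _) _; lra.
move=> r /= r0 H; exists (r / 2); first by rewrite divr_gt0.
move=> x y Kx; apply: (H (r / 2)) => //=; last by rewrite divr_gt0.
by rewrite sub0r normrN ger0_norm ?divr_ge0 ?ltW// ltr_pdivrMr// ltr_pMr// ltr1n.
Qed.

(* [sin_coord L] maps the line to [0, 1] and [clamped_asin L] inverts it on [- L, L]:
   Bernstein polynomials in [sin_coord L] are trigonometric polynomials. *)
Definition clamped_asin (L q : R) : R :=
  L * asin (Num.max (- sin 1) (Num.min (2 * q - 1) (sin 1))).

Definition sin_coord (L t : R) : R := (1 + sin (L^-1 * t)) / 2.

Lemma sin1_lt1 : 0 <= (sin 1 : R) < 1.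
Proof.
have s0 : 0 <= sin 1 :> R by rewrite sin_ge0_pi// ler01 (le_trans _ (@pi_ge2 R))// ler1n.
rewrite s0/= -(@expr_lt1 _ 2)// sin2cos2 gtrBl exprn_gt0//.
exact: cos1_gt0.
Qed.

(** Clamping at [sin 1] keeps the argument of [asin] inside the open interval where it is
    continuous. The clamp is inactive at [sin_coord L t] for [|t| <= L], because then [|t / L| <= 1]
    and sine is monotone on that range. *)
Let clamp_bound q : -1 < Num.max (- sin 1) (Num.min (2 * q - 1) (sin 1)) < (1 : R).
Proof.
have /andP[s0 s1] := sin1_lt1.
rewrite lt_max gt_max ltrN2 s1/= gt_min s1 orbT andbT.
by rewrite (le_lt_trans _ (@ltr01 R))// oppr_le0.
Qed.

Lemma clamped_asin_continuous L : continuous (clamped_asin L).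
Proof.
move=> q; apply: cvgMl_tmp.
apply: (@continuous_comp _ _ _ (fun q : R => Num.max (- sin 1) (Num.min (2 * q - 1) (sin 1))) asin).
  apply: (@continuous_max _ _ (cst (- sin 1))); first exact: cst_continuous.
  apply: (@continuous_min _ _ (fun q : R => 2 * q - 1) (cst (sin 1))); last exact: cst_continuous.
  by apply: cvgB; [apply: cvgMl_tmp; exact: cvg_id|exact: cvg_cst].
exact/continuous_asin/clamp_bound.
Qed.

Lemma clamped_asin_bound L q : 0 < L -> `|clamped_asin L q| <= L * (pi / 2).
Proof.
move=> L0; rewrite /clamped_asin normrM gtr0_norm// ler_pM2l// ler_norml.
have /andP[/ltW h1 /ltW h2] := clamp_bound q.
by rewrite asin_geNpi2 ?asin_lepi2 ?h1.
Qed.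

Lemma sin_coord_itv L t : 0 <= sin_coord L t <= 1.
Proof.
rewrite /sin_coord; have := sin_le1 (L^-1 * t); have := sin_geN1 (L^-1 * t).
by move=> h1 h2; apply/andP; split; lra.
Qed.

Lemma clamped_asinK L t : 0 < L -> `|t| <= L -> clamped_asin L (sin_coord L t) = t.
Proof.
move=> L0 tL; rewrite /clamped_asin /sin_coord mulrCA divff ?mulr1 ?pnatr_eq0// addrAC subrr add0r.
have tl : -1 <= L^-1 * t <= 1.
  by rewrite -ler_norml normrM gtr0_norm ?invr_gt0// mulrC ler_pdivrMr// mul1r.
have pi1 := @pihalf_ge1 R.
have in1 (x : R) : -1 <= x <= 1 -> x \in `[(- (pi / 2)), (pi / 2)].
  by move=> /andP[h1 h2]; rewrite in_itv/=; apply/andP; split; lra.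
have ms (x y : R) : -1 <= x <= 1 -> -1 <= y <= 1 -> x <= y -> sin x <= sin y.
  move=> x1 y1; rewrite le_eqVlt => /predU1P[->//|xy].
  by apply/ltW; rewrite ltr_sin ?in1.
have /andP[t1 t2] := tl.
have o1 : -1 <= (1 : R) <= 1 by rewrite lexx andbT lerNl (le_trans (lerN10 _)).
have o2 : -1 <= (-1 : R) <= 1 by rewrite lexx (le_trans (lerN10 _)).
rewrite min_l; last exact: ms.
rewrite max_r; last first.
  by rewrite -sinN; exact: ms.
by rewrite sinK ?in1// mulrA mulfV ?mul1r ?gt_eqF.
Qed.

End UniformApproximation.

Section TrigApproximation.
Context {R : realType} {k : nat}.
Implicit Types (x : 'rV[R]_k) (f g : 'rV[R]_k -> R).

Lemma trig_poly_bern n L i (j : 'I_k) : trig_poly (fun x : 'rV[R]_k => bern n (sin_coord L (x 0 j)) i).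
Proof.
have tp : trig_poly (fun x : 'rV[R]_k => sin_coord L (x 0 j)).
  have := trig_polyZ 2^-1 (trig_polyD (trig_poly_cst 1) (trig_poly_sin L^-1 j)).
  rewrite [X in trig_poly X -> _](_ : _ = fun x => sin_coord L (x 0 j))//.
  by apply/funext => x; rewrite /sin_coord mulrC.
have tq : trig_poly (fun x : 'rV[R]_k => 1 - sin_coord L (x 0 j)).
  have := trig_polyD (trig_poly_cst 1) (trig_polyZ (-1) tp).
  rewrite [X in trig_poly X -> _](_ : _ = fun x => 1 - sin_coord L (x 0 j))//.
  by apply/funext => x; rewrite mulN1r.
elim: n i => [|n ih] i /=; first exact: trig_poly_cst.
apply: trig_polyD; apply: trig_polyM => //.
by case: i => [|i]; [exact: trig_poly_cst|exact: ih].
Qed.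

(** Bernstein's proof of the Weierstrass theorem, in [k] variables and in the coordinates
    [sin_coord L]. The approximant is an average of values of [f], so the bound [M] holds on the
    whole space; this controls the error outside the cube later. *)
Lemma trig_poly_approx f (M L e : R) : continuous f -> (forall x, `|f x| <= M) ->
  0 < L -> 0 < e ->
  exists2 g, trig_poly g & (forall x, `|g x| <= M) /\
    (forall x, (forall j, `|x 0 j| <= L) -> `|f x - g x| <= e).
Proof.
move=> cf fM L0 e0.
have M0 : 0 <= M by exact: le_trans (normr_ge0 _) (fM 0).
pose B := L * (pi / 2).
have e20 : 0 < e / 2 by rewrite divr_gt0.
have cB : compact [set v : 'rV[R]_k | forall i, `[- B, B]%classic (v ord0 i)].
  by apply: (@rV_compact _ _ (fun=> `[- B, B]%classic)) => i; exact: segment_compact.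
have [d1 d10 uf] := compact_uniform_continuity cB cf e20.
have [del del0 ua] := compact_uniform_continuity (@segment_compact R 0 1)
  (@clamped_asin_continuous R L) (divr_gt0 d10 (ltr0n _ 2)).
pose h (q : 'I_k -> R) : 'rV[R]_k := \row_j clamped_asin L (q j).
have hB q i : `[- B, B]%classic (h q ord0 i).
  by rewrite mxE /= in_itv/= -ler_norml clamped_asin_bound.
(* Chebyshev's device: if some coordinate is off by at least [del], then [c] times the sum of
   squares already exceeds the trivial bound [2 * M]. *)
pose c := 2 * M / del ^+ 2.
have c0 : 0 <= c by rewrite divr_ge0 ?exprn_ge0 ?(ltW del0)// mulr_ge0.
have fh q q' : (forall j, 0 <= q j <= 1) ->
    `|f (h q) - f (h q')| <= e / 2 + c * \sum_j (q' j - q j) ^+ 2.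
  move=> q01; have S0 : 0 <= \sum_j (q' j - q j) ^+ 2 by rewrite sumr_ge0// => j _; exact: sqr_ge0.
  have [near|] := pselect (forall j, `|q j - q' j| < del).
    apply: (@le_trans _ _ (e / 2)); last by rewrite lerDl mulr_ge0.
    apply: uf; first exact: hB.
    split => // i j; rewrite !mxE; apply: le_lt_trans (ua _ _ _ _) _.
    - by rewrite /= in_itv/= q01.
    - exact: near.
    - by rewrite ltr_pdivrMr// ltr_pMr// ltr1n.
  move=> /existsNP[j /negP]; rewrite -leNgt => far.
  apply: (@le_trans _ _ (2 * M)).
    by apply: le_trans (ler_normB _ _) _; rewrite mulr_natl mulr2n lerD.
  apply: (@le_trans _ _ (c * \sum_j (q' j - q j) ^+ 2)); last by rewrite lerDr ltW.
  rewrite /c -mulrA ler_peMr ?mulr_ge0// mulrC ler_pdivlMr ?exprn_gt0// mul1r.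
  have hd : del ^+ 2 <= (q' j - q j) ^+ 2.
    by rewrite -[leRHS]real_normK ?num_real// lerXn2r ?nnegrE ?(ltW del0)// distrC.
  apply: le_trans hd _; rewrite (bigD1 j)//= lerDl sumr_ge0// => i _.
  exact: sqr_ge0.
(* Chosen so that [c * k / (n + 1) <= e / 2], the sum of the [k] binomial variances times [c]. *)
pose n := Num.truncn (c * k%:R / (e / 2)).
pose w (i : {ffun 'I_k -> 'I_n.+2}) x := \prod_j bern n.+1 (sin_coord L (x 0 j)) (i j).
pose grid (i : {ffun 'I_k -> 'I_n.+2}) (j : 'I_k) : R := (i j)%:R / n.+1%:R.
pose g x := \sum_i f (h (grid i)) * w i x.
have w0 i x : 0 <= w i x by rewrite prodr_ge0// => j _; rewrite bern_ge0// sin_coord_itv.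
have w1 x : \sum_i w i x = 1.
  rewrite /w -(bigA_distr_bigA (fun j l => bern n.+1 (sin_coord L (x 0 j)) (l : 'I_n.+2))).
  by rewrite big1// => j _; exact: bern_sum.
exists g.
  by apply: trig_poly_sum => i; apply: trig_polyZ; apply: trig_poly_prod => j; exact: trig_poly_bern.
split=> x.
  rewrite /g; apply: le_trans (ler_norm_sum _ _ _) _.
  rewrite -[leRHS]mulr1 -(w1 x) mulr_sumr; apply: ler_sum => i _.
  by rewrite normrM (ger0_norm (w0 _ _)) ler_wpM2r.
move=> xL; pose q j := sin_coord L (x 0 j).
have hq : h q = x by apply/rowP => j; rewrite mxE clamped_asinK.
have -> : f x - g x = \sum_i (f (h q) - f (h (grid i))) * w i x.
  rewrite /g hq; under [RHS]eq_bigr do rewrite mulrBl.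
  by rewrite sumrB -mulr_sumr w1 mulr1.
apply: le_trans (ler_norm_sum _ _ _) _.
apply: (@le_trans _ _ (\sum_i (e / 2 + c * \sum_j (grid i j - q j) ^+ 2) * w i x)).
  apply: ler_sum => i _; rewrite normrM (ger0_norm (w0 _ _)) ler_wpM2r//.
  by apply: fh => j; exact: sin_coord_itv.
(* The sum over the grid factors over the coordinates: every factor but the one for [l] is a total
   mass 1, and that one is a binomial variance. *)
have V l : \sum_i (grid i l - q l) ^+ 2 * w i x <= n.+1%:R^-1.
  pose G (j : 'I_k) (i : 'I_n.+2) := (if j == l then (i%:R / n.+1%:R - q j) ^+ 2 else 1) * bern n.+1 (q j) i.
  rewrite [leLHS](_ : _ = \prod_j \sum_i G j i).
    rewrite (bigD1 l)//= [X in _ * X]big1 ?mulr1.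
      rewrite /G eqxx; under eq_bigr do rewrite mulrC.
      by apply: bern_variance; exact: sin_coord_itv.
    by move=> j jl; rewrite /G (negbTE jl); under eq_bigr do rewrite mul1r; exact: bern_sum.
  rewrite (bigA_distr_bigA G); apply: eq_bigr => i _.
  rewrite /G big_split/= /w; congr (_ * _).
  by rewrite (bigD1 l)//= eqxx big1 ?mulr1// => j /negbTE ->.
rewrite (_ : \sum_i _ = e / 2 + c * \sum_l \sum_i (grid i l - q l) ^+ 2 * w i x); last first.
  under eq_bigr do rewrite mulrDl.
  rewrite big_split/= -mulr_sumr w1 mulr1; congr (_ + _).
  rewrite exchange_big/= mulr_sumr; apply: eq_bigr => i _.
  by rewrite -mulrA mulr_suml.
rewrite {2}(splitr e) lerD2l.
apply: (@le_trans _ _ (c * (k%:R * n.+1%:R^-1))).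
  rewrite ler_wpM2l//; apply: le_trans (ler_sum _ (fun l _ => V l)) _.
  by rewrite sumr_const card_ord mulr_natl.
rewrite mulrA ler_pdivrMr// [leRHS]mulrC -ler_pdivrMr//.
by apply/ltW; exact: truncnS_gt.
Qed.

End TrigApproximation.

(** * Weak convergence from trigonometric moments *)

Section WeakConvergence.
Context {R : realType} {k : nat}.

Lemma measurable_trig_poly {d} {T : measurableType d} (Y : T -> 'rV[R]_k) (g : 'rV[R]_k -> R) :
  (forall j, measurable_fun setT (fun w => Y w 0 j)) -> trig_poly g ->
  measurable_fun setT (fun w => g (Y w)).
Proof.
move=> mY; elim=> [a b|f1 f2 _ h1 _ h2|c f1 _ h1].
- apply: measurable_cos_comp; apply: measurable_funD => //.
  by apply: measurable_sum => j; exact: measurable_funM.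
- exact: measurable_funD.
- exact: measurable_funM.
Qed.

(** Measurability is assumed coordinate by coordinate. [f (Y w)] is a pointwise limit of
    trigonometric polynomials in [Y w], the [n]-th one being accurate within [1/(n+1)] on the cube
    of half-side [n + 1]. *)
Lemma measurable_bounded_continuous {d} {T : measurableType d} (Y : T -> 'rV[R]_k) (f : 'rV[R]_k -> R) (M : R) :
  (forall j, measurable_fun setT (fun w => Y w 0 j)) ->
  continuous f -> (forall x, `|f x| <= M) -> measurable_fun setT (fun w => f (Y w)).
Proof.
move=> mY cf fM.
have H n : exists g : 'rV[R]_k -> R, trig_poly g /\
    (forall x : 'rV[R]_k, (forall j, `|x 0 j| <= n.+1%:R) -> `|f x - g x| <= n.+1%:R^-1).
  have nV0 : 0 < n.+1%:R^-1 :> R by rewrite invr_gt0.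
  have [g tg [_ gf]] := trig_poly_approx cf fM (ltr0Sn R n) nV0.
  by exists g.
have [g gP] := choice H.
apply: (@measurable_fun_cvg _ _ _ _ (fun n w => g n (Y w))) => //.
  by move=> n; apply: measurable_trig_poly => //; case: (gP n).
move=> w _; apply/cvgrPdist_le => e e0.
pose B : R := \sum_j `|Y w 0 j|.
exists (maxn (Num.truncn B) (Num.truncn e^-1)) => // n /=; rewrite geq_max => /andP[nB ne].
have [_ gn] := gP n.
apply: le_trans (gn _ _) _.
  move=> j; apply: (@le_trans _ _ B).
    by rewrite /B (bigD1 j)//= lerDl sumr_ge0.
  by apply: le_trans (ltW (truncnS_gt B)) _; rewrite ler_nat ltnS.
rewrite -[leRHS]invrK lef_pV2 ?posrE ?invr_gt0//.
by apply: le_trans (ltW (truncnS_gt e^-1)) _; rewrite ler_nat ltnS.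
Qed.

Context {d d' : measure_display} {T : measurableType d} {T' : measurableType d'}.
Variables (P : probability T R) (P' : probability T' R).
Variables (W : nat -> T -> R) (Y : nat -> T -> 'rV[R]_k) (Y' : T' -> 'rV[R]_k) (B : R).
Hypothesis W0 : forall N w, 0 <= W N w.
Hypothesis mY' : forall j, measurable_fun setT (fun w => Y' w 0 j).
Hypothesis reg : \forall N \near \oo,
  [/\ intble P (W N), Ex P (W N) = 1,
     (forall j, measurable_fun setT (fun w => Y N w 0 j)) &
     forall j, intble P (fun w => W N w * (Y N w 0 j) ^+ 2) /\
               Ex P (fun w => W N w * (Y N w 0 j) ^+ 2) <= B].
Hypothesis trig_cvg : forall (a : 'rV[R]_k) (b : R),
  Ex P (fun w => W N w * cos (\sum_j a 0 j * Y N w 0 j + b)) @[N --> \oo] -->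
  Ex P' (fun w => cos (\sum_j a 0 j * Y' w 0 j + b)).

Let intble_W (f : 'rV[R]_k -> R) N (M : R) : intble P (W N) -> measurable_fun setT (fun w => f (Y N w)) ->
  (forall x, `|f x| <= M) -> intble P (fun w => W N w * f (Y N w)).
Proof.
move=> iW mf fM; apply: (intble_dom _ _ (intbleZ M iW)).
  by apply: measurable_funM => //; exact: (intble_meas iW).
by move=> w; rewrite normrM ger0_norm// mulrC ler_wpM2r.
Qed.

Lemma trig_poly_cvg (g : 'rV[R]_k -> R) : trig_poly g ->
  Ex P (fun w => W N w * g (Y N w)) @[N --> \oo] --> Ex P' (fun w => g (Y' w)).
Proof.
elim=> [a b|f1 f2 t1 h1 t2 h2|c f1 t1 h1]; first exact: trig_cvg.
- have [M1 fM1] := trig_poly_bounded t1; have [M2 fM2] := trig_poly_bounded t2.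
  have i1 : intble P' (fun w => f1 (Y' w)) by exact: (intble_bounded _ (measurable_trig_poly mY' t1) (fun w => fM1 (Y' w))).
  have i2 : intble P' (fun w => f2 (Y' w)) by exact: (intble_bounded _ (measurable_trig_poly mY' t2) (fun w => fM2 (Y' w))).
  rewrite ExD//; apply: cvg_trans (cvgD h1 h2); apply: near_eq_cvg.
  move: reg; apply: filterS => N [iW _ mY _].
  have j1 : intble P (fun w => W N w * f1 (Y N w)) by exact: (intble_W iW (measurable_trig_poly mY t1) fM1).
  have j2 : intble P (fun w => W N w * f2 (Y N w)) by exact: (intble_W iW (measurable_trig_poly mY t2) fM2).
  have E : Ex P (fun w => W N w * (f1 (Y N w) + f2 (Y N w))) =
      Ex P (fun w => W N w * f1 (Y N w)) + Ex P (fun w => W N w * f2 (Y N w)).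
    by rewrite -ExD//; apply: eq_Ex => w; rewrite mulrDr.
  exact/esym.
- have [M1 fM1] := trig_poly_bounded t1.
  have i1 : intble P' (fun w => f1 (Y' w)) by exact: (intble_bounded _ (measurable_trig_poly mY' t1) (fun w => fM1 (Y' w))).
  have h2 : c * Ex P (fun w => W N w * f1 (Y N w)) @[N --> \oo] --> c * Ex P' (fun w => f1 (Y' w)).
    exact: cvgMl_tmp.
  rewrite ExZ//; apply: cvg_trans h2; apply: near_eq_cvg.
  move: reg; apply: filterS => N [iW _ mY _].
  have j1 : intble P (fun w => W N w * f1 (Y N w)) by exact: (intble_W iW (measurable_trig_poly mY t1) fM1).
  have E : Ex P (fun w => W N w * (c * f1 (Y N w))) = c * Ex P (fun w => W N w * f1 (Y N w)).
    by rewrite -ExZ//; apply: eq_Ex => w; rewrite mulrCA.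
  exact/esym.
Qed.

(** A bounded substitute for the indicator of the complement of the cube. Before the limit it is
    controlled by second moments, as in Chebyshev's inequality; for [Y'], where no moment is
    assumed, by dominated convergence with bound [k]. *)
Let chi (L : R) (x : 'rV[R]_k) : R := \sum_j Num.min 1 ((x 0 j) ^+ 2 / L ^+ 2).

Let chi_ge0 L x : 0 <= chi L x.
Proof.
rewrite sumr_ge0// => j _; rewrite le_min ler01/=.
by rewrite divr_ge0// ?sqr_ge0// exprn_even_ge0.
Qed.

Let chi_ge1 (L : R) (x : 'rV[R]_k) : 0 < L -> ~ (forall j, `|x 0 j| <= L) -> 1 <= chi L x.
Proof.
move=> L0 /existsNP[j /negP]; rewrite -ltNge => jL.
rewrite /chi (bigD1 j)//= min_l; last first.
  rewrite ler_pdivlMr ?exprn_gt0// mul1r -[leRHS]real_normK ?num_real//.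
  by rewrite lerXn2r ?nnegrE// ltW.
rewrite lerDl sumr_ge0// => i _; rewrite le_min ler01/=.
by rewrite divr_ge0// ?sqr_ge0// exprn_even_ge0.
Qed.

Let chi_le (L : R) (x : 'rV[R]_k) : chi L x <= \sum_j (x 0 j) ^+ 2 / L ^+ 2.
Proof. by apply: ler_sum => j _; rewrite ge_min lexx orbT. Qed.

Let chi_limit : Ex P' (fun w => chi n.+1%:R (Y' w)) @[n --> \oo] --> (0 : R).
Proof.
have mchi n : measurable_fun setT (fun w => chi n.+1%:R (Y' w)).
  apply: measurable_sum => j; apply: measurable_minr => //.
  by apply: measurable_funM => //; exact: measurable_funX.
have [] := @dominated_convergence _ T' R P' setT measurableT
  (fun n w => (chi n.+1%:R (Y' w))%:E) (fun=> 0%E) (fun=> k%:R%:E).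
- by move=> n; apply/measurable_EFinP; exact: mchi.
- exact: measurable_cst.
- apply: nearW => w _; apply: cvg_EFin; first exact: nearW.
  rewrite /=; apply: (@squeeze_cvgr _ _ _ _ (fun=> 0) (fun n => (\sum_j (Y' w 0 j) ^+ 2) * harmonic n)).
  + apply: nearW => n; rewrite chi_ge0/=; apply: le_trans (chi_le _ _) _.
    rewrite -mulr_suml ler_wpM2l ?sumr_ge0// => [i _|]; first exact: sqr_ge0.
    rewrite /harmonic/= lef_pV2 ?posrE ?exprn_gt0// expr2 ler_peMr//.
    by rewrite ler1n.
  + exact: cvg_cst.
  + rewrite -[X in _ --> X](mulr0 (\sum_j (Y' w 0 j) ^+ 2)).
    by apply: cvgMl_tmp; exact: cvg_harmonic.
- exact: intble_cst.
- apply: nearW => w n _ /=; rewrite lee_fin ger0_norm//.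
  rewrite /chi; apply: (@le_trans _ _ (\sum_(j < k) 1)).
    by apply: ler_sum => j _; rewrite ge_min lexx.
  by rewrite sumr_const card_ord.
move=> _ _; rewrite integral0 => h.
by apply: (fine_cvg h).
Qed.

Lemma bounded_continuous_cvg (f : 'rV[R]_k -> R) M : continuous f -> (forall x, `|f x| <= M) ->
  Ex P (fun w => W N w * f (Y N w)) @[N --> \oo] --> Ex P' (fun w => f (Y' w)).
Proof.
move=> cf fM.
have M0 : 0 <= M by exact: le_trans (normr_ge0 _) (fM 0).
(* [K] dominates the sum of the weighted second moments and is positive whatever [B] and [k]. Of the
   five parts [e1] of [e], two pay for replacing [f] by [g] under [P'], two for the same under [P],
   and one for the convergence with [g]; [eta] is such that [2 * M * eta <= e1]. *)
pose K := `|B| * k%:R + 1; have K0 : 0 < K by rewrite ltr_wpDl// mulr_ge0.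
apply/cvgrPdist_le => e e0.
pose e1 := e / 5; have e10 : 0 < e1 by rewrite divr_gt0.
pose eta := e1 / (2 * M + 1).
have M10 : 0 < 2 * M + 1 by rewrite ltr_wpDl// mulr_ge0.
have eta0 : 0 < eta by rewrite divr_gt0.
have [n [L0 Lchi LK]] : exists n, [/\ 0 < n.+1%:R :> R, Ex P' (fun w => chi n.+1%:R (Y' w)) <= eta & K / n.+1%:R ^+ 2 <= eta].
  have h1 : \forall n \near \oo, Ex P' (fun w => chi n.+1%:R (Y' w)) <= eta.
    move/cvgrPdist_le : chi_limit => /(_ _ eta0); apply: filterS => n.
    by rewrite sub0r normrN; apply: le_trans; exact: ler_norm.
  have h2 : \forall n \near \oo, K / n.+1%:R ^+ 2 <= eta.
    have /cvgrPdist_le/(_ (eta / K)) := @cvg_harmonic R; rewrite divr_gt0// => /(_ isT).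
    apply: filterS => n; rewrite sub0r normrN => h.
    have {}h : n.+1%:R^-1 <= eta / K by exact: le_trans (ler_norm _) h.
    rewrite ler_pdivlMr// in h; apply: le_trans h; rewrite mulrC ler_pM2r// lef_pV2 ?posrE ?exprn_gt0// expr2 ler_peMr//.
    by rewrite ler1n.
  have [n [H1 H2]] := @filter_ex _ _ _ _ (filterI h1 h2).
  by exists n; split.
set L : R := n.+1%:R in L0 Lchi LK.
have [g tg [gM fg]] := trig_poly_approx cf fM L0 e10.
have fgchi x : `|f x - g x| <= e1 + 2 * M * chi L x.
  have [xL|xL] := pselect (forall j, `|x 0 j| <= L).
    by apply: le_trans (fg _ xL) _; rewrite lerDl mulr_ge0// mulr_ge0.
  apply: (@le_trans _ _ (2 * M)).
    by apply: le_trans (ler_normB _ _) _; rewrite mulr_natl mulr2n lerD.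
  have : 2 * M <= 2 * M * chi L x by rewrite ler_peMr ?mulr_ge0// chi_ge1.
  lra.
have mchi (U : T' -> 'rV[R]_k) : (forall j, measurable_fun setT (fun w => U w 0 j)) ->
    measurable_fun setT (fun w => chi L (U w)).
  move=> mU; apply: measurable_sum => j; apply: measurable_minr => //.
  by apply: measurable_funM => //; exact: measurable_funX.
have chik x : `|chi L x| <= k%:R.
  rewrite ger0_norm// /chi; apply: (@le_trans _ _ (\sum_(j < k) 1)).
    by apply: ler_sum => j _; rewrite ge_min lexx.
  by rewrite sumr_const card_ord.
have ichi : intble P' (fun w => chi L (Y' w)) by exact: (intble_bounded _ (mchi _ mY') (fun w => chik _)).
have mg' : measurable_fun setT (fun w => g (Y' w)) by exact: measurable_trig_poly.
have mf' : measurable_fun setT (fun w => f (Y' w)) by exact: (measurable_bounded_continuous _ cf fM).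
have ig' : intble P' (fun w => g (Y' w)) by exact: (intble_bounded _ mg' (fun w => gM _)).
have if' : intble P' (fun w => f (Y' w)) by exact: (intble_bounded _ mf' (fun w => fM _)).
have etaM : 2 * M * eta <= e1.
  rewrite /eta mulrA ler_pdivrMr// mulrC ler_pM2l//.
  by rewrite lerDl.
have lim_close : `|Ex P' (fun w => f (Y' w)) - Ex P' (fun w => g (Y' w))| <= 2 * e1.
  rewrite -ExB//; apply: (@le_trans _ _ (Ex P' (fun w => e1 + 2 * M * chi L (Y' w)))).
    apply: normr_Ex_le; first exact: intbleB.
    - by apply: intbleD; [exact: intble_cst|exact: intbleZ].
    - by move=> w; exact: fgchi.
  rewrite ExD; [|exact: intble_cst|exact: intbleZ].
  rewrite Ex_cst ExZ//.
  have : 2 * M * Ex P' (fun w => chi L (Y' w)) <= 2 * M * eta by rewrite ler_wpM2l// mulr_ge0.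
  lra.
have /cvgrPdist_le/(_ _ e10) := trig_poly_cvg tg.
move: reg; apply: filterS2 => N [iW EW mY mY2] gN.
have mf : measurable_fun setT (fun w => f (Y N w)) by exact: (measurable_bounded_continuous _ cf fM).
have jg : intble P (fun w => W N w * g (Y N w)).
  by exact: (intble_W iW (measurable_trig_poly mY tg) gM).
have jf : intble P (fun w => W N w * f (Y N w)) by exact: (intble_W iW mf fM).
have N_close : `|Ex P (fun w => W N w * f (Y N w)) - Ex P (fun w => W N w * g (Y N w))| <= 2 * e1.
  pose q w := e1 * W N w + 2 * M / L ^+ 2 * \sum_j W N w * (Y N w 0 j) ^+ 2.
  have iS : intble P (fun w => \sum_j W N w * (Y N w 0 j) ^+ 2).
    by apply: intble_sum => j _; case: (mY2 j).
  rewrite -ExB//; apply: (@le_trans _ _ (Ex P q)).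
    apply: normr_Ex_le; first exact: intbleB.
    - by apply: intbleD; exact: intbleZ.
    move=> w; rewrite -mulrBr normrM ger0_norm//.
    apply: (@le_trans _ _ (W N w * (e1 + 2 * M * \sum_j (Y N w 0 j) ^+ 2 / L ^+ 2))).
      rewrite ler_wpM2l//; apply: le_trans (fgchi _) _; rewrite lerD2l.
      by apply: ler_wpM2l; [rewrite mulr_ge0|exact: chi_le].
    rewrite /q -mulr_suml -mulr_sumr.
    by rewrite le_eqVlt; apply/orP; left; apply/eqP; ring.
  rewrite ExD; [|exact: intbleZ|exact: intbleZ].
  rewrite ExZ// ExZ// EW mulr1 Ex_sum; last by move=> j _; case: (mY2 j).
  have SB : \sum_j Ex P (fun w => W N w * (Y N w 0 j) ^+ 2) <= K.
    apply: (@le_trans _ _ (\sum_(j < k) `|B|)).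
      by apply: ler_sum => j _; apply: le_trans (ler_norm B); case: (mY2 j).
    by rewrite sumr_const card_ord -mulr_natr /K lerDl.
  have L20 : 0 < L ^+ 2 by rewrite exprn_gt0.
  have : 2 * M / L ^+ 2 * \sum_j Ex P (fun w => W N w * (Y N w 0 j) ^+ 2) <= 2 * M * eta.
    rewrite -mulrA ler_wpM2l ?mulr_ge0//; apply: le_trans LK.
    by rewrite mulrC ler_pM2r ?invr_gt0.
  by move=> h; rewrite [leRHS]mulr_natl mulr2n lerD2l; exact: le_trans h etaM.
move: lim_close N_close gN.
set u := Ex P' _; set v := Ex P' _; set u' := Ex P _; set v' := Ex P _ => h1 h2 h3.
rewrite (_ : u - u' = (u - v) + (v - v') - (u' - v')); last by ring.
apply: le_trans (ler_normB _ _) _; apply: (@le_trans _ _ ((2 * e1 + e1) + 2 * e1)).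
  by apply: lerD => //; apply: le_trans (ler_normD _ _) _; exact: lerD.
by rewrite /e1; lra.
Qed.

End WeakConvergence.

(** * The normal law *)

Section Gaussian.
Context {R : realType}.
Variable s : R.
Hypothesis s0 : s != 0.

Local Notation mu := (@lebesgue_measure R).
Let Q : probability (measurableTypeR R) R := normal_prob 0 s.
Let p := normal_pdf 0 s.

Let pE x : p x = normal_peak s * expR (- x ^+ 2 / (s ^+ 2 *+ 2)).
Proof. by rewrite /p normal_pdfE// /normal_fun subr0. Qed.

Let p0 x : 0 <= p x. Proof. exact: normal_pdf_ge0. Qed.

Let mp : measurable_fun setT p. Proof. exact: measurable_normal_pdf. Qed.

Lemma ge0_integral_normal (f : R -> R) : measurable_fun setT f -> (forall x, 0 <= f x) ->
  (\int[Q]_x (f x)%:E = \int[mu]_x (f x * p x)%:E)%E.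
Proof.
move=> mf f0; have := @ge0_integral_weight _ (measurableTypeR R) R _ (measurableTypeR R) mu Q f p f 1%E.
rewrite mul1e => -> // B mB; rewrite mul1e /Q /= /normal_prob.
rewrite [RHS]integral_mkcond; apply: eq_integral => x _.
rewrite patchE indicE; case: ifP => xB.
  by rewrite mul1r.
by rewrite mul0r.
Qed.

Let pdf_shift x h : p (x - h) = p x * expR (h * x / s ^+ 2 - h ^+ 2 / (s ^+ 2 *+ 2)).
Proof.
rewrite !pE -[RHS]mulrA -expRD; congr (_ * expR _); field.
by [].
Qed.

(** The Cameron-Martin formula: translating the Gaussian density multiplies it by an exponential.
    Taking [h = s^2 u] makes this factor a multiple of [e^{u x}], so exponential moments come from
    translations alone. *)
Lemma ge0_normal_shift (f : R -> R) h : continuous f -> (forall x, 0 <= f x) ->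
  (\int[Q]_x (f (x + h))%:E =
   \int[Q]_x (f x * expR (h * x / s ^+ 2 - h ^+ 2 / (s ^+ 2 *+ 2)))%:E)%E.
Proof.
move=> cf f0.
have mf : measurable_fun setT f by exact: continuous_measurable_fun.
have msh : measurable_fun setT (fun x : R => f (x + h)).
  by apply: (measurableT_comp mf); exact: measurable_funD.
rewrite ge0_integral_normal//.
rewrite ge0_integral_normal; last 2 first.
- apply: measurable_funM => //; apply: measurable_expR_comp; apply: measurable_funB => //.
  by apply: measurable_funM => //; exact: measurable_funM.
- by move=> x; rewrite mulr_ge0 ?expR_ge0.
under [RHS]eq_integral => x _ do rewrite -mulrA [expR _ * _]mulrC -pdf_shift.
have dF (x : R) : is_derive x (1:R) (fun x : R => x + h) 1.
  by have := is_deriveD (is_derive_id (x:R) (1:R)) (is_derive_cst (h:R) (x:R) (1:R)); rewrite addr0.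
have F'E : (fun x : R => x + h)^`()%classic = cst 1.
  by apply/funext => x; rewrite derive1E; have [_ ->] := dF x.
rewrite (@increasing_ge0_integration_by_substitutionT R (fun x => x + h) (fun x => f x * p (x - h))).
- apply: eq_integral => x _; rewrite F'E /= !fctE /= mulr1 addrK.
  by [].
- by move=> x y; rewrite ltrD2r.
- by rewrite F'E => x; exact: cvg_cst.
- by rewrite F'E; exact: is_cvg_cst.
- by rewrite F'E; exact: is_cvg_cst.
- by move=> x; have [] := dF x.
- exact: cvg_addrr_Ny.
- exact: cvg_addrr.
- move=> x; apply: cvgM; first exact: cf.
  apply: (@continuous_comp _ _ _ (fun x : R => x - h) p); last exact: continuous_normal_pdf.
  by apply: cvgB; [exact: cvg_id|exact: cvg_cst].
- by move=> x; rewrite mulr_ge0.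
Qed.

Lemma normal_shift (f : R -> R) u : continuous f -> (forall x, 0 <= f x) ->
  (\int[Q]_x (f (x + s ^+ 2 * u))%:E =
   \int[Q]_x (f x * expR (u * x) * expR (- (s ^+ 2 * u ^+ 2 / 2)))%:E)%E.
Proof.
move=> cf f0; rewrite ge0_normal_shift//; apply: eq_integral => x _.
congr (_%:E); rewrite -[RHS]mulrA -expRD; congr (_ * expR _); field.
by [].
Qed.

Lemma normal_exp_intble u : intble Q (fun x => expR (u * x)).
Proof.
have me : measurable_fun setT (fun x : R => expR (u * x)).
  by apply: measurable_expR_comp; exact: measurable_funM.
set c := expR (- (s ^+ 2 * u ^+ 2 / 2)).
have ci : intble Q (fun x => expR (u * x) * c).
  apply: intble_ge0.
  - exact: measurable_funM.
  - by move=> x; rewrite mulr_ge0 ?expR_ge0.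
  have := @normal_shift (cst 1) u (@cst_continuous _ _ _) (fun=> ler01).
  under [RHS]eq_integral do rewrite /= mul1r.
  move=> <-; rewrite /= integral_cst//= probability_setT mule1 ltry//.
have := intbleZ c^-1 ci; rewrite [X in intble _ X](_ : _ = fun x => expR (u * x))//.
by apply/funext => x; rewrite mulrC mulfK// gt_eqF// expR_gt0.
Qed.

Let mexp u : measurable_fun setT (fun x : R => expR (u * x)).
Proof. by apply: measurable_expR_comp; exact: measurable_funM. Qed.

Let mid : measurable_fun setT (fun x : R => x). Proof. exact: measurable_id. Qed.

Let F b a := Ex Q (fun x => cos (a * x + b)).

Let mtrig (a b : R) : measurable_fun setT (fun x : R => cos (a * x + b)).
Proof. by apply: measurable_cos_comp; apply: measurable_funD => //; exact: measurable_funM. Qed.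

Let mtrigs (a b : R) : measurable_fun setT (fun x : R => sin (a * x + b)).
Proof. by apply: measurable_sin_comp; apply: measurable_funD => //; exact: measurable_funM. Qed.

Let icos a b : intble Q (fun x => cos (a * x + b)).
Proof. exact: (intble_bounded Q (mtrig a b) (fun x => cos_max _)). Qed.

Let isin a b : intble Q (fun x => sin (a * x + b)).
Proof. exact: (intble_bounded Q (mtrigs a b) (fun x => sin_max _)). Qed.

Let isinexp a b u : intble Q (fun x => sin (a * x + b) * expR (u * x)).
Proof.
apply: (intble_dom _ _ (normal_exp_intble u)).
  by apply: measurable_funM; [exact: mtrigs|exact: mexp].
by move=> x; rewrite normrM (ger0_norm (expR_ge0 _)) ler_piMl ?expR_ge0// sin_max.
Qed.

Let Ex_exp u : Ex Q (fun x => expR (u * x)) = expR (s ^+ 2 * u ^+ 2 / 2).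
Proof.
have := @normal_shift (cst 1) u (@cst_continuous _ _ _) (fun=> ler01).
move=> /(congr1 fine); rewrite -/(Ex Q _) -/(Ex Q _) Ex_cst.
have -> : Ex Q (fun x => cst 1 x * expR (u * x) * expR (- (s ^+ 2 * u ^+ 2 / 2))) =
   expR (- (s ^+ 2 * u ^+ 2 / 2)) * Ex Q (fun x => expR (u * x)).
  by rewrite -ExZ; [apply: eq_Ex => x; rewrite mul1r mulrC|exact: normal_exp_intble].
by move=> /(congr1 (fun z => expR (s ^+ 2 * u ^+ 2 / 2) * z)); rewrite mulr1 mulrA -expRD subrr expR0 mul1r => ->.
Qed.

Let sin_exp a b u : Ex Q (fun x => sin (a * x + b) * expR (u * x)) =
  expR (s ^+ 2 * u ^+ 2 / 2) * Ex Q (fun x => sin (a * (x + s ^+ 2 * u) + b)).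
Proof.
(* The shift formula is for nonnegative functions, hence the added 1; its contribution cancels
   through [Ex_exp]. *)
pose f x := 1 + sin (a * x + b).
have cf : continuous f.
  move=> x; apply: cvgD; first exact: cvg_cst.
  apply: (@continuous_comp _ _ _ (fun x : R => a * x + b) sin); last exact: continuous_sin.
  by apply: cvgD; [apply: cvgMl_tmp; exact: cvg_id|exact: cvg_cst].
have f0 x : 0 <= f x by have := sin_geN1 (a * x + b); rewrite /f; lra.
have := normal_shift u cf f0 => /(congr1 fine); rewrite -/(Ex Q _) -/(Ex Q _).
have ish : intble Q (fun x => sin (a * (x + s ^+ 2 * u) + b)).
  rewrite [X in intble _ X](_ : _ = fun x => sin (a * x + (a * (s ^+ 2 * u) + b))); first exact: isin.
  by apply/funext => x; congr sin; ring.
rewrite /f ExD//; last exact: intble_cst.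
rewrite Ex_cst.
set c := expR (- (s ^+ 2 * u ^+ 2 / 2)).
have -> : Ex Q (fun x => (1 + sin (a * x + b)) * expR (u * x) * c) =
   c * (expR (s ^+ 2 * u ^+ 2 / 2) + Ex Q (fun x => sin (a * x + b) * expR (u * x))).
  rewrite -Ex_exp -ExD; [|exact: normal_exp_intble|exact: isinexp].
  rewrite -ExZ; last by apply: intbleD; [exact: normal_exp_intble|exact: isinexp].
  by apply: eq_Ex => x; ring.
have cc : c * expR (s ^+ 2 * u ^+ 2 / 2) = 1 by rewrite -expRD addNr expR0.
rewrite mulrDr cc => /addrI ->.
by rewrite mulrA [expR _ * c]mulrC cc mul1r.
Qed.

Let weighted_derive (f : R -> R) : measurable_fun setT f -> (forall x, `|f x| <= 1) ->
  is_derive (0 : R) (1 : R) (fun u => Ex Q (fun x => f x * expR (u * x))) (Ex Q (fun x => f x * x)).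
Proof.
move=> mf f1.
have bi := intbleD (@intble_norm_pow_exp _ (measurableTypeR R) R Q (fun x => x) mid normal_exp_intble 2 1)
  (@intble_norm_pow_exp _ (measurableTypeR R) R Q (fun x => x) mid normal_exp_intble 2 (- 1)).
have ife u : intble Q (fun x => f x * expR (u * x)).
  apply: (intble_dom _ _ (normal_exp_intble u)).
    by apply: measurable_funM => //; exact: mexp.
  by move=> x; rewrite normrM (ger0_norm (expR_ge0 _)) ler_piMl ?expR_ge0.
have ifx : intble Q (fun x => f x * x).
  have := @intble_norm_pow_exp _ (measurableTypeR R) R Q (fun x => x) mid normal_exp_intble 1 0.
  apply: intble_dom; first exact: measurable_funM.
  by move=> x; rewrite mul0r expR0 mulr1 expr1 normrM ler_piMl.
apply: (@quadratic_is_derive _ _ _ _ (Ex Q (fun x => `|x| ^+ 2 * expR (1 * x) + `|x| ^+ 2 * expR (- 1 * x)))) => h h1.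
rewrite -ExB// -[X in _ - X]ExZ//.
rewrite -ExB; [|exact: intbleB|exact: intbleZ].
rewrite mulrC -ExZ//; apply: normr_Ex_le.
- by apply: intbleB; [exact: intbleB|exact: intbleZ].
- exact: intbleZ.
move=> x; rewrite add0r mul0r expR0 mulr1.
have -> : f x * expR (h * x) - f x - h * (f x * x) = f x * (expR (h * x) - 1 - h * x) by ring.
rewrite normrM; apply: le_trans (_ : `|expR (h * x) - 1 - h * x| <= _); first by rewrite ler_piMl.
apply: le_trans (expR_taylor1 _) _.
rewrite mul1r mulN1r -mulrDr real_normK ?num_real// mulrA -exprMn.
rewrite ler_wpM2l ?sqr_ge0//; apply: le_trans (expR_norm_le _).
by rewrite ler_expR normrM ler_piMl.
Qed.

(* Differentiates the exponential-shift formula [sin_exp] at [u = 0]. *)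
Let stein a b : Ex Q (fun x => sin (a * x + b) * x) = a * s ^+ 2 * F b a.
Proof.
have [_ <-] := weighted_derive (mtrigs a b) (fun x => sin_max (a * x + b)).
have -> : (fun u => Ex Q (fun x => sin (a * x + b) * expR (u * x))) =
  fun u => expR (s ^+ 2 / 2 * u ^+ 2) *
    (sin (a * s ^+ 2 * u) * F b a + cos (a * s ^+ 2 * u) * Ex Q (fun x => sin (a * x + b))).
  apply/funext => u; rewrite sin_exp; congr (expR _ * _); first by field.
  have -> : Ex Q (fun x => sin (a * (x + s ^+ 2 * u) + b)) =
    Ex Q (fun x => sin (a * s ^+ 2 * u) * cos (a * x + b) + cos (a * s ^+ 2 * u) * sin (a * x + b)).
    apply: eq_Ex => x; rewrite (_ : a * (x + s ^+ 2 * u) + b = a * s ^+ 2 * u + (a * x + b)); last by ring.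
    by rewrite sinD.
  by rewrite ExD ?ExZ//; exact: intbleZ.
have lin c (u : R) : is_derive u (1 : R) (fun u : R => c * u) c.
  by have := @is_deriveZ _ _ _ _ c u 1 _ (is_derive_id u 1); rewrite /GRing.scale/= mulr1.
set S0 := Ex Q _.
have d1 : is_derive (0:R) (1:R) (fun u : R => s ^+ 2 / 2 * u ^+ 2) 0.
  have := @is_deriveZ _ _ _ _ (s ^+ 2 / 2) (0:R) (1:R) _ (@is_deriveX _ _ _ 2 (0:R) (1:R) _ (is_derive_id (0:R) (1:R))).
  by rewrite /GRing.scale/= mulr1 expr1 mulr0 mulr0.
have d2 := is_derive_comp d1 (is_derive_expR _).
have d3 := is_derive_comp (lin (a * s ^+ 2) 0) (is_derive_sin _).
have d4 := is_derive_comp (lin (a * s ^+ 2) 0) (is_derive_cos _).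
have d5 := is_deriveM d2 (is_deriveD (is_deriveM d3 (is_derive_cst (F b a) (0:R) (1:R)))
   (is_deriveM d4 (is_derive_cst S0 (0:R) (1:R)))).
have [_ E] := d5.
rewrite [LHS](_ : _ = 'D_1 ((fun y => expR (s ^+ 2 / 2 * y ^+ 2)) * ((fun y => sin (a * s ^+ 2 * y)) * cst (F b a) + (fun y => cos (a * s ^+ 2 * y)) * cst S0)) 0)//.
rewrite E /GRing.scale/= !fctE/= !mulr0 expr0n/= mulr0 expR0 sin0 cos0; ring.
Qed.

(** The derivative of [F b] is minus the expectation of [x sin (a x + b)], and [stein] turns it back
    into [F b a]: a linear differential equation, which [Ex_normal_cos] solves by showing that
    [F b a * e^{s^2 a^2 / 2}] is constant. *)
Let F_derive b (a : R) : is_derive a (1 : R) (F b) (- (s ^+ 2 * a) * F b a).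
Proof.
have i2 := @intble_norm_pow_exp _ (measurableTypeR R) R Q (fun x => x) mid normal_exp_intble 2 0.
have isx : intble Q (fun x => sin (a * x + b) * x).
  have := @intble_norm_pow_exp _ (measurableTypeR R) R Q (fun x => x) mid normal_exp_intble 1 0.
  apply: intble_dom; first by apply: measurable_funM => //; exact: mtrigs.
  by move=> x; rewrite mul0r expR0 mulr1 expr1 normrM ler_piMl// sin_max.
apply: (@quadratic_is_derive _ _ _ _ (2 * Ex Q (fun x => `|x| ^+ 2 * expR (0 * x)))) => h h1.
have -> : F b (a + h) - F b a - h * (- (s ^+ 2 * a) * F b a) =
  F b (a + h) - F b a + h * Ex Q (fun x => sin (a * x + b) * x) by rewrite stein; ring.
rewrite /F -ExB// -ExZ// -ExD; [|exact: intbleB|exact: intbleZ].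
rewrite mulrAC -ExZ//; apply: normr_Ex_le.
- by apply: intbleD; [exact: intbleB|exact: intbleZ].
- exact: intbleZ.
move=> x; rewrite mul0r expR0 mulr1 real_normK ?num_real//.
have -> : (a + h) * x + b = (a * x + b) + h * x by ring.
rewrite cosD.
set y := a * x + b; set z := h * x.
have -> : cos y * cos z - sin y * sin z - cos y + h * (sin y * x) =
   cos y * (cos z - 1) - sin y * (sin z - z) by rewrite /z; ring.
have -> : 2 * h ^+ 2 * x ^+ 2 = z ^+ 2 + z ^+ 2 by rewrite /z; ring.
apply: le_trans (ler_normB _ _) _; apply: lerD; rewrite normrM.
  apply: (@le_trans _ _ `|cos z - 1|); first by rewrite ler_piMl ?cos_max.
  rewrite distrC ger0_norm ?subr_ge0 ?cos_le1//.
  have := cos_ge_pos (normr_ge0 z); rewrite cos_norm real_normK ?num_real//.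
  by have := sqr_ge0 z; lra.
by apply: le_trans (sin_taylor2 z); rewrite ler_piMl ?sin_max.
Qed.

Lemma Ex_normal_cos a b : Ex Q (fun x => cos (a * x + b)) = expR (- (s ^+ 2 * a ^+ 2 / 2)) * cos b.
Proof.
have d1 (c : R) : is_derive c (1:R) (fun u : R => s ^+ 2 / 2 * u ^+ 2) (s ^+ 2 * c).
  have := @is_deriveZ _ _ _ _ (s ^+ 2 / 2) c (1:R) _ (@is_deriveX _ _ _ 2 c (1:R) _ (is_derive_id c (1:R))).
  by move=> H; apply: (is_derive_eq H); rewrite /GRing.scale/= mulr1 expr1; field.
have d2 (c : R) : is_derive c (1:R) (fun u : R => F b u * expR (s ^+ 2 / 2 * u ^+ 2)) 0.
  have H := is_deriveM (F_derive b c) (is_derive_comp (d1 c) (is_derive_expR _)).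
  by apply: (is_derive_eq H); rewrite /GRing.scale/=; ring.
have := is_derive_0_is_cst a 0 d2.
rewrite expr0n/= mulr0 expR0 mulr1 => E.
have F0 : F b 0 = cos b.
  by rewrite /F -[RHS](Ex_cst Q); apply: eq_Ex => x; rewrite mul0r add0r.
rewrite -F0 -E -/(F b a) mulrCA -expRD.
rewrite (_ : _ + _ = 0) ?expR0 ?mulr1//.
by field.
Qed.

End Gaussian.

(** * Central limit theorem under the tilt *)

Section TiltedBlocks.
Context {d : measure_display} {T : measurableType d} {R : realType}.
Variables (P : probability T R) (xi : R -> T -> R) (psi : R -> R).
Hypothesis lexp : levy_exponent P xi psi.

Let m := derive1 psi 2.
Let v := derive1n 2 psi 2.
Hypothesis v0 : 0 < v.

Let levy : levy_process P xi. Proof. by case: lexp. Qed.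

Variables (tau a b : R) (n : nat).
Hypothesis tau0 : 0 < tau.
Hypothesis ngt0 : (0 < n)%N.
Hypothesis taun : tau <= n%:R.
Hypothesis n2tau : n%:R <= 2 * tau.

Let h := tau / n%:R.
Let sg := Num.sqrt (v * tau).

Let n0 : 0 < n%:R :> R. Proof. by rewrite ltr0n. Qed.
Let sg0 : 0 < sg. Proof. by rewrite sqrtr_gt0 mulr_gt0. Qed.
Let h0 : 0 <= h. Proof. by rewrite divr_ge0// ltW. Qed.
Let h1 : h <= 1. Proof. by rewrite ler_pdivrMr// mul1r. Qed.
Let nh : n%:R * h = tau. Proof. by rewrite mulrC divfK// gt_eqF. Qed.
Let w (y : R) := expR (2 * y - h * psi 2).
Let z (y : R) := a * (y - h * m) / sg.

Let mz : measurable_fun setT z.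
Proof. by apply: measurable_funM => //; apply: measurable_funM => //; exact: measurable_funB. Qed.

Let mw : measurable_fun setT w.
Proof. by apply: measurable_expR_comp; apply: measurable_funB => //; exact: measurable_funM. Qed.

Let mx : measurable_fun setT (xi h). Proof. exact: (levy_measurable levy h0). Qed.

Let third : intble P (fun x => tilt xi psi h x * `|xi h x - h * m| ^+ 3) /\
  Ex P (fun x => tilt xi psi h x * `|xi h x - h * m| ^+ 3) <= tilt3_bound psi.
Proof. exact: tilt_third. Qed.

Let K := tilt3_bound psi.

Let E3 : intble P (fun x => w (xi h x) * `|z (xi h x)| ^+ 3) /\
  Ex P (fun x => w (xi h x) * `|z (xi h x)| ^+ 3) <= (`|a| / sg) ^+ 3 * K.
Proof.
have [i3 E3] := third.
have -> : (fun x => w (xi h x) * `|z (xi h x)| ^+ 3) =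
  (fun x => (`|a| / sg) ^+ 3 * (tilt xi psi h x * `|xi h x - h * m| ^+ 3)).
  apply/funext => x; rewrite /z !normrM normfV (gtr0_norm sg0) /w /tilt.
  by rewrite !expr_div_n !exprMn; ring.
split; first exact: intbleZ.
by rewrite ExZ// ler_wpM2l// exprn_ge0// divr_ge0// ltW.
Qed.

Let E2 : intble P (fun x => w (xi h x) * z (xi h x) ^+ 2) /\
  Ex P (fun x => w (xi h x) * z (xi h x) ^+ 2) = a ^+ 2 / n%:R.
Proof.
have [i2 E2] := tilt_variance lexp h0.
have -> : (fun x => w (xi h x) * z (xi h x) ^+ 2) =
  (fun x => (a / sg) ^+ 2 * (tilt xi psi h x * (xi h x - h * m) ^+ 2)).
  by apply/funext => x; rewrite /z /w /tilt !expr_div_n !exprMn; ring.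
split; first exact: intbleZ.
rewrite ExZ// E2 expr_div_n sqr_sqrtr; last by rewrite mulr_ge0 ?ltW.
rewrite -/v /h; field.
by rewrite !gt_eqF//; apply: ltr0n.
Qed.

Let E1 : intble P (fun x => w (xi h x) * z (xi h x)) /\
  Ex P (fun x => w (xi h x) * z (xi h x)) = 0.
Proof.
have [i1 E1] := tilt_centered lexp h0.
have -> : (fun x => w (xi h x) * z (xi h x)) =
  (fun x => (a / sg) * (tilt xi psi h x * (xi h x - h * m))).
  by apply/funext => x; rewrite /z /w /tilt; ring.
by split; [exact: intbleZ|rewrite ExZ// E1 mulr0].
Qed.

Let iw : intble P (fun x => w (xi h x)). Proof. exact: (tilt_intble lexp h0). Qed.
Let Ew : Ex P (fun x => w (xi h x)) = 1. Proof. exact: (Ex_tilt lexp h0). Qed.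
Let wge0 y : 0 <= w y. Proof. exact: expR_ge0. Qed.

Let icos : intble P (fun x => w (xi h x) * cos (z (xi h x))).
Proof.
apply: (intble_dom _ _ iw).
  apply: measurable_funM; first exact: (measurableT_comp mw mx).
  by apply: measurable_cos_comp; exact: (measurableT_comp mz mx).
by move=> x; rewrite normrM ger0_norm// ler_piMr// cos_max.
Qed.

Let isin : intble P (fun x => w (xi h x) * sin (z (xi h x))).
Proof.
apply: (intble_dom _ _ iw).
  apply: measurable_funM; first exact: (measurableT_comp mw mx).
  by apply: measurable_sin_comp; exact: (measurableT_comp mz mx).
by move=> x; rewrite normrM ger0_norm// ler_piMr// sin_max.
Qed.

Let c := Ex P (fun x => w (xi h x) * cos (z (xi h x))).
Let s := Ex P (fun x => w (xi h x) * sin (z (xi h x))).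

Let c_bound : `|c - (1 - a ^+ 2 / 2 / n%:R)| <= (`|a| / sg) ^+ 3 * K.
Proof.
have [i3 b3] := E3; have [i2 e2] := E2.
apply: le_trans b3.
have i2' := intbleZ 2^-1 i2.
have -> : c - (1 - a ^+ 2 / 2 / n%:R) = Ex P (fun x => w (xi h x) * cos (z (xi h x)) - w (xi h x) + 2^-1 * (w (xi h x) * z (xi h x) ^+ 2)).
  rewrite ExD//; last exact: intbleB.
  by rewrite ExB// ExZ// Ew e2 /c; ring.
apply: normr_Ex_le => //.
  by apply: intbleD => //; exact: intbleB.
move=> x; rewrite (_ : _ + _ = w (xi h x) * (cos (z (xi h x)) - 1 + z (xi h x) ^+ 2 / 2)); last by ring.
by rewrite normrM ger0_norm// ler_wpM2l// cos_taylor3.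
Qed.

Let s_bound : `|s| <= (`|a| / sg) ^+ 3 * K.
Proof.
have [i3 b3] := E3; have [i1 e1] := E1.
apply: le_trans b3.
have -> : s = Ex P (fun x => w (xi h x) * sin (z (xi h x)) - w (xi h x) * z (xi h x)).
  by rewrite ExB// e1 subr0.
apply: normr_Ex_le => //; first exact: intbleB.
move=> x; rewrite -mulrBr normrM ger0_norm// ler_wpM2l//.
exact: sin_taylor3.
Qed.

Let u (j : nat) : R := j%:R * h.

Let umono j : u j <= u j.+1.
Proof. by rewrite /u ler_wpM2r// ler_nat. Qed.

Let uS j : u j.+1 - u j = h.
Proof. by rewrite /u -natr1; ring. Qed.

Let D j x := xi (u j.+1) x - xi (u j) x.

Let block_law j (phi : R -> R) : measurable_fun setT phi -> Ex P (fun x => phi (D j x)) = Ex P (fun x => phi (xi h x)).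
Proof.
move=> mphi; have uj0 : 0 <= u j by rewrite /u mulr_ge0.
apply: (same_law_Ex (levy_incr_measurable levy uj0 (umono j)) mx) => // B mB.
by rewrite (levy_incr_law levy uj0 (umono j))// uS.
Qed.

(** The tilt is multiplicative: up to [xi 0 = 0] almost surely, [tilt] at [tau] is the product of
    the weights [w (D j x)]. So the increments still factor under the tilt, with one and the same
    pair [(c, s)] for every block. *)
Let block_expansion :
  Ex P (fun x => tilt xi psi tau x * cos (a * (xi tau x - tau * m) / sg + b)) =
  trig_conv [seq (c, s) | j <- index_iota 0 n] b.
Proof.
have mwc : measurable_fun setT (fun y => w y * cos (z y)).
  by apply: measurable_funM => //; exact: measurable_cos_comp.
have mws : measurable_fun setT (fun y => w y * sin (z y)).
  by apply: measurable_funM => //; exact: measurable_sin_comp.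
have := @Ex_prod_cos_sum _ T R P _ (index_iota 0 n) (fun j x => w (D j x)) (fun j x => z (D j x)) b (iota_uniq _ _).
rewrite (_ : [seq _ | _ <- _] = [seq (c, s) | j <- index_iota 0 n]); last first.
  by apply: eq_map => j; rewrite (block_law j mwc) (block_law j mws).
move=> <-; last first.
  move=> g gP.
  pose phi j (y : R) := if pselect (g j = (fun x => w (D j x) * cos (z (D j x)))) then w y * cos (z y) else w y * sin (z y).
  have mphi j : measurable_fun setT (phi j) by rewrite /phi; case: pselect.
  have gE j : j \in index_iota 0 n -> g j = (fun x => phi j (D j x)).
    by move=> jn; rewrite /phi; case: pselect => // h'; case: (gP j jn).
  have [||i E] := @levy_incr_Ex_prod _ T R P xi levy n u phi _ (fun j _ => umono j) mphi.
  - by rewrite /u mul0r.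
  - by move=> j jn; rewrite uS /phi; case: pselect.
  have Eg : (fun x => \prod_(i <- index_iota 0 n) g i x) = (fun x => \prod_(0 <= j < n) phi j (D j x)).
    by apply/funext => x; rewrite big_seq [RHS]big_seq; apply: eq_bigr => j jn; rewrite gE.
  rewrite Eg; split; first exact: i.
  rewrite -[LHS]/(Ex P (fun w => \prod_(0 <= j < n) phi j (xi (u j.+1) w - xi (u j) w))) E.
  apply: eq_big_seq => j jn.
  by rewrite (gE j jn) uS (block_law j (mphi j)).
have mD j : measurable_fun setT (D j).
  by apply: (levy_incr_measurable levy); [rewrite /u mulr_ge0|exact: umono].
apply: Ex_ae.
- apply: measurable_funM; first exact: (intble_meas (tilt_intble lexp (ltW tau0))).
  apply: measurable_cos_comp; apply: measurable_funD => //; apply: measurable_funM => //.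
  apply: measurable_funM => //; apply: measurable_funB => //.
  exact: (levy_measurable levy (ltW tau0)).
- apply: measurable_funM.
    by apply: measurable_prod => j _; exact: (measurableT_comp mw (mD j)).
  apply: measurable_cos_comp; apply: measurable_funD => //.
  by apply: measurable_sum => j; exact: (measurableT_comp mz (mD j)).
apply: filterS (levy0_ae levy) => x x0.
have SD : \sum_(0 <= j < n) D j x = xi tau x.
  by rewrite (telescope_sumr (fun j => xi (u j) x)) // {1}/u nh /u mul0r x0 subr0.
congr (_ * cos (_ + b)).
  rewrite /w -expR_sum /tilt; congr expR.
  rewrite sumrB -mulr_sumr SD sumr_const_nat subn0; congr (_ - _).
  by rewrite -[RHS]mulr_natl mulrA nh.
rewrite /z -mulr_suml -mulr_sumr sumrB SD sumr_const_nat subn0 -mulr_natl mulrA nh.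
by [].
Qed.

(* Splits [0, tau] into [n] increments of length [h <= 1], whose tilted third absolute
   moments are bounded uniformly in [h]. *)
Lemma tilted_trig_bound_blocks :
  `|Ex P (fun x => tilt xi psi tau x * cos (a * (xi tau x - tau * m) / sg + b)) -
    expR (- (a ^+ 2 / 2)) * cos b| <=
  4 * `|a| ^+ 3 * tilt3_bound psi / v / sg + (a ^+ 2 / 2) ^+ 2 * expR (a ^+ 2 / 2) / tau.
Proof.
pose q := a ^+ 2 / 2; have q0 : 0 <= q by rewrite divr_ge0 ?sqr_ge0.
pose rho := expR (- (q / n%:R)).
have rhon : expR (- (a ^+ 2 / 2)) = rho ^+ size [seq (c, s) | j <- index_iota 0 n].
  by rewrite size_map size_iota subn0 /rho -expRM_natl -/q; congr expR; field; rewrite gt_eqF.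
have K0 : 0 <= K.
  by rewrite /K /tilt3_bound addr_ge0// mulr_ge0// ?addr_ge0 ?expR_ge0 ?exprn_ge0.
have cs1 : c ^+ 2 + s ^+ 2 <= 1.
  apply: (@Ex_trig_sqr_le1 _ _ _ P (fun x => w (xi h x)) (fun x => z (xi h x))) => //.
  exact: (measurableT_comp mz mx).
rewrite block_expansion rhon.
apply: le_trans (trig_conv_dist _ _ _) _.
- by move=> p /mapP[j _ ->].
- by rewrite expR_ge0/= -expR0 ler_expR oppr_le0 divr_ge0// ltW.
rewrite big_map big_const_seq count_predT size_iota subn0 iter_addr_0.
set e3 := (`|a| / sg) ^+ 3 * K.
have rhob : `|rho - (1 - q / n%:R)| <= (q / n%:R) ^+ 2 * expR q.
  have := expR_taylor1 (- (q / n%:R)); rewrite -/rho sqrrN normrN opprK.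
  have -> : rho - 1 + q / n%:R = rho - (1 - q / n%:R) by ring.
  move=> hh; apply: le_trans hh _; rewrite ler_wpM2l ?sqr_ge0// ler_expR.
  rewrite ger0_norm; last by rewrite divr_ge0// ltW.
  by rewrite ler_pdivrMr// ler_peMr// ler1n.
have cr : `|c - rho| <= e3 + (q / n%:R) ^+ 2 * expR q.
  have -> : c - rho = (c - (1 - q / n%:R)) - (rho - (1 - q / n%:R)) by ring.
  by apply: le_trans (ler_normB _ _) _; apply: lerD.
have : (`|c - rho| + `|s|) *+ n <= (2 * e3 + (q / n%:R) ^+ 2 * expR q) *+ n.
  apply: ler_wMn2r; apply: le_trans (lerD cr s_bound) _.
  by rewrite -/e3 addrAC mulr_natl mulr2n.
move=> hh; apply: le_trans hh _; rewrite mulrnDl; apply: lerD; rewrite -[leLHS]mulr_natl.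
  (* The constant 4 of the bound: one factor 2 from [n <= 2 tau], one because both the cosine and
     the sine contribute [e3]. The cancellation of [tau] then uses [sg^2 = v tau]. *)
  apply: (@le_trans _ _ (2 * tau * (2 * e3))).
    by rewrite ler_wpM2r// mulr_ge0// mulr_ge0// exprn_ge0// divr_ge0// ltW.
  rewrite /e3 le_eqVlt; apply/orP; left; apply/eqP.
  have sgsg : sg ^+ 2 = v * tau by rewrite sqr_sqrtr// mulr_ge0 ?ltW.
  have -> : (`|a| / sg) ^+ 3 = `|a| ^+ 3 / (v * tau) / sg.
    by rewrite -sgsg; field; rewrite gt_eqF.
  by rewrite /K; field; rewrite !gt_eqF.
have -> : n%:R * ((q / n%:R) ^+ 2 * expR q) = q ^+ 2 * expR q / n%:R.
  by field; rewrite gt_eqF.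
apply: ler_wpM2l; first by rewrite mulr_ge0 ?sqr_ge0 ?expR_ge0.
by rewrite lef_pV2 ?posrE.
Qed.

End TiltedBlocks.

Lemma tilted_trig_bound {d : measure_display} {T : measurableType d} {R : realType}
    (P : probability T R) (xi : R -> T -> R) (psi : R -> R) (tau a b : R) :
  levy_exponent P xi psi -> 0 < derive1n 2 psi 2 -> 1 <= tau ->
  `|Ex P (fun x => tilt xi psi tau x *
      cos (a * (xi tau x - tau * derive1 psi 2) / Num.sqrt (derive1n 2 psi 2 * tau) + b)) -
    expR (- (a ^+ 2 / 2)) * cos b| <=
  4 * `|a| ^+ 3 * tilt3_bound psi / derive1n 2 psi 2 / Num.sqrt (derive1n 2 psi 2 * tau) +
  (a ^+ 2 / 2) ^+ 2 * expR (a ^+ 2 / 2) / tau.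
Proof.
move=> lexp v0 tau1; have tau0 := lt_le_trans ltr01 tau1.
(* The number of blocks is the integer part of [tau] plus one; it lies between [tau] and [2 tau]
   because [tau >= 1]. *)
apply: (tilted_trig_bound_blocks lexp v0 a b tau0 (ltn0Sn (Num.truncn tau))).
  by rewrite ltW// truncnS_gt.
have : (Num.truncn tau)%:R <= tau by rewrite truncn_le// ltW.
rewrite -natr1 mulr_natl mulr2n => h; exact: lerD.
Qed.

(** * Convergence of the tilted distribution function *)

Section NormalCdf.
Context {R : realType}.
Local Notation Q := (normal_prob 0 1 : probability (measurableTypeR R) R).

Lemma normal_itv_le (a b : R) : a <= b ->
  Ex Q (\1_(`]a, b]%classic)) <= b - a.
Proof.
move=> ab; rewrite Ex_indic; last exact: measurable_itv.
have fin : Q `]a, b]%classic \is a fin_num by exact: fin_num_measure.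
rewrite -lee_fin fineK// /= /normal_prob.
have lb : (b - a)%:E = (\int[lebesgue_measure]_(x in `]a, b]%classic) (cst 1 x))%E :> \bar R.
  rewrite integral_cst//= mul1e lebesgue_measure_itv/= lte_fin.
  by move: ab; rewrite le_eqVlt => /predU1P[->|->]//; rewrite ltxx subrr.
rewrite lb; apply: ge0_le_integral => //=.
- by move=> x _; rewrite lee_fin normal_pdf_ge0.
- by apply/measurable_EFinP; apply: measurable_funTS; exact: measurable_normal_pdf.
move=> x _; rewrite lee_fin; apply: le_trans (normal_pdf_ub _ _ (oner_neq0 _)) _.
rewrite /normal_peak expr1n mul1r invf_le1; last by rewrite sqrtr_gt0 mulrn_wgt0// pi_gt0.
rewrite -[leLHS]sqrtr1 ler_sqrt; last by rewrite mulrn_wge0// pi_ge0.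
by have := @pi_ge2 R; rewrite mulr2n; lra.
Qed.

Lemma std_normal_cdfE (x : R) : std_normal_cdf x = Ex Q (\1_(`]-oo, x]%classic)).
Proof.
rewrite Ex_indic; last exact: measurable_itv.
by rewrite /std_normal_cdf; congr (fine (normal_prob 0 1 _)).
Qed.

(** The Lipschitz constant 1 comes from the peak [1 / sqrt (2 pi)] of the density being below 1. It
    quantifies what moving the threshold costs. *)
Lemma std_normal_cdf_lip (a b : R) : a <= b ->
  std_normal_cdf a <= std_normal_cdf b <= std_normal_cdf a + (b - a).
Proof.
move=> ab; rewrite !std_normal_cdfE.
have i (x : R) : intble Q (\1_(`]-oo, x]%classic)).
  by apply: (@integrable_indic _ (measurableTypeR R)); exact: measurable_itv.
have i2 : intble Q (\1_(`]a, b]%classic)).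
  by apply: (@integrable_indic _ (measurableTypeR R)); exact: measurable_itv.
apply/andP; split.
  apply: le_Ex => // x; rewrite !indicE ler_nat !mem_setE !in_itv/=.
  by case: (leP x a) => // xa; rewrite (le_trans xa ab).
apply: (@le_trans _ _ (Ex Q (\1_(`]-oo, a]%classic)) + Ex Q (\1_(`]a, b]%classic)))); last first.
  by rewrite lerD2l normal_itv_le.
rewrite -ExD//; apply: le_Ex => //; first exact: intbleD.
move=> x; rewrite !indicE !mem_setE !in_itv/=.
by case: (leP x a) => //= xa; case: (leP x b) => //=; rewrite ?addr0 ?add0r// ?ler01// lerDl.
Qed.

Lemma std_normal_cdf_bounds (x : R) : 0 <= std_normal_cdf x <= 1.
Proof.
rewrite /std_normal_cdf; apply/andP; split; first by rewrite fine_ge0.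
have mI : measurable ([set y : R | y <= x] : set R).
  by rewrite (_ : mkset _ = `]-oo, x]%classic)//; apply/seteqP; split => y /=; rewrite in_itv.
by rewrite -lee_fin fineK ?fin_num_measure// (probability_le1 Q).
Qed.

End NormalCdf.

Section TiltedCdf.
Context {d : measure_display} {T : measurableType d} {R : realType}.
Variables (P : probability T R) (psi : R -> R) (zeta : nat -> R -> T -> R).
Variables (tau x : nat -> R) (theta : R).
Hypothesis lexp : forall N, levy_exponent P (zeta N) psi.

Let m := derive1 psi 2.
Let v := derive1n 2 psi 2.
Hypothesis v0 : 0 < v.
Hypothesis tau_cvg : tau N @[N --> \oo] --> +oo.
Let sg N := Num.sqrt (v * tau N).
Hypothesis x_cvg : (x N - tau N * m) / sg N @[N --> \oo] --> theta.

Let V N w := (zeta N (tau N) w - tau N * m) / sg N.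
Let W N w := tilt (zeta N) psi (tau N) w.

Let tau1 : \forall N \near \oo, 1 <= tau N.
Proof. by move/cvgryPge : tau_cvg => /(_ 1). Qed.

Let inv_tau : (tau N)^-1 @[N --> \oo] --> (0 : R).
Proof.
by apply/gtr0_cvgV0 => //; move: tau1; apply: filterS => N; exact: lt_le_trans.
Qed.

Let inv_sg : (sg N)^-1 @[N --> \oo] --> (0 : R).
Proof.
have := cvg_comp _ _ inv_tau (@sqrt_continuous R 0) => /=; rewrite sqrtr0 => h.
rewrite [X in _ --> X](_ : 0 = (Num.sqrt v)^-1 * 0); last by rewrite mulr0.
have h2 : (Num.sqrt v)^-1 * Num.sqrt (tau N)^-1 @[N --> \oo] --> (Num.sqrt v)^-1 * 0.
  exact: cvgMl_tmp.
apply: cvg_trans h2; apply: near_eq_cvg; near=> N.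
rewrite /sg sqrtrM ?(ltW v0)// invfM; congr (_ * _).
by rewrite sqrtrV// (le_trans ler01)//; near: N.
Unshelve. all: by end_near. Qed.

Let trig_lim (a b : R) :
  Ex P (fun w => W N w * cos (a * V N w + b)) @[N --> \oo] --> expR (- (a ^+ 2 / 2)) * cos b.
Proof.
pose C1 := 4 * `|a| ^+ 3 * tilt3_bound psi / v.
pose C2 := (a ^+ 2 / 2) ^+ 2 * expR (a ^+ 2 / 2).
have lim0 : C1 / sg N + C2 / tau N @[N --> \oo] --> (0 : R).
  rewrite [X in _ --> X](_ : 0 = C1 * 0 + C2 * 0); last by rewrite !mulr0 addr0.
  by apply: cvgD; apply: cvgMl_tmp.
apply/cvgrPdist_le => e e0; move/cvgrPdist_le : lim0 => /(_ _ e0).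
move: tau1; apply: filterS2 => N t1 h.
have b1 := @tilted_trig_bound _ _ _ P (zeta N) psi (tau N) a b (lexp N) v0 t1.
rewrite sub0r normrN in h.
rewrite distrC; apply: le_trans (le_trans (ler_norm _) h).
apply: le_trans b1; rewrite le_eqVlt; apply/orP; left; apply/eqP.
congr (`|_ - _|); apply: eq_Ex => w; rewrite /W /V; congr (_ * cos (_ + _)).
by rewrite mulrA.
Qed.

(** The weighted weak convergence lemma in dimension one. Tightness is immediate, as the tilted
    second moment of [V N] is exactly 1. *)
Lemma tilted_weak_cvg (f : R -> R) M : continuous f -> (forall y, `|f y| <= M) ->
  Ex P (fun w => W N w * f (V N w)) @[N --> \oo] -->
  Ex (normal_prob 0 1 : probability (measurableTypeR R) R) f.
Proof.
move=> cf fM.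
pose Q : probability (measurableTypeR R) R := normal_prob 0 1.
pose g (y : 'rV[R]_1) := f (y 0 0).
have cg : continuous g.
  by move=> y; apply: continuous_comp; [exact: coord_continuous|exact: cf].
have := @bounded_continuous_cvg R 1 _ _ T (measurableTypeR R) P Q W
  (fun N w => \row_(j < 1) V N w) (fun y => \row_(j < 1) y) 1 _ _ _ _ g M cg (fun y => fM _).
rewrite (_ : (fun N => Ex P (fun w => W N w * f (V N w))) =
  (fun N => Ex P (fun w => W N w * g (\row_(j < 1) V N w)))); last first.
  by apply/funext => N; apply: eq_Ex => w; rewrite /g mxE.
rewrite (_ : Ex Q f = Ex Q (fun y => g (\row_(j < 1) y))); last first.
  by apply: eq_Ex => y; rewrite /g mxE.
apply.
- by move=> N w; exact: tilt_ge0.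
- by move=> j; under eq_fun do rewrite mxE; exact: measurable_id.
- move: tau1; apply: filterS => N t1.
  have t0 : 0 <= tau N by exact: le_trans t1.
  have sg0 : 0 < sg N by rewrite sqrtr_gt0 mulr_gt0// (lt_le_trans ltr01).
  have [levy _] := lexp N.
  split.
  + exact: (tilt_intble (lexp N) t0).
  + exact: (Ex_tilt (lexp N) t0).
  + move=> j; under eq_fun do rewrite mxE; apply: measurable_funM => //.
    by apply: measurable_funB => //; exact: (levy_measurable levy t0).
  move=> j; have [i2 e2] := tilt_variance (lexp N) t0.
  have -> : (fun w => W N w * (\row_(j0 < 1) V N w) 0 j ^+ 2) =
    (fun w => (sg N)^-1 ^+ 2 * (W N w * (zeta N (tau N) w - tau N * m) ^+ 2)).
    by apply/funext => w; rewrite mxE /V exprMn; ring.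
  split; first exact: intbleZ.
  rewrite ExZ// e2 exprVn sqr_sqrtr; last by rewrite mulr_ge0// ltW.
  by rewrite mulrC mulrC [tau N * _]mulrC mulVf// gt_eqF// mulr_gt0// (lt_le_trans ltr01).
- move=> a b.
  have -> : (fun N => Ex P (fun w => W N w * cos (\sum_j a 0 j * (\row_(j0 < 1) V N w) 0 j + b))) =
    (fun N => Ex P (fun w => W N w * cos (a 0 0 * V N w + b))).
    by apply/funext => N; apply: eq_Ex => w; rewrite big_ord1 mxE.
  have -> : Ex Q (fun w => cos (\sum_j a 0 j * (\row_(j0 < 1) w) 0 j + b)) =
     Ex Q (fun y => cos (a 0 0 * y + b)).
    by apply: eq_Ex => w; rewrite big_ord1 mxE.
  by rewrite (Ex_normal_cos (oner_neq0 _)) expr1n mul1r; exact: trig_lim.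
Qed.

(** Continuous, equal to 1 up to [c] and to 0 from [c + del] on: it lies between the indicators of
    the half-lines ending at these two points. *)
Definition ramp (c del y : R) : R := Num.max 0 (Num.min 1 ((c + del - y) / del)).

Let ramp_cont c del : continuous (ramp c del).
Proof.
move=> y; apply: (@continuous_max _ _ (cst 0) (fun y => Num.min 1 ((c + del - y) / del))).
  exact: cst_continuous.
apply: (@continuous_min _ _ (cst 1) (fun y => (c + del - y) / del)); first exact: cst_continuous.
by apply: cvgMr_tmp; apply: cvgB; [exact: cvg_cst|exact: cvg_id].
Qed.

Let ramp_01 c del y : 0 <= ramp c del y <= 1.
Proof. by rewrite /ramp le_max lexx/= ge_max ler01/= ge_min lexx. Qed.

Let ramp_1 c del y : 0 < del -> y <= c -> ramp c del y = 1.
Proof.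
move=> del0 yc; rewrite /ramp min_l; first by rewrite max_r.
by rewrite ler_pdivlMr// mul1r; lra.
Qed.

Let ramp_0 c del y : 0 < del -> c + del <= y -> ramp c del y = 0.
Proof.
move=> del0 yc; rewrite /ramp max_l// ge_min; apply/orP; right.
by rewrite ler_pdivrMr// mul0r subr_le0.
Qed.

Lemma tilted_cdf_cvg :
  Ex P (fun w => W N w * \1_(`]-oo, x N]%classic) (zeta N (tau N) w)) @[N --> \oo] -->
  std_normal_cdf theta.
Proof.
pose Q : probability (measurableTypeR R) R := normal_prob 0 1.
apply/cvgrPdist_le => e e0.
(* The threshold is within [del] of [theta], the ramps reach [2 * del] away from [theta], and weak
   convergence costs one more [del]: [3 * del] in all, below [e]. *)
pose del := e / 4; have del0 : 0 < del by rewrite divr_gt0.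
have rM c y : `|ramp c del y| <= 1 by have /andP[h1 h2] := ramp_01 c del y; rewrite ger0_norm.
have iQ (t : R) : intble Q (\1_(`]-oo, t]%classic)).
  by apply: (@integrable_indic _ (measurableTypeR R)); exact: measurable_itv.
have ir c : intble Q (ramp c del).
  apply: (@intble_bounded _ _ _ _ _ 1) => //.
  exact: continuous_measurable_fun.
have up : Ex Q (ramp (theta + del) del) <= std_normal_cdf theta + 2 * del.
  have /andP[_ h] := @std_normal_cdf_lip R theta (theta + 2 * del) ltac:(lra).
  apply: le_trans (_ : std_normal_cdf (theta + 2 * del) <= _); last by lra.
  rewrite std_normal_cdfE; apply: le_Ex => // y.
  rewrite indicE mem_setE in_itv/=; case: (leP y (theta + 2 * del)) => [_|yt]; first by have /andP[] := ramp_01 (theta + del) del y.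
  by rewrite ramp_0//; lra.
have lo : std_normal_cdf theta - 2 * del <= Ex Q (ramp (theta - 2 * del) del).
  have /andP[_ h] := @std_normal_cdf_lip R (theta - 2 * del) theta ltac:(lra).
  apply: (@le_trans _ _ (std_normal_cdf (theta - 2 * del))); first lra.
  rewrite std_normal_cdfE; apply: le_Ex => // y.
  rewrite indicE mem_setE in_itv/=; case: (leP y (theta - 2 * del)) => [yt|_]; last by have /andP[] := ramp_01 (theta - 2 * del) del y.
  by rewrite ramp_1.
have /cvgrPdist_le/(_ _ del0) hup := tilted_weak_cvg (@ramp_cont (theta + del) del) (rM _).
have /cvgrPdist_le/(_ _ del0) hlo := tilted_weak_cvg (@ramp_cont (theta - 2 * del) del) (rM _).
have /cvgrPdist_le/(_ _ del0) hx := x_cvg.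
near=> N.
have t1 : 1 <= tau N by near: N.
have t0 : 0 <= tau N by exact: le_trans t1.
have sg0 : 0 < sg N by rewrite sqrtr_gt0 mulr_gt0// (lt_le_trans ltr01).
have [levy _] := lexp N.
have iW : intble P (W N) by exact: (tilt_intble (lexp N) t0).
have mz : measurable_fun setT (zeta N (tau N)) by exact: (levy_measurable levy t0).
have mV : measurable_fun setT (V N) by apply: measurable_funM => //; exact: measurable_funB.
have iB (f : T -> R) : measurable_fun setT f -> (forall w, 0 <= f w <= 1) -> intble P (fun w => W N w * f w).
  move=> mf f01; apply: (intble_dom _ _ iW).
    by apply: measurable_funM => //; exact: (intble_meas iW).
  move=> w; have /andP[f0 f1] := f01 w.
  by rewrite ger0_norm ?mulr_ge0 ?tilt_ge0// ler_piMr// tilt_ge0.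
have i1 : intble P (fun w => W N w * \1_(`]-oo, x N]%classic) (zeta N (tau N) w)).
  apply: iB; last by move=> w; rewrite indicE; case: (_ \in _); rewrite ?lexx ?ler01.
  apply: (measurableT_comp _ mz); exact: measurable_indic.
have i2 c : intble P (fun w => W N w * ramp c del (V N w)).
  apply: iB => [|w]; last exact: ramp_01.
  have mr : measurable_fun setT (ramp c del) by exact: continuous_measurable_fun.
  exact: (measurableT_comp mr mV).
have hx' : `|theta - (x N - tau N * m) / sg N| <= del by near: N.
have Vle w : (zeta N (tau N) w <= x N) = (V N w <= (x N - tau N * m) / sg N).
  by rewrite /V ler_pM2r ?invr_gt0// lerD2r.
move: hx'; rewrite ler_norml => /andP[hx1 hx2].
have U : Ex P (fun w => W N w * \1_(`]-oo, x N]%classic) (zeta N (tau N) w)) <=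
    Ex P (fun w => W N w * ramp (theta + del) del (V N w)).
  apply: le_Ex => // w; apply: ler_wpM2l; first exact: tilt_ge0.
  rewrite indicE mem_setE in_itv/= Vle; case: (leP (V N w) ((x N - tau N * m) / sg N)) => [h|_]; last by have /andP[] := ramp_01 (theta + del) del (V N w).
  by rewrite ramp_1//; lra.
have Lo : Ex P (fun w => W N w * ramp (theta - 2 * del) del (V N w)) <=
    Ex P (fun w => W N w * \1_(`]-oo, x N]%classic) (zeta N (tau N) w)).
  apply: le_Ex => // w; apply: ler_wpM2l; first exact: tilt_ge0.
  rewrite indicE mem_setE in_itv/= Vle; case: (leP (V N w) ((x N - tau N * m) / sg N)) => [h|h]; first by have /andP[] := ramp_01 (theta - 2 * del) del (V N w).
  by rewrite ramp_0//; lra.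
have Hu : `|Ex Q (ramp (theta + del) del) - Ex P (fun w => W N w * ramp (theta + del) del (V N w))| <= del by near: N.
have Hl : `|Ex Q (ramp (theta - 2 * del) del) - Ex P (fun w => W N w * ramp (theta - 2 * del) del (V N w))| <= del by near: N.
move: Hu Hl; rewrite !ler_norml => /andP[u1 u2] /andP[l1 l2].
have e4 : e = 4 * del by rewrite /del; field.
by rewrite e4; apply/andP; split; lra.
Unshelve. all: by end_near. Qed.

End TiltedCdf.

(** * Truncated moments of one summand *)

Section Pointwise.
Context {R : realType}.
Implicit Types (x y : R).

Lemma sum_sqr_le k (z : 'I_k -> R) :
  (\sum_j z j) ^+ 2 <= 2 ^+ k * \sum_j (z j) ^+ 2.
Proof.
elim: k z => [|k ih] z; first by rewrite !big_ord0 expr0n mulr0.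
rewrite !big_ord_recl; set s := \sum_(i < k) z _; set q := \sum_(i < k) z _ ^+ 2.
have h : s ^+ 2 <= 2 ^+ k * q := ih _.
have q0 : 0 <= q by rewrite sumr_ge0// => i _; exact: sqr_ge0.
have : (z ord0 + s) ^+ 2 <= 2 * (z ord0 ^+ 2 + s ^+ 2).
  by rewrite -subr_ge0 (_ : _ - _ = (z ord0 - s) ^+ 2) ?sqr_ge0//; ring.
move=> h2; apply: le_trans h2 _; rewrite (exprS (2:R) k) -mulrA ler_wpM2l// mulrDr.
apply: lerD => //; by rewrite ler_peMl ?sqr_ge0// exprn_ege1// ler1n.
Qed.

Lemma cube_add_le x y : 0 <= x -> 0 <= y -> (x + y) ^+ 3 <= 4 * (x ^+ 3 + y ^+ 3).
Proof.
move=> x0 y0; rewrite -subr_ge0 (_ : _ - _ = 3 * (x + y) * (x - y) ^+ 2); last by ring.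
by rewrite mulr_ge0 ?sqr_ge0// mulr_ge0 ?addr_ge0.
Qed.

Lemma sum_cube_le k (z : 'I_k -> R) : (forall j, 0 <= z j) ->
  (\sum_j z j) ^+ 3 <= 4 ^+ k * \sum_j (z j) ^+ 3.
Proof.
elim: k z => [|k ih] z z0; first by rewrite !big_ord0 expr0n mulr0.
rewrite !big_ord_recl; set s := \sum_(i < k) z _; set q := \sum_(i < k) z _ ^+ 3.
have h : s ^+ 3 <= 4 ^+ k * q by apply: ih => j; exact: z0.
have q0 : 0 <= q by rewrite sumr_ge0// => i _; rewrite exprn_ge0.
have s0 : 0 <= s by rewrite sumr_ge0.
apply: le_trans (cube_add_le (z0 _) s0) _; rewrite (exprS (4:R) k) -mulrA ler_wpM2l// mulrDr.
apply: lerD => //; by rewrite ler_peMl ?exprn_ge0// exprn_ege1// ler1n.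
Qed.

Variables (Yp mu U mb hi mid low : R).
Hypothesis YU : `|Yp| <= U.
Hypothesis mumb : `|mu| <= mb.
(* The three indicators of the partition into large, intermediate and small values. *)
Hypothesis cases : [\/ [/\ hi = 1, mid = 0 & low = 0],
  [/\ hi = 0, mid = 1 & low = 0] | [/\ hi = 0, mid = 0 & low = 1]].

Let U0 : 0 <= U. Proof. exact: le_trans (normr_ge0 _) YU. Qed.
Let mb0 : 0 <= mb. Proof. exact: le_trans (normr_ge0 _) mumb. Qed.

Let YB : `|Yp - mu| <= U + mb.
Proof. by apply: le_trans (ler_normB _ _) _; exact: lerD. Qed.

Let Y2 : (Yp - mu) ^+ 2 <= 2 * U ^+ 2 + 2 * mb ^+ 2.
Proof.
rewrite -real_normK ?num_real//; apply: (@le_trans _ _ ((U + mb) ^+ 2)).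
  by rewrite lerXn2r ?nnegrE ?addr_ge0.
rewrite -subr_ge0 (_ : _ - _ = (U - mb) ^+ 2) ?sqr_ge0//; ring.
Qed.

Let Y3 : `|Yp - mu| ^+ 3 <= 4 * U ^+ 3 + 4 * mb ^+ 3.
Proof.
apply: (@le_trans _ _ ((U + mb) ^+ 3)).
  by rewrite lerXn2r ?nnegrE ?addr_ge0.
by rewrite -mulrDr; exact: cube_add_le.
Qed.

Let dY2 : `|(Yp - mu) ^+ 2 / 2 - Yp ^+ 2 / 2| <= mb * U + mb ^+ 2 / 2.
Proof.
rewrite (_ : _ - _ = mu ^+ 2 / 2 - mu * Yp); last by field.
apply: le_trans (ler_normB _ _) _; rewrite addrC; apply: lerD.
  by rewrite normrM; apply: ler_pM.
rewrite normrM normrX [X in _ * X]ger0_norm ?invr_ge0// ler_wpM2r ?invr_ge0//.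
by rewrite lerXn2r ?nnegrE.
Qed.

(** On large values only boundedness of the cosine is used, and the quadratic term is switched off
    there; intermediate values use the quadratic remainder, small ones the cubic. The terms with
    [mb] are the price of centring. *)
Lemma cos_truncated_taylor :
  `|cos (Yp - mu) - 1 + Yp ^+ 2 / 2 * (1 - hi)| <=
  2 * hi + 2 * U ^+ 2 * mid + 4 * U ^+ 3 * low + mb * U + (3 * mb ^+ 2 + 4 * mb ^+ 3).
Proof.
have mU : 0 <= mb * U by rewrite mulr_ge0.
have m2 : 0 <= mb ^+ 2 := sqr_ge0 _.
have m3 : 0 <= mb ^+ 3 by rewrite exprn_ge0.
have split2 : cos (Yp - mu) - 1 + Yp ^+ 2 / 2 =
   (cos (Yp - mu) - 1 + (Yp - mu) ^+ 2 / 2) - ((Yp - mu) ^+ 2 / 2 - Yp ^+ 2 / 2) by ring.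
case: cases => -[-> -> ->].
- rewrite subrr !mulr0 !addr0 mulr1.
  apply: (@le_trans _ _ 2); last by lra.
  apply: le_trans (ler_normB _ _) _; rewrite normr1 (_ : 2 = 1 + 1)// lerD2r.
  exact: cos_max.
- rewrite subr0 !mulr0 !mulr1 add0r addr0 split2.
  apply: le_trans (ler_normB _ _) _.
  have := cos_taylor2 (Yp - mu); have := dY2; have := Y2.
  lra.
rewrite subr0 !mulr0 !mulr1 !add0r split2.
apply: le_trans (ler_normB _ _) _.
have := cos_taylor3 (Yp - mu); have := dY2; have := Y3.
lra.
Qed.

(** Here the linear term stays on large values too, because it has mean zero only without
    truncation; this is why [U * hi] enters. *)
Lemma sin_truncated_taylor :
  `|sin (Yp - mu) - (Yp - mu)| <=
  (1 + mb) * hi + U * hi + 2 * U ^+ 2 * mid + 4 * U ^+ 3 * low + (3 * mb ^+ 2 + 4 * mb ^+ 3).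
Proof.
have m2 : 0 <= mb ^+ 2 := sqr_ge0 _.
have m3 : 0 <= mb ^+ 3 by rewrite exprn_ge0.
case: cases => -[-> -> ->].
- rewrite !mulr0 !addr0 !mulr1.
  apply: le_trans (ler_normB _ _) _.
  have := sin_max (Yp - mu); have := YB; lra.
- rewrite !mulr0 !mulr1 !add0r addr0.
  apply: le_trans (sin_taylor2 _) _; have := Y2; lra.
rewrite !mulr0 !mulr1 !add0r.
apply: le_trans (sin_taylor3 _) _; have := Y3; lra.
Qed.

End Pointwise.

(** * Moments truncated at an earlier time *)

Section ThreeIncrements.
Context {d : measure_display} {T : measurableType d} {R : realType}.
Variables (P : probability T R) (xi : R -> T -> R) (psi : R -> R).
Hypothesis lexp : levy_exponent P xi psi.

Let levy : levy_process P xi. Proof. by case: lexp. Qed.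

Lemma levy_three_increments (u0 u1 u2 p q : R) (phi : R -> R) :
  0 <= u0 -> u0 <= u1 -> u1 <= u2 -> measurable_fun setT phi ->
  intble P (fun w => phi (xi u0 w)) ->
  intble P (fun w => phi (xi u0 w) * (expR (p * (xi u1 w - xi u0 w)) * expR (q * (xi u2 w - xi u1 w)))) /\
  Ex P (fun w => phi (xi u0 w) * (expR (p * (xi u1 w - xi u0 w)) * expR (q * (xi u2 w - xi u1 w)))) =
  Ex P (fun w => phi (xi u0 w)) * (expR ((u1 - u0) * psi p) * expR ((u2 - u1) * psi q)).
Proof.
move=> u00 u01 u12 mphi iphi.
(* The value at [u0] is treated as the increment from 0, so there are three increments; the defaults
   of [nth] only make [u] and [f] total. *)
pose u (j : nat) := nth u2 [:: 0; u0; u1; u2] j.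
pose f (j : nat) := nth phi [:: phi; (fun y => expR (p * y)); (fun y => expR (q * y))] j.
have mf j : measurable_fun setT (f j).
  by rewrite /f; case: j => [|[|[|[|j]]]]//=; exact: measurable_expM.
have [||||i E] := @levy_incr_Ex_prod _ T R P xi levy 3 u f.
- exact: lexx.
- by case=> [|[|[|]]].
- exact: mf.
- case=> [|[|[|]]]//= _; rewrite /f/= ?subr0//.
  + by apply: (levy_exp_intble lexp); rewrite subr_ge0.
  + by apply: (levy_exp_intble lexp); rewrite subr_ge0.
move: i E; rewrite /f /u.
under eq_fun do rewrite big_mkord !big_ord_recl big_ord0 mulr1/=.
rewrite big_mkord !big_ord_recl big_ord0 mulr1/= subr0.
rewrite (levy_exp_Ex lexp p) ?subr_ge0// (levy_exp_Ex lexp q) ?subr_ge0// => i E.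
have ae : {ae P, forall w, phi (xi u0 w - xi 0 w) * (expR (p * (xi u1 w - xi u0 w)) * expR (q * (xi u2 w - xi u1 w))) =
  phi (xi u0 w) * (expR (p * (xi u1 w - xi u0 w)) * expR (q * (xi u2 w - xi u1 w)))}.
  by apply: filterS (levy0_ae levy) => w ->; rewrite subr0.
have m0 := levy_measurable levy u00.
have mg : measurable_fun setT (fun w => phi (xi u0 w) * (expR (p * (xi u1 w - xi u0 w)) * expR (q * (xi u2 w - xi u1 w)))).
  apply: measurable_funM; first exact: (measurableT_comp mphi m0).
  apply: measurable_funM.
    apply: (measurableT_comp (measurable_expM p)).
    exact: (levy_incr_measurable levy).
  apply: (measurableT_comp (measurable_expM q)).
  by apply: (levy_incr_measurable levy) => //; exact: le_trans u01.
split; first exact: intble_ae mg ae i.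
by rewrite -E; apply/esym; apply: (Ex_ae (intble_meas i) mg ae).
Qed.

Variables (tau u1 u2 : R) (J : R -> R).
Hypothesis tau0 : 0 <= tau.
Hypothesis mJ : measurable_fun setT J.
Hypothesis J01 : forall y, 0 <= J y <= 1.
Hypothesis tu1 : tau <= u1.
Hypothesis u12 : u1 <= u2.

Lemma intble_J_exp r : intble P (fun w => J (xi tau w) * expR (r * xi tau w)).
Proof.
have mx := levy_measurable levy tau0.
apply: (intble_dom _ _ (levy_exp_intble lexp r tau0)).
  apply: measurable_funM; first exact: (measurableT_comp mJ mx).
  exact: (measurableT_comp (measurable_expM r) mx).
move=> w; have /andP[j0 j1] := J01 (xi tau w).
by rewrite ger0_norm ?mulr_ge0 ?expR_ge0// ler_piMl ?expR_ge0.
Qed.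

Let mphi r : measurable_fun setT (fun y => J y * expR (r * y)).
Proof. by apply: measurable_funM => //; exact: measurable_expM. Qed.

Lemma Ex_J_exp_pow r :
  intble P (fun w => J (xi tau w) * expR (r * xi u1 w)) /\
  Ex P (fun w => J (xi tau w) * expR (r * xi u1 w)) =
  Ex P (fun w => J (xi tau w) * expR (r * xi tau w)) * expR ((u1 - tau) * psi r).
Proof.
have := @levy_three_increments tau u1 u1 r 0 _ tau0 tu1 (lexx _) (mphi r) (intble_J_exp r).
rewrite subrr mul0r expR0 mulr1.
rewrite (_ : (fun w => _ * (_ * _)) = fun w => J (xi tau w) * expR (r * xi u1 w))//.
apply/funext => w; rewrite mul0r expR0 mulr1 -mulrA -expRD; congr (_ * expR _); ring.
Qed.

(** Up to [u1] both exponentials grow together, hence the parameter 2; after [u1] only one moves,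
    hence the parameter 1. This is the origin of the limiting covariance. *)
Lemma Ex_J_exp_cross :
  intble P (fun w => J (xi tau w) * (expR (xi u1 w) * expR (xi u2 w))) /\
  Ex P (fun w => J (xi tau w) * (expR (xi u1 w) * expR (xi u2 w))) =
  Ex P (fun w => J (xi tau w) * expR (2 * xi tau w)) *
  (expR ((u1 - tau) * psi 2) * expR ((u2 - u1) * psi 1)).
Proof.
have := @levy_three_increments tau u1 u2 2 1 _ tau0 tu1 u12 (mphi 2) (intble_J_exp 2).
rewrite (_ : (fun w => _ * (_ * expR (1 * _))) = fun w => J (xi tau w) * (expR (xi u1 w) * expR (xi u2 w)))//.
apply/funext => w; rewrite -mulrA -!expRD; congr (_ * expR _); ring.
Qed.

End ThreeIncrements.

Section TruncatedMoments.
Context {d : measure_display} {T : measurableType d} {R : realType}.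
Variables (P : probability T R) (xi : R -> T -> R) (psi : R -> R).
Hypothesis lexp : levy_exponent P xi psi.

Let levy : levy_process P xi. Proof. by case: lexp. Qed.

Variables (k : nat) (a t q : 'I_k -> R) (s t0 x0 y n : R).
Hypothesis q0 : forall j, 0 < q j.
Hypothesis n0 : 0 < n.
Hypothesis y0 : 0 <= y.
Hypothesis tau0 : 0 <= s + t0.
Hypothesis tt0 : forall j, t0 <= t j.
Hypothesis x0E : expR x0 ^+ 2 = n * expR (psi 2 * s).

Let tau := s + t0.
Let S := expR x0.
Let S0 : 0 < S. Proof. exact: expR_gt0. Qed.
Let A j w := expR (xi (s + t j) w) / (S * q j).
Let I (x g : R) : R := \1_(`]-oo, x]%classic) g.
Let xp := x0 + y.
Let xm := x0 - y.
Let al j := `|a j|.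

Definition trunc_prob (x : R) : R := Ex P (fun w => tilt xi psi tau w * I x (xi tau w)).
(** The value of [n * Ex P] of [A j * A l] without truncation; by [cross_moment], truncating at [x]
    merely multiplies it by [trunc_prob x]. *)
Definition cov_coef j l : R :=
  expR (Num.min (t j) (t l) * psi 2 + `|t l - t j| * psi 1) / (q j * q l).
Definition mean_coef j : R := expR ((s + t j) * psi 1) / (S * q j).

Let tauj j : tau <= s + t j. Proof. by rewrite lerD2l. Qed.
Let mI x : measurable_fun setT (I x).
Proof. by apply: measurable_indic; exact: measurable_itv. Qed.

Let IE x g : I x g = (g <= x)%R%:R.
Proof. by rewrite /I indicE mem_setE in_itv. Qed.

Let I01 x g : 0 <= I x g <= 1.
Proof. by rewrite IE; case: (g <= x); rewrite ?lexx ?ler01. Qed.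

Let Jc01 x g : 0 <= 1 - I x g <= 1.
Proof. by rewrite IE; case: (g <= x); rewrite ?subrr ?subr0 ?lexx ?ler01. Qed.

Let mJc x : measurable_fun setT (fun g => 1 - I x g).
Proof. exact: measurable_funB. Qed.

Let G := xi tau.
Let mG : measurable_fun setT G. Proof. exact: (levy_measurable levy tau0). Qed.

Let i2 : intble P (fun w => expR (2 * G w)). Proof. exact: (levy_exp_intble lexp). Qed.
Let E2 : Ex P (fun w => expR (2 * G w)) = expR (tau * psi 2).
Proof. exact: (levy_exp_Ex lexp). Qed.

(** Explains the choice of [x0]: after multiplication by [n], second exponential moments at time
    [tau] are of the order [S^2]. Every bound below is brought to the exponent 2 in order to use
    this identity. *)
Let n_tilt : n * expR (tau * psi 2) = S ^+ 2 * expR (t0 * psi 2).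
Proof. by rewrite x0E -mulrA -expRD /tau; congr (_ * expR _); ring. Qed.

Lemma mean_coefE j : intble P (A j) /\ Ex P (A j) = mean_coef j.
Proof.
have u0 : 0 <= s + t j by exact: le_trans (tauj j).
have i := levy_exp_intble lexp 1 u0; have e := levy_exp_Ex lexp 1 u0.
have -> : A j = fun w => (S * q j)^-1 * expR (1 * xi (s + t j) w).
  by apply/funext => w; rewrite /A mul1r mulrC.
by split; [exact: intbleZ|rewrite ExZ// e mulrC].
Qed.

Let A0 j w : 0 <= A j w.
Proof. by rewrite divr_ge0 ?expR_ge0// mulr_ge0// ltW. Qed.

Let mean_ge0 j : 0 <= mean_coef j.
Proof. by rewrite divr_ge0 ?expR_ge0// mulr_ge0// ltW. Qed.

Let I2 x : Ex P (fun w => I x (G w) * expR (2 * G w)) = expR (tau * psi 2) * trunc_prob x.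
Proof.
rewrite /trunc_prob -ExZ; last first.
  apply: (intble_dom _ _ (tilt_intble lexp tau0)).
    by apply: measurable_funM; [exact: (intble_meas (tilt_intble lexp tau0))|exact: (measurableT_comp (mI x) mG)].
  move=> w; have /andP[j0 j1] := I01 x (xi tau w).
  by rewrite ger0_norm ?mulr_ge0 ?tilt_ge0// ler_piMr ?tilt_ge0.
apply: eq_Ex => w; rewrite /tilt -/G mulrA -expRD mulrC; congr (expR _ * _); ring.
Qed.

Let cross_le x j l : t j <= t l -> intble P (fun w => I x (G w) * (A j w * A l w)) /\
  n * Ex P (fun w => I x (G w) * (A j w * A l w)) =
  trunc_prob x * (expR (t j * psi 2 + (t l - t j) * psi 1) / (q j * q l)).
Proof.
move=> jl; have jl' : s + t j <= s + t l by rewrite lerD2l.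
have [i e] := Ex_J_exp_cross lexp tau0 (mI x) (I01 x) (tauj j) jl'.
have -> : (fun w => I x (G w) * (A j w * A l w)) =
  fun w => (S * q j * (S * q l))^-1 * (I x (G w) * (expR (xi (s + t j) w) * expR (xi (s + t l) w))).
  by apply/funext => w; rewrite /A !invfM; ring.
split; first exact: intbleZ.
rewrite ExZ// e I2.
have -> : s + t l - (s + t j) = t l - t j by ring.
have -> : s + t j - tau = t j - t0 by rewrite /tau; ring.
have -> : n * ((S * q j * (S * q l))^-1 * (expR (tau * psi 2) * trunc_prob x * (expR ((t j - t0) * psi 2) * expR ((t l - t j) * psi 1)))) =
  (n * expR (tau * psi 2)) * ((S * q j * (S * q l))^-1 * (trunc_prob x * (expR ((t j - t0) * psi 2) * expR ((t l - t j) * psi 1)))) by ring.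
rewrite n_tilt.
have -> : expR (t j * psi 2 + (t l - t j) * psi 1) = expR (t0 * psi 2) * expR ((t j - t0) * psi 2) * expR ((t l - t j) * psi 1).
  by rewrite -!expRD; congr expR; ring.
by field; rewrite !gt_eqF.
Qed.

Lemma cross_moment x j l : intble P (fun w => I x (G w) * (A j w * A l w)) /\
  n * Ex P (fun w => I x (G w) * (A j w * A l w)) = trunc_prob x * cov_coef j l.
Proof.
have [jl|/ltW lj] := leP (t j) (t l).
  by rewrite /cov_coef min_l// ger0_norm ?subr_ge0//; exact: cross_le.
rewrite /cov_coef min_r// distrC ger0_norm ?subr_ge0// [q j * _]mulrC.
have -> : (fun w => I x (G w) * (A j w * A l w)) = (fun w => I x (G w) * (A l w * A j w)).
  by apply/funext => w; rewrite [A j w * _]mulrC.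
exact: cross_le.
Qed.

(** Above [xp] one has [1 <= e^{2 (G - xp)}], which gains [e^{-2 y}] after [n_tilt]. Likewise
    [tail_mean] replaces [e^G] by [e^{2 G - xp}] and gains [e^{-y}]. *)
Lemma tail_prob : intble P (fun w => 1 - I xp (G w)) /\
  n * Ex P (fun w => 1 - I xp (G w)) <= expR (t0 * psi 2 - 2 * y).
Proof.
have i : intble P (fun w => 1 - I xp (G w)).
  apply: (@intble_bounded _ _ _ _ _ 1); first exact: (measurableT_comp (mJc xp) mG).
  by move=> w; have /andP[j0 j1] := Jc01 xp (G w); rewrite ger0_norm.
split => //.
have le : Ex P (fun w => 1 - I xp (G w)) <= Ex P (fun w => expR (- 2 * xp) * expR (2 * G w)).
  apply: le_Ex => //; first exact: intbleZ.
  move=> w; rewrite IE; case: (leP (G w) xp) => h; first by rewrite subrr mulr_ge0 ?expR_ge0.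
  by rewrite subr0 -expRD -[leLHS]expR0 ler_expR; lra.
apply: le_trans (ler_wpM2l (ltW n0) le) _; rewrite ExZ// E2 mulrCA n_tilt.
rewrite /S -expRM_natl -!expRD ler_expR le_eqVlt; apply/orP; left; apply/eqP.
by rewrite /xp; ring.
Qed.

Lemma tail_mean j : intble P (fun w => (1 - I xp (G w)) * A j w) /\
  n * Ex P (fun w => (1 - I xp (G w)) * A j w) <=
  expR (t0 * psi 2 - y + (t j - t0) * psi 1) / q j.
Proof.
have [i e] := Ex_J_exp_pow lexp tau0 (mJc xp) (Jc01 xp) (tauj j) 1.
have -> : (fun w => (1 - I xp (G w)) * A j w) =
  fun w => (S * q j)^-1 * ((1 - I xp (G w)) * expR (1 * xi (s + t j) w)).
  by apply/funext => w; rewrite /A mul1r; ring.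
split; first exact: intbleZ.
rewrite ExZ// e.
have -> : s + t j - tau = t j - t0 by rewrite /tau; ring.
have le : Ex P (fun w => (1 - I xp (G w)) * expR (1 * G w)) <= expR (- xp) * expR (tau * psi 2).
  rewrite -E2 -ExZ//; apply: le_Ex; [|exact: intbleZ|].
    exact: (intble_J_exp lexp tau0 (mJc xp) (Jc01 xp) 1).
  move=> w; rewrite IE; case: (leP (G w) xp) => h; first by rewrite subrr mul0r mulr_ge0 ?expR_ge0.
  by rewrite subr0 mul1r -expRD ler_expR; lra.
have c0 : 0 <= n * (S * q j)^-1 * expR ((t j - t0) * psi 1).
  by rewrite mulr_ge0 ?expR_ge0// divr_ge0 ?mulr_ge0// ltW.
have := ler_wpM2r c0 le.
rewrite [X in X <= _](_ : _ = n * ((S * q j)^-1 * (Ex P (fun w => (1 - I xp (G w)) * expR (1 * G w)) * expR ((t j - t0) * psi 1)))); last by ring.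
move=> h; apply: le_trans h _.
have -> : expR (- xp) * expR (tau * psi 2) * (n / (S * q j) * expR ((t j - t0) * psi 1)) =
  expR (- xp) * (n * expR (tau * psi 2)) * ((S * q j)^-1 * expR ((t j - t0) * psi 1)) by ring.
rewrite n_tilt.
have -> : expR (- xp) = expR (- y) * S^-1 by rewrite /S -expRN -expRD /xp; congr expR; ring.
have -> : expR (t0 * psi 2 - y + (t j - t0) * psi 1) = expR (t0 * psi 2) * expR (- y) * expR ((t j - t0) * psi 1).
  by rewrite -!expRD.
by rewrite le_eqVlt; apply/orP; left; apply/eqP; field; rewrite !gt_eqF.
Qed.

(** The mirror image below the threshold: for [G <= xm], [e^{3 G} <= e^{2 G + xm}], and
    [xm = x0 - y] supplies the gain [e^{-y}]. *)
Lemma low_cube j : intble P (fun w => I xm (G w) * A j w ^+ 3) /\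
  n * Ex P (fun w => I xm (G w) * A j w ^+ 3) <=
  expR (t0 * psi 2 - y + (t j - t0) * psi 3) / q j ^+ 3.
Proof.
have [i e] := Ex_J_exp_pow lexp tau0 (mI xm) (I01 xm) (tauj j) 3.
have -> : (fun w => I xm (G w) * A j w ^+ 3) =
  fun w => (S * q j) ^- 3 * (I xm (G w) * expR (3 * xi (s + t j) w)).
  apply/funext => w; rewrite /A expr_div_n -expRM_natl.
  by rewrite mulrA mulrC.
split; first exact: intbleZ.
rewrite ExZ// e.
have -> : s + t j - tau = t j - t0 by rewrite /tau; ring.
have le : Ex P (fun w => I xm (G w) * expR (3 * G w)) <= expR xm * expR (tau * psi 2).
  rewrite -E2 -ExZ//; apply: le_Ex; [|exact: intbleZ|].
    exact: (intble_J_exp lexp tau0 (mI xm) (I01 xm) 3).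
  move=> w; rewrite IE; case: (leP (G w) xm) => h; last by rewrite mul0r mulr_ge0 ?expR_ge0.
  by rewrite mul1r -expRD ler_expR; lra.
have c0 : 0 <= n * (S * q j) ^- 3 * expR ((t j - t0) * psi 3).
  by rewrite mulr_ge0 ?expR_ge0// divr_ge0 ?exprn_ge0 ?mulr_ge0// ltW.
have := ler_wpM2r c0 le.
rewrite [X in X <= _](_ : _ = n * ((S * q j) ^- 3 * (Ex P (fun w => I xm (G w) * expR (3 * G w)) * expR ((t j - t0) * psi 3)))); last by ring.
move=> h; apply: le_trans h _.
have -> : expR xm * expR (tau * psi 2) * (n / (S * q j) ^+ 3 * expR ((t j - t0) * psi 3)) =
  expR xm * (n * expR (tau * psi 2)) * ((S * q j) ^- 3 * expR ((t j - t0) * psi 3)) by ring.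
rewrite n_tilt.
have -> : expR xm = S * expR (- y) by rewrite /S -expRD.
have -> : expR (t0 * psi 2 - y + (t j - t0) * psi 3) = expR (t0 * psi 2) * expR (- y) * expR ((t j - t0) * psi 3).
  by rewrite -!expRD.
by rewrite le_eqVlt; apply/orP; left; apply/eqP; field; rewrite !gt_eqF.
Qed.

Definition mean_abs : R := \sum_j al j * mean_coef j.

(** One error for both cosine and sine. In order: probability of large values, with [2 + mean_abs]
    dominating the coefficients of both cases; mean carried by large values; second moment between
    the two thresholds; third moment of small values; effect of centring. *)
Definition trunc_error : R :=
  (2 + mean_abs) * expR (t0 * psi 2 - 2 * y) +
  \sum_j al j * (expR (t0 * psi 2 - y + (t j - t0) * psi 1) / q j) +
  2 * (2 ^+ k * \sum_j al j ^+ 2 * ((trunc_prob xp - trunc_prob xm) * cov_coef j j)) +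
  4 * (4 ^+ k * \sum_j al j ^+ 3 * (expR (t0 * psi 2 - y + (t j - t0) * psi 3) / q j ^+ 3)) +
  4 * (1 + mean_abs) * (n * mean_abs ^+ 2).

Let U w := \sum_j al j * A j w.
Let Yp w := \sum_j a j * A j w.
Let mu := \sum_j a j * mean_coef j.
Let hi w := 1 - I xp (G w).
Let mid w := I xp (G w) - I xm (G w).
Let low w := I xm (G w).

Let al0 j : 0 <= al j. Proof. exact: normr_ge0. Qed.

Let U0 w : 0 <= U w. Proof. by rewrite sumr_ge0// => j _; rewrite mulr_ge0. Qed.

Let YU w : `|Yp w| <= U w.
Proof.
apply: le_trans (ler_norm_sum _ _ _) _; apply: ler_sum => j _.
by rewrite normrM [X in _ * X]ger0_norm.
Qed.

Let mb0 : 0 <= mean_abs. Proof. by rewrite sumr_ge0// => j _; rewrite mulr_ge0. Qed.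

Let mumb : `|mu| <= mean_abs.
Proof.
apply: le_trans (ler_norm_sum _ _ _) _; apply: ler_sum => j _.
by rewrite normrM [X in _ * X]ger0_norm.
Qed.

Let cases w : [\/ [/\ hi w = 1, mid w = 0 & low w = 0],
  [/\ hi w = 0, mid w = 1 & low w = 0] | [/\ hi w = 0, mid w = 0 & low w = 1]].
Proof.
rewrite /hi /mid /low !IE; case: (leP (G w) xp) => hp.
  case: (leP (G w) xm) => hm; first by apply: Or33; rewrite !subrr.
  by apply: Or32; rewrite subrr subr0.
case: (leP (G w) xm) => hm; last by apply: Or31; rewrite subrr subr0.
by exfalso; move: hp hm; rewrite /xp /xm; have := y0; lra.
Qed.

Let hi0 w : 0 <= hi w. Proof. by have /andP[] := Jc01 xp (G w). Qed.
Let low0 w : 0 <= low w. Proof. by have /andP[] := I01 xm (G w). Qed.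
Let mid0 w : 0 <= mid w. Proof. by case: (cases w) => -[_ -> _]; rewrite ?ler01. Qed.

Let mA j : measurable_fun setT (A j). Proof. by have [/intble_meas] := mean_coefE j. Qed.

Let iU : intble P U /\ Ex P U = mean_abs.
Proof.
split; first by apply: intble_sum => j _; apply: intbleZ; have [] := mean_coefE j.
rewrite Ex_sum; last by move=> j _; apply: intbleZ; have [] := mean_coefE j.
by apply: eq_bigr => j _; have [i e] := mean_coefE j; rewrite ExZ// e.
Qed.

Let mU : measurable_fun setT U. Proof. by have [/intble_meas] := iU. Qed.
Let mlow : measurable_fun setT low. Proof. exact: (measurableT_comp (mI xm) mG). Qed.
Let mIp : measurable_fun setT (fun w => I xp (G w)). Proof. exact: (measurableT_comp (mI xp) mG). Qed.

Let iUhi : intble P (fun w => U w * hi w) /\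
  n * Ex P (fun w => U w * hi w) <= \sum_j al j * (expR (t0 * psi 2 - y + (t j - t0) * psi 1) / q j).
Proof.
have -> : (fun w => U w * hi w) = fun w => \sum_j al j * ((1 - I xp (G w)) * A j w).
  by apply/funext => w; rewrite /U mulr_suml; apply: eq_bigr => j _; rewrite -mulrA [A j w * _]mulrC.
have ii j : intble P (fun w => al j * ((1 - I xp (G w)) * A j w)).
  by apply: intbleZ; have [] := tail_mean j.
split; first exact: intble_sum.
rewrite Ex_sum// mulr_sumr; apply: ler_sum => j _; have [i e] := tail_mean j.
by rewrite ExZ// mulrCA ler_wpM2l.
Qed.

Let iUmid : intble P (fun w => U w ^+ 2 * mid w) /\
  n * Ex P (fun w => U w ^+ 2 * mid w) <=
  2 ^+ k * \sum_j al j ^+ 2 * ((trunc_prob xp - trunc_prob xm) * cov_coef j j).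
Proof.
pose b w := 2 ^+ k * \sum_j al j ^+ 2 * (I xp (G w) * (A j w * A j w) - I xm (G w) * (A j w * A j w)).
have ij j : intble P (fun w => al j ^+ 2 * (I xp (G w) * (A j w * A j w) - I xm (G w) * (A j w * A j w))).
  by apply: intbleZ; apply: intbleB; [have [] := cross_moment xp j j|have [] := cross_moment xm j j].
have ib : intble P b by apply: intbleZ; exact: intble_sum.
have le w : U w ^+ 2 * mid w <= b w.
  apply: le_trans (ler_wpM2r (mid0 w) (sum_sqr_le (fun j => al j * A j w))) _.
  rewrite /b -mulrA; apply: ler_wpM2l; first by rewrite exprn_ge0.
  rewrite mulr_suml le_eqVlt; apply/orP; left; apply/eqP; apply: eq_bigr => j _.
  by rewrite /mid; ring.
have ii : intble P (fun w => U w ^+ 2 * mid w).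
  apply: (intble_dom _ _ ib).
    by apply: measurable_funM; [exact: measurable_funX|exact: measurable_funB].
  by move=> w; rewrite ger0_norm// mulr_ge0 ?sqr_ge0.
split => //; apply: le_trans (ler_wpM2l (ltW n0) (le_Ex ii ib le)) _.
rewrite /b ExZ; last exact: intble_sum.
rewrite Ex_sum// mulrCA ler_wpM2l ?exprn_ge0// mulr_sumr; apply: ler_sum => j _.
have [ip ep] := cross_moment xp j j; have [im em] := cross_moment xm j j.
rewrite ExZ; last exact: intbleB.
by rewrite ExB// mulrCA mulrBr ep em mulrBl.
Qed.

Let iUlow : intble P (fun w => U w ^+ 3 * low w) /\
  n * Ex P (fun w => U w ^+ 3 * low w) <=
  4 ^+ k * \sum_j al j ^+ 3 * (expR (t0 * psi 2 - y + (t j - t0) * psi 3) / q j ^+ 3).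
Proof.
pose b w := 4 ^+ k * \sum_j al j ^+ 3 * (I xm (G w) * A j w ^+ 3).
have ij j : intble P (fun w => al j ^+ 3 * (I xm (G w) * A j w ^+ 3)).
  by apply: intbleZ; have [] := low_cube j.
have ib : intble P b by apply: intbleZ; exact: intble_sum.
have le w : U w ^+ 3 * low w <= b w.
  have aA j : 0 <= al j * A j w by rewrite mulr_ge0.
  apply: le_trans (ler_wpM2r (low0 w) (sum_cube_le aA)) _.
  rewrite /b -mulrA; apply: ler_wpM2l; first by rewrite exprn_ge0.
  rewrite mulr_suml le_eqVlt; apply/orP; left; apply/eqP; apply: eq_bigr => j _.
  by rewrite /low; ring.
have ii : intble P (fun w => U w ^+ 3 * low w).
  apply: (intble_dom _ _ ib).
    by apply: measurable_funM => //; exact: measurable_funX.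
  by move=> w; rewrite ger0_norm// mulr_ge0 ?exprn_ge0.
split => //; apply: le_trans (ler_wpM2l (ltW n0) (le_Ex ii ib le)) _.
rewrite /b ExZ; last exact: intble_sum.
rewrite Ex_sum// mulrCA ler_wpM2l ?exprn_ge0// mulr_sumr; apply: ler_sum => j _.
have [i e] := low_cube j.
by rewrite ExZ// mulrCA ler_wpM2l// exprn_ge0.
Qed.

Let iYI : intble P (fun w => Yp w ^+ 2 / 2 * I xp (G w)) /\
  n * Ex P (fun w => Yp w ^+ 2 / 2 * I xp (G w)) =
  trunc_prob xp * (\sum_j \sum_l a j * a l * cov_coef j l) / 2.
Proof.
have -> : (fun w => Yp w ^+ 2 / 2 * I xp (G w)) =
   fun w => 2^-1 * \sum_j \sum_l a j * a l * (I xp (G w) * (A j w * A l w)).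
  apply/funext => w; rewrite mulrAC mulrC; congr (_ * _).
  rewrite /Yp expr2 mulr_suml mulr_suml; apply: eq_bigr => j _.
  rewrite mulr_sumr mulr_suml; apply: eq_bigr => l _; ring.
have il j l : intble P (fun w => a j * a l * (I xp (G w) * (A j w * A l w))).
  by apply: intbleZ; have [] := cross_moment xp j l.
have ij j : intble P (fun w => \sum_l a j * a l * (I xp (G w) * (A j w * A l w))).
  exact: intble_sum.
split; first by apply: intbleZ; exact: intble_sum.
rewrite ExZ; last exact: intble_sum.
rewrite Ex_sum// mulrCA [RHS]mulrC; congr (_ * _).
rewrite !mulr_sumr; apply: eq_bigr => j _; rewrite Ex_sum// !mulr_sumr.
apply: eq_bigr => l _; have [i e] := cross_moment xp j l.
by rewrite ExZ// mulrCA e mulrCA.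
Qed.

(** The coefficients [(c1, c2, c3)] select the case: [(2, 0, 1)] for the cosine and
    [(1 + mean_abs, 1, 0)] for the sine. *)
Let Ebound (c1 : R) : 0 <= c1 -> c1 <= 2 + mean_abs ->
  forall (c2 c3 : R), 0 <= c2 <= 1 -> 0 <= c3 <= 1 ->
  intble P (fun w => c1 * hi w + c2 * (U w * hi w) + 2 * U w ^+ 2 * mid w + 4 * U w ^+ 3 * low w +
     c3 * (mean_abs * U w) + (3 * mean_abs ^+ 2 + 4 * mean_abs ^+ 3)) /\
  n * Ex P (fun w => c1 * hi w + c2 * (U w * hi w) + 2 * U w ^+ 2 * mid w + 4 * U w ^+ 3 * low w +
     c3 * (mean_abs * U w) + (3 * mean_abs ^+ 2 + 4 * mean_abs ^+ 3)) <= trunc_error.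
Proof.
move=> c10 c11 c2 c3 /andP[c20 c21] /andP[c30 c31].
have [ih eh] := tail_prob; have [iuh euh] := iUhi; have [im em] := iUmid.
have [il el] := iUlow; have [iu eu] := iU.
have -> : (fun w => c1 * hi w + c2 * (U w * hi w) + 2 * U w ^+ 2 * mid w + 4 * U w ^+ 3 * low w +
     c3 * (mean_abs * U w) + (3 * mean_abs ^+ 2 + 4 * mean_abs ^+ 3)) =
  (fun w => c1 * hi w + c2 * (U w * hi w) + 2 * (U w ^+ 2 * mid w) + 4 * (U w ^+ 3 * low w) +
     (c3 * mean_abs) * U w + (3 * mean_abs ^+ 2 + 4 * mean_abs ^+ 3)).
  by apply/funext => w; rewrite !mulrA.
have j1 := intbleZ c1 ih; have j2 := intbleZ c2 iuh; have j3 := intbleZ 2 im.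
have j4 := intbleZ 4 il; have j5 := intbleZ (c3 * mean_abs) iu.
have j12 := intbleD j1 j2; have j13 := intbleD j12 j3; have j14 := intbleD j13 j4.
have j15 := intbleD j14 j5.
have jc : intble P (fun=> 3 * mean_abs ^+ 2 + 4 * mean_abs ^+ 3) by exact: intble_cst.
split; first exact: intbleD.
rewrite ExD// ExD// ExD// ExD// ExD// !ExZ// Ex_cst eu.
rewrite 6!mulrDr.
have hi_ge0 : 0 <= Ex P hi by exact: Ex_ge0.
have uhi_ge0 : 0 <= Ex P (fun w => U w * hi w) by apply: Ex_ge0 => w; rewrite mulr_ge0.
have n1 : 0 <= n by exact: ltW.
have b1 : n * (c1 * Ex P hi) <= (2 + mean_abs) * expR (t0 * psi 2 - 2 * y).
  by rewrite mulrCA; apply: ler_pM => //; rewrite mulr_ge0.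
have b2 : n * (c2 * Ex P (fun w => U w * hi w)) <= \sum_j al j * (expR (t0 * psi 2 - y + (t j - t0) * psi 1) / q j).
  by rewrite mulrCA; apply: le_trans euh; rewrite ler_piMl// mulr_ge0.
have b3 : n * (2 * Ex P (fun w => U w ^+ 2 * mid w)) <= 2 * (2 ^+ k * \sum_j al j ^+ 2 * ((trunc_prob xp - trunc_prob xm) * cov_coef j j)).
  by rewrite mulrCA ler_wpM2l.
have b4 : n * (4 * Ex P (fun w => U w ^+ 3 * low w)) <= 4 * (4 ^+ k * \sum_j al j ^+ 3 * (expR (t0 * psi 2 - y + (t j - t0) * psi 3) / q j ^+ 3)).
  by rewrite mulrCA ler_wpM2l.
have b5 : n * (c3 * mean_abs * mean_abs) <= n * mean_abs ^+ 2.
  by rewrite ler_wpM2l// expr2 -mulrA ler_piMl// mulr_ge0.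
have E4 : 4 * (1 + mean_abs) * (n * mean_abs ^+ 2) = n * mean_abs ^+ 2 + (n * (3 * mean_abs ^+ 2) + n * (4 * mean_abs ^+ 3)) by ring.
rewrite /trunc_error E4 [leRHS]addrA.
by do 5! (apply: lerD => //).
Qed.

Let mYp : measurable_fun setT Yp.
Proof. by apply: measurable_sum => j; exact: measurable_funM. Qed.

Lemma cos_array_estimate :
  `|n * (Ex P (fun w => cos (Yp w - mu)) - 1) + trunc_prob xp * (\sum_j \sum_l a j * a l * cov_coef j l) / 2|
  <= trunc_error.
Proof.
have [iy ey] := iYI.
have [ib eb] := @Ebound 2 (ler0n _ 2) (ltac:(rewrite lerDl; exact: mb0)) 0 1 (ltac:(by rewrite lexx ler01)) (ltac:(by rewrite lexx ler01)).
have ic : intble P (fun w => cos (Yp w - mu)).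
  apply: (@intble_bounded _ _ _ _ _ 1); last by move=> w; exact: cos_max.
  by apply: measurable_cos_comp; exact: measurable_funB.
have ic1 : intble P (fun w => cos (Yp w - mu) - 1) by apply: intbleB => //; exact: intble_cst.
have -> : n * (Ex P (fun w => cos (Yp w - mu)) - 1) + trunc_prob xp * (\sum_j \sum_l a j * a l * cov_coef j l) / 2 =
  n * Ex P (fun w => (cos (Yp w - mu) - 1) + Yp w ^+ 2 / 2 * I xp (G w)).
  rewrite (ExD ic1 iy) [RHS]mulrDr ey; congr (n * _ + _).
  by rewrite ExB//; [rewrite Ex_cst|exact: intble_cst].
rewrite normrM (gtr0_norm n0); apply: le_trans eb; apply: (ler_wpM2l (ltW n0)).
apply: normr_Ex_le => //; first exact: intbleD.
move=> w; have := cos_truncated_taylor (YU w) mumb (cases w).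
by rewrite {1}/hi opprB addrCA subrr addr0 mul0r addr0 mul1r.
Qed.

Lemma sin_array_estimate : n * `|Ex P (fun w => sin (Yp w - mu))| <= trunc_error.
Proof.
have [ib eb] := @Ebound (1 + mean_abs) (addr_ge0 ler01 mb0) (ltac:(by rewrite lerD2r ler1n)) 1 0 (ltac:(by rewrite lexx ler01)) (ltac:(by rewrite lexx ler01)).
have iYp : intble P Yp.
  by apply: intble_sum => j _; apply: intbleZ; have [] := mean_coefE j.
have iY : intble P (fun w => Yp w - mu) by apply: intbleB => //; exact: intble_cst.
have EY : Ex P (fun w => Yp w - mu) = 0.
  rewrite ExB//; last exact: intble_cst.
  rewrite Ex_cst Ex_sum; last by move=> j _; apply: intbleZ; have [] := mean_coefE j.
  apply/eqP; rewrite subr_eq0; apply/eqP; apply: eq_bigr => j _.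
  by have [i e] := mean_coefE j; rewrite ExZ// e.
have is_ : intble P (fun w => sin (Yp w - mu)).
  apply: (@intble_bounded _ _ _ _ _ 1); last by move=> w; exact: sin_max.
  by apply: measurable_sin_comp; exact: measurable_funB.
have -> : Ex P (fun w => sin (Yp w - mu)) = Ex P (fun w => sin (Yp w - mu) - (Yp w - mu)).
  by rewrite ExB// EY subr0.
apply: le_trans eb; apply: (ler_wpM2l (ltW n0)).
apply: normr_Ex_le => //; first exact: intbleB.
move=> w; have := sin_truncated_taylor (YU w) mumb (cases w).
by rewrite mul0r addr0 mul1r.
Qed.

End TruncatedMoments.

(** * Limits along the array *)

Section RealSequences.
Context {R : realType}.
Implicit Types u v : nat -> R.

Lemma sqrt_cvgy u : u N @[N --> \oo] --> +oo -> Num.sqrt (u N) @[N --> \oo] --> +oo.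
Proof.
move=> uy; apply/cvgryPge => A; have /cvgryPge/(_ (A ^+ 2)) := uy.
apply: filterS => N AN; have := ler_wsqrtr AN.
by rewrite sqrtr_sqr; apply: le_trans; exact: ler_norm.
Qed.

Lemma inv_cvgy u : u N @[N --> \oo] --> +oo -> (u N)^-1 @[N --> \oo] --> 0.
Proof.
move=> uy; apply/gtr0_cvgV0 => //.
have /cvgryPgt/(_ 0) := uy; exact.
Qed.

Lemma expR_cvg0 u (c k : R) : 0 < k -> u N @[N --> \oo] --> +oo ->
  expR (c - k * u N) @[N --> \oo] --> 0.
Proof.
move=> k0 uy.
have h : k * u N - c @[N --> \oo] --> +oo.
  apply/cvgryPge => A; have /cvgryPge/(_ ((A + c) / k)) := uy.
  by apply: filterS => N; rewrite ler_pdivrMr// => ?; lra.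
have -> : (fun N => expR (c - k * u N)) = (fun N => expR (- (k * u N - c))).
  by apply/funext => N; rewrite opprB.
exact: (cvg_comp _ _ h (@cvgr_expR R)).
Qed.

Lemma cvg_sqrt_comp u (l : R) : u N @[N --> \oo] --> l -> Num.sqrt (u N) @[N --> \oo] --> Num.sqrt l.
Proof. by move=> h; apply: (cvg_comp _ Num.sqrt h); exact: sqrt_continuous. Qed.

Lemma cvg_sum (I : Type) (r : seq I) (u : I -> nat -> R) (l : I -> R) :
  (forall i, u i N @[N --> \oo] --> l i) ->
  \sum_(i <- r) u i N @[N --> \oo] --> \sum_(i <- r) l i.
Proof.
move=> h; elim: r => [|i r IH].
  by rewrite big_nil; under eq_fun do rewrite big_nil; exact: cvg_cst.
by rewrite big_cons; under eq_fun do rewrite big_cons; exact: cvgD.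
Qed.

End RealSequences.

Section Threshold.
Context {R : realType}.
Variables (s : nat -> R) (theta lam v m p t0 : R).
Hypothesis s_cvg : s N @[N --> \oo] --> +oo.
Hypothesis v0 : 0 < v.
Hypothesis lamE : lam = 2 * m - p.
Hypothesis lnN : (fun N : nat => ln N%:R - lam * s N - 2 * theta * Num.sqrt (v * s N))
  =o_\oo (fun N : nat => Num.sqrt (s N)).

(** Here [p], [m], [v] stand for [psi 2] and the first two derivatives of [psi] at 2. As
    [lam = 2 m - p], the half sum [(ln N + p s) / 2] equals [m s + theta sqrt (v s)] plus [r / 2];
    the remainder, the shift by [s^{1/4}] and the constant [t0 m] all vanish against [sqrt s]. *)
Lemma threshold_cvg (c : R) :
  ((ln N%:R + p * s N) / 2 + c * Num.sqrt (Num.sqrt (s N)) - (s N + t0) * m) /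
    Num.sqrt (v * (s N + t0)) @[N --> \oo] --> theta.
Proof.
pose r (N : nat) := ln N%:R - lam * s N - 2 * theta * Num.sqrt (v * s N).
have uy := sqrt_cvgy s_cvg; have yy := sqrt_cvgy uy.
have rv : r N / Num.sqrt (s N) @[N --> \oo] --> 0.
  apply/cvgr0Pnorm_le => e e0; have /eqoP/(_ _ e0) h := lnN.
  have /cvgryPgt/(_ 0) us := uy.
  near=> N; have u0 : 0 < Num.sqrt (s N) by near: N.
  rewrite normrM normfV (gtr0_norm u0) ler_pdivrMr//.
  by rewrite -[X in _ * X](gtr0_norm u0); near: N.
have q1 : Num.sqrt (s N / (s N + t0)) @[N --> \oo] --> (1 : R).
  rewrite -[X in _ --> X]sqrtr1; apply: cvg_sqrt_comp.
  have h : 1 + t0 / s N @[N --> \oo] --> 1 + t0 * 0.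
    by apply: cvgD; [exact: cvg_cst|apply: cvgMl_tmp; exact: inv_cvgy].
  rewrite mulr0 addr0 in h.
  have h1 : (1 + t0 / s N)^-1 @[N --> \oo] --> (1 : R).
    by rewrite -[X in _ --> X]invr1; exact: (cvgV (oner_neq0 R) h).
  apply: cvg_trans h1.
  apply: near_eq_cvg; have /cvgryPgt/(_ (`|t0|)) s1 := s_cvg; near=> N.
  have sN : `|t0| < s N by near: N.
  have s0 : s N != 0 by rewrite gt_eqF// (le_lt_trans _ sN).
  have st : s N + t0 != 0 by rewrite gt_eqF//; move: sN; rewrite ltr_norml; lra.
  by rewrite /=; field; rewrite s0 st.
(* The same quotient with denominator [sqrt (v s)]; the factor [sqrt (s / (s + t0))], which tends to
   1, corrects the denominator. *)
pose w N := theta + 2^-1 / Num.sqrt v * (r N / Num.sqrt (s N)) +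
  c / Num.sqrt v * (Num.sqrt (Num.sqrt (s N)))^-1 - t0 * m / Num.sqrt v * (Num.sqrt (s N))^-1.
have wl : w N @[N --> \oo] --> theta.
  rewrite [X in _ --> X](_ : _ = theta + 2^-1 / Num.sqrt v * 0 + c / Num.sqrt v * 0 - t0 * m / Num.sqrt v * 0); last by ring.
  apply: cvgB; [apply: cvgD; [apply: cvgD; first exact: cvg_cst|]|]; apply: cvgMl_tmp => //; exact: inv_cvgy.
have -> : theta = theta * 1 by rewrite mulr1.
have wq : w N * Num.sqrt (s N / (s N + t0)) @[N --> \oo] --> theta * 1 by exact: cvgM.
apply: cvg_trans wq; apply: near_eq_cvg.
have /cvgryPgt/(_ (`|t0|)) s1 := s_cvg; near=> N.
have sN : `|t0| < s N by near: N.
have s0 : 0 < s N by rewrite (le_lt_trans _ sN).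
have st : 0 < s N + t0 by move: sN; rewrite ltr_norml; lra.
rewrite /w.
have -> : ln N%:R = r N + lam * s N + 2 * theta * Num.sqrt (v * s N) by rewrite /r; ring.
rewrite lamE sqrtrM ?(ltW s0)// sqrtrM ?ltW// sqrtrM ?ltW// sqrtrV ?ltW//.
have sE : s N = Num.sqrt (s N) ^+ 2 by rewrite sqr_sqrtr ?ltW.
have uE : Num.sqrt (s N) = Num.sqrt (Num.sqrt (s N)) ^+ 2 by rewrite sqr_sqrtr ?sqrtr_ge0.
set z := Num.sqrt (Num.sqrt (s N)) in uE *; set u := Num.sqrt (s N) in sE uE *.
have z0 : 0 < z by rewrite !sqrtr_gt0.
have u0 : 0 < u by rewrite sqrtr_gt0.
have v1 : 0 < Num.sqrt v by rewrite sqrtr_gt0.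
have st1 : 0 < Num.sqrt (s N + t0) by rewrite sqrtr_gt0.
move: (Num.sqrt (s N + t0)) (Num.sqrt v) (r N) st1 v1 => A B C A0 B0.
rewrite sE uE.
by field; rewrite !gt_eqF.
Unshelve. all: by end_near. Qed.

End Threshold.

Section ArrayLimits.
Context {R : realType}.
Variables (psi : R -> R) (s : nat -> R) (theta : R).
Hypothesis v0 : 0 < derive1n 2 psi 2.
Hypothesis gap : 2 * psi 1 < psi 2.
Hypothesis s_cvg : s N @[N --> \oo] --> +oo.
Hypothesis lnN : (fun N : nat => ln N%:R - (2 * derive1 psi 2 - psi 2) * s N
    - 2 * theta * Num.sqrt (derive1n 2 psi 2 * s N))
  =o_\oo (fun N : nat => Num.sqrt (s N)).
Variables (k : nat) (a t : 'I_k -> R).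

(* [expR (log_scale N) * var_shape N j] is the standard deviation of [Z_N (t j)]. *)
Definition log_scale (N : nat) : R := (ln N%:R + psi 2 * s N) / 2.
Definition var_shape (N : nat) (j : 'I_k) : R :=
  Num.sqrt (expR (psi 2 * t j) - expR (2 * psi 1 * t j + s N * (2 * psi 1 - psi 2))).

(** A lower bound for all the [t j] that also makes sense for [k = 0]. Below, [y N] is [s^{1/4}]: it
    tends to infinity but is negligible against the fluctuations of order [sqrt s]. *)
Let t0 : R := - \sum_j `|t j|.
Let y N := Num.sqrt (Num.sqrt (s N)).
Let yy : y N @[N --> \oo] --> +oo. Proof. by do 2 apply: sqrt_cvgy. Qed.

Let t0_le j : t0 <= t j.
Proof.
rewrite /t0 lerNl (bigD1 j)//= -normrN; apply: le_trans (ler_norm _) _.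
by rewrite lerDl sumr_ge0.
Qed.

Lemma var_shape_cvg j : var_shape N j @[N --> \oo] --> expR (psi 2 * t j / 2).
Proof.
have E : expR (psi 2 * t j / 2) = Num.sqrt (expR (psi 2 * t j) - 0).
  rewrite subr0 -[LHS]ger0_norm ?expR_ge0// -sqrtr_sqr -expRM_natl; congr (Num.sqrt (expR _)).
  by field.
rewrite E; apply: cvg_sqrt_comp; apply: cvgB; first exact: cvg_cst.
have -> : (fun N => expR (2 * psi 1 * t j + s N * (2 * psi 1 - psi 2))) =
   (fun N => expR (2 * psi 1 * t j - (psi 2 - 2 * psi 1) * s N)).
  by apply/funext => N; congr expR; ring.
by apply: expR_cvg0 => //; rewrite subr_gt0.
Qed.

Lemma var_shape_gt0 j N : 0 < s N + t j -> 0 < var_shape N j.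
Proof.
move=> st; rewrite sqrtr_gt0 subr_gt0 ltr_expR -subr_gt0.
have -> : psi 2 * t j - (2 * psi 1 * t j + s N * (2 * psi 1 - psi 2)) =
  (psi 2 - 2 * psi 1) * (s N + t j) by ring.
by rewrite mulr_gt0// subr_gt0.
Qed.

Let qV j : (var_shape N j)^-1 @[N --> \oo] --> expR (- (psi 2 * t j / 2)).
Proof.
rewrite expRN; have := @var_shape_cvg j; move=> h.
exact: (cvgV (lt0r_neq0 (expR_gt0 _)) h).
Qed.

Lemma cov_coef_cvg j l : cov_coef psi t (var_shape N) j l @[N --> \oo] -->
  expR ((psi 1 - psi 2 / 2) * `|t l - t j|).
Proof.
have -> : expR ((psi 1 - psi 2 / 2) * `|t l - t j|) =
  expR (Num.min (t j) (t l) * psi 2 + `|t l - t j| * psi 1) *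
   (expR (- (psi 2 * t j / 2)) * expR (- (psi 2 * t l / 2))).
  rewrite -!expRD; congr expR.
  have [jl|/ltW lj] := leP (t j) (t l).
    by rewrite ger0_norm ?subr_ge0//; field.
  by rewrite distrC ger0_norm ?subr_ge0//; field.
apply: cvgMl_tmp.
have -> : (fun N => (var_shape N j * var_shape N l)^-1) =
  (fun N => (var_shape N j)^-1 * (var_shape N l)^-1) by apply/funext => N; rewrite invfM.
by apply: cvgM; exact: qV.
Qed.

(** The means of the scaled terms without their factor [N^{-1/2}]. Since [psi 1 < psi 2 / 2] they
    decay exponentially in [s], so [N] times the squared mean, which is the square of [M N], tends
    to 0. *)
Let g N j := expR (s N * (psi 1 - psi 2 / 2) + t j * psi 1) * (var_shape N j)^-1.
Let M N := \sum_j `|a j| * g N j.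

Let M_cvg0 : M N @[N --> \oo] --> (0 : R).
Proof.
rewrite [X in _ --> X](_ : 0 = \sum_j `|a j| * (0 * expR (- (psi 2 * t j / 2)))); last first.
  by rewrite big1// => j _; rewrite mul0r mulr0.
apply: cvg_sum => j; apply: cvgMl_tmp; apply: cvgM; last exact: qV.
have -> : (fun N => expR (s N * (psi 1 - psi 2 / 2) + t j * psi 1)) =
  (fun N => expR (t j * psi 1 - (psi 2 / 2 - psi 1) * s N)).
  by apply/funext => N; congr expR; ring.
by apply: expR_cvg0 => //; have := gap; lra.
Qed.

Lemma mean_coef_scale N j : mean_coef psi t (var_shape N) (s N) (log_scale N) j =
  expR (- (ln N%:R / 2)) * g N j.
Proof.
rewrite /mean_coef /g invfM mulrA mulrA -expRN -!expRD; congr (expR _ * _).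
by rewrite /log_scale; field.
Qed.

Let meanE N : mean_abs psi a t (var_shape N) (s N) (log_scale N) =
  expR (- (ln N%:R / 2)) * M N.
Proof.
rewrite /mean_abs /M mulr_sumr; apply: eq_bigr => j _.
by rewrite mean_coef_scale mulrCA.
Qed.

Let ln_nat_ge0 N : 0 <= ln N%:R :> R.
Proof. by case: N => [|N]; [rewrite ln0|rewrite ln_ge0// ler1n]. Qed.

Let mean_cvg0 : mean_abs psi a t (var_shape N) (s N) (log_scale N) @[N --> \oo] --> (0 : R).
Proof.
apply/cvgr0Pnorm_le => e e0; have /cvgr0Pnorm_le/(_ _ e0) := M_cvg0.
apply: filterS => N; apply: le_trans; rewrite meanE normrM ger0_norm ?expR_ge0//.
rewrite ler_piMl// -[leRHS](@expR0 R) ler_expR oppr_le0 divr_ge0//.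
Qed.

Lemma log_scaleE N : (0 < N)%N -> expR (log_scale N) ^+ 2 = N%:R * expR (psi 2 * s N).
Proof.
move=> N0; rewrite -expRM_natl.
have -> : 2%:R * log_scale N = ln N%:R + psi 2 * s N by rewrite /log_scale; field.
by rewrite expRD lnK// posrE ltr0n.
Qed.

Let mean_sqr_cvg0 : N%:R * mean_abs psi a t (var_shape N) (s N) (log_scale N) ^+ 2 @[N --> \oo] --> (0 : R).
Proof.
have h : M N * M N @[N --> \oo] --> (0 * 0 : R) by exact: cvgM.
rewrite mulr0 in h.
apply: cvg_trans h; apply: near_eq_cvg; near=> N.
have N0 : (0 < N)%N by near: N; exact: nbhs_infty_gt.
rewrite meanE exprMn -expRM_natl mulrA.
have -> : 2%:R * - (ln N%:R / 2) = - ln N%:R :> R by field.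
by rewrite expRN lnK ?posrE ?ltr0n// divff ?mul1r ?pnatr_eq0 -?lt0n// expr2.
Unshelve. all: by end_near. Qed.

Context {d : measure_display} {T : measurableType d} (P : probability T R).
Variable zeta : nat -> R -> T -> R.
Hypothesis lexp : forall N, levy_exponent P (zeta N) psi.

Let trunc_cvg c : trunc_prob P (zeta N) psi (s N) t0 (log_scale N + c * y N) @[N --> \oo] -->
  std_normal_cdf theta.
Proof.
apply: (@tilted_cdf_cvg _ _ _ _ psi zeta (fun N => s N + t0)) => //.
  apply/cvgryPge => A; have /cvgryPge/(_ (A - t0)) := s_cvg.
  by apply: filterS => N; rewrite lerBlDr.
exact: threshold_cvg.
Qed.

Let trunc_cvgp : trunc_prob P (zeta N) psi (s N) t0 (log_scale N + y N) @[N --> \oo] -->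
  std_normal_cdf theta.
Proof. by have := @trunc_cvg 1; under eq_fun do rewrite mul1r. Qed.

Let trunc_cvgm : trunc_prob P (zeta N) psi (s N) t0 (log_scale N - y N) @[N --> \oo] -->
  std_normal_cdf theta.
Proof. by have := @trunc_cvg (-1); under eq_fun do rewrite mulN1r. Qed.

Let err N := trunc_error P (zeta N) psi a t (var_shape N) (s N) t0 (log_scale N) (y N) N%:R.

Let expy (b c : R) : expR (b - y N + c) @[N --> \oo] --> (0 : R).
Proof.
have -> : (fun N => expR (b - y N + c)) = (fun N => expR (b + c - 1 * y N)).
  by apply/funext => N; congr expR; ring.
exact: expR_cvg0.
Qed.

Let err_cvg0 : err N @[N --> \oo] --> (0 : R).
Proof.
pose Q j := expR (- (psi 2 * t j / 2)).
pose C j := expR ((psi 1 - psi 2 / 2) * `|t j - t j|).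
(* Zero is rewritten in the shape of [trunc_error], each factor replaced by its limit. The term
   between the thresholds disappears because both truncation probabilities have the same limit. *)
rewrite [X in _ --> X](_ : 0 = (2 + 0) * 0 + \sum_j `|a j| * (0 * Q j) +
  2 * (2 ^+ k * \sum_j `|a j| ^+ 2 * ((std_normal_cdf theta - std_normal_cdf theta) * C j)) +
  4 * (4 ^+ k * \sum_j `|a j| ^+ 3 * (0 * Q j ^+ 3)) + 4 * (1 + 0) * 0); last first.
  rewrite subrr !mulr0 !add0r !addr0 !big1 ?mulr0 ?addr0// => j _; by rewrite mul0r mulr0.
have c0 c : (fun=> c) @ \oo --> (c : R) by exact: cvg_cst.
apply: cvgD; [apply: cvgD; [apply: cvgD; [apply: cvgD|]|]|].
- apply: cvgM; first exact: cvgD.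
  by apply: expR_cvg0.
- apply: cvg_sum => j; apply: cvgMl_tmp; apply: cvgM; last exact: qV.
  exact: expy.
- do 2 apply: cvgMl_tmp; apply: cvg_sum => j; apply: cvgMl_tmp.
  by apply: cvgM; [exact: cvgB|exact: cov_coef_cvg].
- do 2 apply: cvgMl_tmp; apply: cvg_sum => j; apply: cvgMl_tmp.
  apply: cvgM; first exact: expy.
  under eq_fun do rewrite -exprVn.
  have q := @qV j; rewrite /Q !exprS !expr0.
  under eq_fun do rewrite !exprS expr0.
  by do 3 (apply: cvgM; first exact: q).
- by apply: cvgM => //; apply: cvgMl_tmp; exact: cvgD.
Qed.

Definition scaled_term N w := \sum_j a j * (expR (zeta N (s N + t j) w) / (expR (log_scale N) * var_shape N j)).
Definition scaled_mean N := \sum_j a j * mean_coef psi t (var_shape N) (s N) (log_scale N) j.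
Definition limit_var := \sum_j \sum_l a j * a l * expR ((psi 1 - psi 2 / 2) * `|t l - t j|).

Let good : \forall N \near \oo, [/\ forall j, 0 < var_shape N j, 0 < N%:R :> R, 0 <= y N, 0 <= s N + t0 &
   expR (log_scale N) ^+ 2 = N%:R * expR (psi 2 * s N)].
Proof.
have /cvgryPgt/(_ (- t0)) h := s_cvg; near=> N.
have N0 : (0 < N)%N by near: N; exact: nbhs_infty_gt.
have st : - t0 < s N by near: N.
split; [move=> j|by rewrite ltr0n|exact: sqrtr_ge0|by lra|exact: log_scaleE].
by apply: var_shape_gt0; have := t0_le j; lra.
Unshelve. all: by end_near. Qed.

Lemma cos_array_cvg : N%:R * (Ex P (fun w => cos (scaled_term N w - scaled_mean N)) - 1) @[N --> \oo] -->
  - (std_normal_cdf theta * limit_var / 2).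
Proof.
pose A N := N%:R * (Ex P (fun w => cos (scaled_term N w - scaled_mean N)) - 1).
pose B N := trunc_prob P (zeta N) psi (s N) t0 (log_scale N + y N) *
  (\sum_j \sum_l a j * a l * cov_coef psi t (var_shape N) j l) / 2.
have Bl : B N @[N --> \oo] --> std_normal_cdf theta * limit_var / 2.
  apply: cvgMr_tmp; apply: cvgM; first exact: trunc_cvgp.
  by apply: cvg_sum => j; apply: cvg_sum => l; apply: cvgMl_tmp; exact: cov_coef_cvg.
have D0 : A N + B N @[N --> \oo] --> (0 : R).
  apply/cvgr0Pnorm_le => e e0; have /cvgr0Pnorm_le/(_ _ e0) h := err_cvg0.
  near=> N; have [q0 n0 y0 st0 xE] : [/\ forall j, 0 < var_shape N j, 0 < N%:R :> R, 0 <= y N, 0 <= s N + t0 &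
   expR (log_scale N) ^+ 2 = N%:R * expR (psi 2 * s N)] by near: N; exact: good.
  have E : `|err N| <= e by near: N.
  apply: le_trans E; apply: le_trans (ler_norm _).
  exact: (cos_array_estimate (lexp N) a q0 n0 y0 st0 t0_le xE).
have : (A N + B N) - B N @[N --> \oo] --> 0 - std_normal_cdf theta * limit_var / 2 by exact: cvgB.
by rewrite sub0r; under eq_fun do rewrite addrK.
Unshelve. all: by end_near. Qed.

Lemma sin_array_cvg : N%:R * `|Ex P (fun w => sin (scaled_term N w - scaled_mean N))| @[N --> \oo] --> (0 : R).
Proof.
apply/cvgr0Pnorm_le => e e0; have /cvgr0Pnorm_le/(_ _ e0) h := err_cvg0.
near=> N; have [q0 n0 y0 st0 xE] : [/\ forall j, 0 < var_shape N j, 0 < N%:R :> R, 0 <= y N, 0 <= s N + t0 &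
   expR (log_scale N) ^+ 2 = N%:R * expR (psi 2 * s N)] by near: N; exact: good.
have E : `|err N| <= e by near: N.
apply: le_trans E; apply: le_trans (ler_norm _).
rewrite ger0_norm ?mulr_ge0//.
exact: (sin_array_estimate (lexp N) a q0 n0 y0 st0 t0_le xE).
Unshelve. all: by end_near. Qed.

(** Since [cos <= 1], the quantities in [cos_array_cvg] are nonpositive, and so is their limit;
    positive definiteness of the covariance kernel is thereby bypassed. *)
Lemma limit_var_ge0 : 0 <= std_normal_cdf theta * limit_var.
Proof.
have h : - (std_normal_cdf theta * limit_var / 2) <= 0.
  apply: (closed_cvg _ (@closed_le R 0) _ _ cos_array_cvg).
  near=> N; rewrite /= mulr_ge0_le0// subr_le0.
  have [q0 n0 y0 st0 xE] : [/\ forall j, 0 < var_shape N j, 0 < N%:R :> R, 0 <= y N, 0 <= s N + t0 &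
   expR (log_scale N) ^+ 2 = N%:R * expR (psi 2 * s N)] by near: N; exact: good.
  rewrite -[leRHS](Ex_cst P); apply: le_Ex; [|exact: intble_cst|by move=> w; exact: cos_le1].
  apply: (@intble_bounded _ _ _ _ _ 1); last by move=> w; exact: cos_max.
  apply: measurable_cos_comp; apply: measurable_funB => //; apply: measurable_sum => j.
  apply: measurable_funM => //; apply: measurable_funM => //; apply: measurable_expR_comp.
  have [levy _] := lexp N; apply: (levy_measurable levy).
  by have := t0_le j; lra.
by have := h; rewrite oppr_le0 pmulr_lge0 ?invr_gt0.
Unshelve. all: by end_near. Qed.
End ArrayLimits.

(** * The normalized sums *)

Section SigmaProc.
Context {d : measure_display} {T : measurableType d} {R : realType}.
Variable xi : R -> T -> R.

Lemma sigma_proc_measurable (P : probability T R) :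
  levy_process P xi -> sigma_proc xi `<=` measurable.
Proof.
move=> levy; apply: smallest_sub; first exact: sigma_algebra_measurable.
move=> _ [t /= t0 [B mB <-]]; rewrite -[X in measurable X]setTI.
exact: (levy_measurable levy t0).
Qed.

Lemma sigma_proc_exp_sum (k : nat) (a u : 'I_k -> R) (phi : R -> R) :
  (forall j, 0 <= u j) -> measurable_fun setT phi ->
  forall B : set R, measurable B ->
  sigma_proc xi ((fun w => phi (\sum_j a j * expR (xi (u j) w))) @^-1` B).
Proof.
move=> u0 mphi B mB.
pose G := \bigcup_(t in [set t : R | 0 <= t]) [set xi t @^-1` B | B in (measurable : set (set R))].
(* The sample space with the sigma-algebra generated by the process: ordinary measurability on [U]
   is membership of preimages in [sigma_proc xi]. *)
pose U := g_sigma_algebraType G.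
have mx j : measurable_fun (setT : set U) (xi (u j) : U -> R).
  move=> _ C mC; rewrite setTI; apply: sub_sigma_algebra.
  by exists (u j); [exact: u0|exists C].
have : measurable_fun (setT : set U) (fun w : U => phi (\sum_j a j * expR (xi (u j) w))).
  apply: (measurableT_comp mphi); apply: measurable_sum => j.
  apply: measurable_funM => //.
  exact: (measurableT_comp (@measurable_expR R) (mx j)).
by move=> /(_ measurableT B mB); rewrite setTI.
Qed.

End SigmaProc.

(** Selects the summand with the largest error, whose process then depends on [N]. For [N = 0] the
    claim is vacuous. *)
Lemma maximal_index {R : realType} (e : nat -> R) N :
  exists i, forall j, (j < N)%N -> e j <= e i.
Proof.
elim: N => [|N [i ih]]; first by exists 0%N.
have [h|h] := leP (e i) (e N).
  exists N => j; rewrite ltnS leq_eqVlt => /predU1P[->//|/ih]; exact: (fun x => le_trans x h).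
exists i => j; rewrite ltnS leq_eqVlt => /predU1P[->|/ih//]; exact: ltW.
Qed.

Section TrigSum.
Context {R : realType} {d : measure_display} {T : measurableType d}.
Variables (P : probability T R) (psi : R -> R) (xis : nat -> R -> T -> R).
Variables (s : nat -> R) (theta : R).
Hypothesis lexp : forall i, levy_exponent P (xis i) psi.
Hypothesis ind : mutually_independent P setT (fun i => sigma_proc (xis i)).
Hypothesis v0 : 0 < derive1n 2 psi 2.
Hypothesis gap : 2 * psi 1 < psi 2.
Hypothesis s_cvg : s N @[N --> \oo] --> +oo.
Hypothesis lnN : (fun N : nat => ln N%:R - (2 * derive1 psi 2 - psi 2) * s N
    - 2 * theta * Num.sqrt (derive1n 2 psi 2 * s N))
  =o_\oo (fun N : nat => Num.sqrt (s N)).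
Variables (k : nat) (a t : 'I_k -> R).

Let Y N i w := scaled_term psi s a t (fun=> xis i) N w - scaled_mean psi s a t N.
Let V := std_normal_cdf theta * limit_var psi a t / 2.
Let rho N := expR (- (V / N%:R)).
Let e N i := `|Ex P (fun w => cos (Y N i w)) - rho N| + `|Ex P (fun w => sin (Y N i w))|.

Let V0 : 0 <= V.
Proof. by rewrite divr_ge0//; exact: (limit_var_ge0 v0 gap s_cvg lnN a t lexp). Qed.

Let rho_cvg : N%:R * (1 - rho N) @[N --> \oo] --> V.
Proof.
apply/cvgrPdist_le => ep ep0.
have h : V ^+ 2 * expR V * N%:R^-1 @[N --> \oo] --> (0 : R).
  rewrite -[X in _ --> X](mulr0 (V ^+ 2 * expR V)).
  by apply: cvgMl_tmp; apply: inv_cvgy; exact: cvgr_idn.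
have /cvgr0Pnorm_le/(_ _ ep0) {}h := h.
near=> N.
have n1 : 1 <= N%:R :> R by rewrite ler1n; near: N; exact: nbhs_infty_gt.
have hN : `|V ^+ 2 * expR V * N%:R^-1| <= ep by near: N.
have n0 : 0 < N%:R :> R by exact: lt_le_trans n1.
apply: le_trans (le_trans (ler_norm _) hN).
pose x := - (V / N%:R).
have -> : V - N%:R * (1 - rho N) = N%:R * (expR x - 1 - x).
  rewrite /rho -/x; have -> : V = - (N%:R * x) by rewrite /x; field; exact: lt0r_neq0.
  by ring.
rewrite normrM gtr0_norm//; apply: le_trans (ler_wpM2l (ltW n0) (expR_taylor1 x)) _.
have xV : `|x| <= V.
  by rewrite normrN (ger0_norm (divr_ge0 V0 (ltW n0))) ler_pdivrMr// ler_peMr.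
apply: (@le_trans _ _ (N%:R * (x ^+ 2 * expR V))).
  by rewrite ler_wpM2l// ler_wpM2l ?sqr_ge0// ler_expR.
by rewrite le_eqVlt; apply/orP; left; apply/eqP; rewrite /x; field; exact: lt0r_neq0.
Unshelve. all: by end_near. Qed.

Let Y_ge : \forall N \near \oo, forall j, 0 <= s N + t j.
Proof.
have /cvgryPge/(_ (\sum_j `|t j|)) := s_cvg; apply: filterS => N sN j.
have : `|t j| <= s N by apply: le_trans sN; rewrite (bigD1 j)//= lerDl sumr_ge0.
by rewrite ler_norml; lra.
Qed.

Let YE N i : Y N i = fun w => (fun z => z - scaled_mean psi s a t N)
   (\sum_j a j / (expR (log_scale psi s N) * var_shape psi s t N j) * expR (xis i (s N + t j) w)).
Proof.
apply/funext => w; rewrite /Y /scaled_term; congr (_ - _); apply: eq_bigr => j _.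
by rewrite -mulrA [_^-1 * _]mulrC.
Qed.

Let mY N i : (forall j, 0 <= s N + t j) -> measurable_fun setT (Y N i).
Proof.
move=> s0 _ B mB; rewrite setTI YE.
have [levy _] := lexp i; apply: (sigma_proc_measurable levy).
by apply: (@sigma_proc_exp_sum _ _ _ (xis i) k _ _ (fun z => z - scaled_mean psi s a t N)) => //; exact: measurable_funB.
Qed.

(** By [trig_conv_dist] with [rho N ^+ N = e^{-V}], the distance to the limit is at most the sum of
    the [N] errors [e N i], hence [N] times the largest. Each error is [o(1/N)] by the array limits,
    as [1 - rho N] is [V / N] to first order. *)
Lemma trig_sum_cvg b :
  Ex P (fun w => cos (\sum_(i < N) Y N i w + b)) @[N --> \oo] --> expR (- V) * cos b.
Proof.
have bound : \forall N \near \oo, `|Ex P (fun w => cos (\sum_(i < N) Y N i w + b)) - expR (- V) * cos b| <=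
   \sum_(0 <= i < N) e N i.
  near=> N.
  have N0 : (0 < N)%N by near: N; exact: nbhs_infty_gt.
  have s0 : forall j, 0 <= s N + t j by near: N; exact: Y_ge.
  have mYN i := mY i s0.
  have -> : Ex P (fun w => cos (\sum_(i < N) Y N i w + b)) =
     Ex P (fun w => (\prod_(i <- index_iota 0 N) 1) * cos (\sum_(i <- index_iota 0 N) Y N i w + b)).
    by apply: eq_Ex => w; rewrite big1_eq mul1r big_mkord.
  rewrite (@Ex_prod_cos_sum _ _ _ P nat (index_iota 0 N) (fun _ _ => 1) (Y N)).
  - have := @trig_conv_dist R [seq (Ex P (fun x : T => 1 * cos (Y N i x)), Ex P (fun x : T => 1 * sin (Y N i x))) | i <- index_iota 0 N] b (rho N).
    rewrite size_map size_iota subn0 big_map.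
    have -> : rho N ^+ N = expR (- V).
      rewrite -expRM_natl; congr expR; rewrite mulrN mulrC divfK// pnatr_eq0 -lt0n//.
    have -> : \sum_(i <- index_iota 0 N) (`|Ex P (fun x => 1 * cos (Y N i x)) - rho N| + `|Ex P (fun x => 1 * sin (Y N i x))|) = \sum_(0 <= i < N) e N i.
      apply: eq_bigr => i _.
      have Em (f : T -> R) : Ex P (fun x => 1 * f x) = Ex P f by apply: eq_Ex => x; rewrite mul1r.
      by rewrite (Em (fun x => cos (Y N i x))) (Em (fun x => sin (Y N i x))).
    apply.
    + move=> p /mapP[i _ ->] /=; apply: Ex_trig_sqr_le1 => //; last exact: Ex_cst.
      exact: intble_cst.
    + by rewrite expR_ge0/= -[leRHS]expR0 ler_expR oppr_le0 divr_ge0.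
  - exact: iota_uniq.
  move=> g gE; apply: (Ex_prod ind) => //.
  - by move=> i _; have [levy _] := lexp i; exact: (sigma_proc_measurable levy).
  - exact: iota_uniq.
  - move=> i ir B mB.
    have [->|->] := gE i ir; rewrite YE; apply: (@sigma_proc_exp_sum _ _ _ (xis i) k _ _ (fun z => 1 * _ (z - scaled_mean psi s a t N))) => //.
      apply: measurable_funM => //; apply: measurable_cos_comp; exact: measurable_funB.
    apply: measurable_funM => //; apply: measurable_sin_comp; exact: measurable_funB.
  move=> i ir; have [->|->] := gE i ir; apply: (@intble_bounded _ _ _ _ _ 1).
  - by apply: measurable_funM => //; exact: measurable_cos_comp.
  - by move=> w; rewrite mul1r cos_max.
  - by apply: measurable_funM => //; exact: measurable_sin_comp.
  - by move=> w; rewrite mul1r sin_max.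
have [iN iNP] : exists iN : nat -> nat, forall N j, (j < N)%N -> e N j <= e N (iN N).
  by have /choice[iN h] := fun N => maximal_index (e N) N; exists iN.
(* The array limits are applied to the sequence of processes [xis (iN N)], one for each [N]; no law
   is shared beyond the exponent [psi]. *)
have c : N%:R * (Ex P (fun w => cos (Y N (iN N) w)) - 1) @[N --> \oo] --> - V.
  exact: (@cos_array_cvg _ _ _ _ v0 gap s_cvg lnN k a t _ _ P (fun N => xis (iN N)) (fun N => lexp (iN N))).
have sn : N%:R * `|Ex P (fun w => sin (Y N (iN N) w))| @[N --> \oo] --> (0 : R).
  exact: (@sin_array_cvg _ _ _ _ v0 gap s_cvg lnN k a t _ _ P (fun N => xis (iN N)) (fun N => lexp (iN N))).
have cr : N%:R * (Ex P (fun w => cos (Y N (iN N) w)) - 1) + N%:R * (1 - rho N) @[N --> \oo] --> (0 : R).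
  by rewrite -[X in _ --> X](addNr V); exact: cvgD.
have e0 : N%:R * e N (iN N) @[N --> \oo] --> (0 : R).
  have -> : (fun N => N%:R * e N (iN N)) = (fun N =>
    `|N%:R * (Ex P (fun w => cos (Y N (iN N) w)) - 1) + N%:R * (1 - rho N)| +
     N%:R * `|Ex P (fun w => sin (Y N (iN N) w))|).
    apply/funext => N; rewrite /e mulrDr -[in RHS]mulrDr normrM ger0_norm//.
    by congr (_ * `|_| + _); ring.
  rewrite -[X in _ --> X](addr0 (0 : R)); apply: cvgD => //.
  by rewrite -[X in _ --> X](@normr0 R R); exact: cvg_norm.
apply/cvgrPdist_le => ep ep0; have /cvgr0Pnorm_le/(_ _ ep0) h := e0.
near=> N; rewrite distrC.
have B : `|Ex P (fun w => cos (\sum_(i < N) Y N i w + b)) - expR (- V) * cos b| <=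
   \sum_(0 <= i < N) e N i by near: N.
apply: le_trans B _; apply: (@le_trans _ _ (N%:R * e N (iN N))); last first.
  by apply: le_trans (ler_norm _) _; near: N.
rewrite big_mkord; apply: le_trans (_ : \sum_(i < N) e N (iN N) <= _).
  by apply: ler_sum => i _; exact: iNP.
by rewrite sumr_const card_ord mulr_natl.
Unshelve. all: by end_near. Qed.

End TrigSum.

Section NormalizedSum.
Context {R : realType} {d : measure_display} {T : measurableType d}.
Variables (P : probability T R) (psi : R -> R) (xis : nat -> R -> T -> R).
Variable (s : nat -> R).
Hypothesis lexp : forall i, levy_exponent P (xis i) psi.
Hypothesis ind : mutually_independent P setT (fun i => sigma_proc (xis i)).
Hypothesis gap : 2 * psi 1 < psi 2.

Lemma ExE (f : T -> R) : fine ('E_P[f])%E = Ex P f.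
Proof. by rewrite /Ex unlock. Qed.

Section FixedTime.
Variables (u : R) (N : nat).
Hypothesis u0 : 0 <= u.

Let F i w := expR (xis i u w).
Let m := expR (u * psi 1).
Let iF i : intble P (F i) /\ Ex P (F i) = m.
Proof.
have h := levy_exp_intble (lexp i) 1 u0; have e := levy_exp_Ex (lexp i) 1 u0.
have -> : F i = (fun w => expR (1 * xis i u w)) by apply/funext => w; rewrite mul1r.
by [].
Qed.

Let D i w := F i w - m.
Let iD i : intble P (D i). Proof. by apply: intbleB; [have [] := iF i|exact: intble_cst]. Qed.
Let ED i : Ex P (D i) = 0.
Proof. by have [i1 e1] := iF i; rewrite ExB ?e1 ?Ex_cst ?subrr//; exact: intble_cst. Qed.

Let iDD i : intble P (fun w => D i w ^+ 2) /\
  Ex P (fun w => D i w ^+ 2) = expR (u * psi 2) - m ^+ 2.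
Proof.
have i2 := levy_exp_intble (lexp i) 2 u0; have e2 := levy_exp_Ex (lexp i) 2 u0.
have [i1 e1] := iF i.
have -> : (fun w => D i w ^+ 2) = (fun w => expR (2 * xis i u w) - 2 * m * F i w + m ^+ 2).
  by apply/funext => w; rewrite /D /F expRM_natl; ring.
have ib : intble P (fun w => expR (2 * xis i u w) - 2 * m * F i w) by apply: intbleB => //; exact: intbleZ.
split; first by apply: intbleD => //; exact: intble_cst.
rewrite ExD//; last exact: intble_cst.
by rewrite ExB//; [rewrite ExZ// e1 e2 Ex_cst; ring|exact: intbleZ].
Qed.

Let cross i l : i != l -> intble P (fun w => D i w * D l w) /\ Ex P (fun w => D i w * D l w) = 0.
Proof.
move=> il; have := @Ex_prod _ _ _ P nat setT _ ind _ [:: i; l] D.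
have -> : (fun x => \prod_(i0 <- [:: i; l]) D i0 x) = (fun w => D i w * D l w).
  by apply/funext => w; rewrite !big_cons big_nil mulr1.
rewrite !big_cons big_nil !ED mul0r; apply => //.
- by move=> j _; have [levy _] := lexp j; exact: (sigma_proc_measurable levy).
- by rewrite /= inE il.
- move=> j _ B mB.
  have -> : D j = fun w => (fun z => z - m) (\sum_(j0 < 1) 1 * expR (xis j u w)).
    by apply/funext => w; rewrite big_ord1 mul1r.
  apply: (@sigma_proc_exp_sum _ _ _ (xis j) 1 (fun=> 1) (fun=> u) (fun z => z - m)) => //.
  exact: measurable_funB.
Qed.

Let Z w := \sum_(i < N) F i w.

Lemma sum_mean : intble P Z /\ Ex P Z = N%:R * m.
Proof.
split; first by apply: intble_sum => i _; have [] := iF i.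
rewrite Ex_sum; last by move=> i _; have [] := iF i.
under eq_bigr => i _ do rewrite (iF i).2.
by rewrite sumr_const card_ord mulr_natl.
Qed.

Lemma sum_centered_sqr : intble P (fun w => (Z w - N%:R * m) ^+ 2) /\
  Ex P (fun w => (Z w - N%:R * m) ^+ 2) = N%:R * (expR (u * psi 2) - m ^+ 2).
Proof.
have -> : (fun w => (Z w - N%:R * m) ^+ 2) =
   (fun w => \sum_(i < N) \sum_(l < N) D i w * D l w).
  apply/funext => w; have -> : Z w - N%:R * m = \sum_(i < N) D i w.
    by rewrite sumrB sumr_const card_ord mulr_natl.
  by rewrite expr2 mulr_suml; apply: eq_bigr => i _; rewrite mulr_sumr.
have iil (i l : 'I_N) : intble P (fun w => D i w * D l w).
  by have [->|/cross[]//] := eqVneq (i : nat) l; have [] := iDD l.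
have ii (i : 'I_N) : intble P (fun w => \sum_(l < N) D i w * D l w) by exact: intble_sum.
split; first exact: intble_sum.
rewrite Ex_sum//; transitivity (\sum_(i < N) (expR (u * psi 2) - m ^+ 2)).
  apply: eq_bigr => i _; rewrite Ex_sum// (bigD1 i)//= big1 ?addr0; first by have [_ <-] := iDD i.
  by move=> l li; have [] := @cross i l; rewrite // eq_sym.
by rewrite sumr_const card_ord mulr_natl.
Qed.

Lemma sum_variance : fine ('V_P[Z])%E = N%:R * (expR (u * psi 2) - m ^+ 2).
Proof.
have [_ <-] := sum_centered_sqr; have [_ <-] := sum_mean.
by rewrite /variance covariance.unlock !ExE; apply: eq_Ex => w; rewrite expr2.
Qed.

End FixedTime.

Section FixedTimes.
Variables (k : nat) (t : 'I_k -> R) (N : nat).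
Hypothesis N0 : (0 < N)%N.
Hypothesis s0 : forall j, 0 < s N + t j.

Let sd j := expR (log_scale psi s N) * var_shape psi s t N j.
Let sd0 j : 0 < sd j. Proof. by rewrite mulr_gt0 ?expR_gt0// var_shape_gt0. Qed.

Let varE j : N%:R * (expR ((s N + t j) * psi 2) - expR ((s N + t j) * psi 1) ^+ 2) = sd j ^+ 2.
Proof.
have q0 := @var_shape_gt0 R psi s gap k t j N (s0 j).
rewrite exprMn log_scaleE// sqr_sqrtr; last by move: q0; rewrite sqrtr_gt0 => /ltW.
rewrite -[RHS]mulrA; congr (_ * _); rewrite mulrBr -expRM_natl -!expRD.
by congr (expR _ - expR _); ring.
Qed.

Lemma normalized_ZE j w : normalized_Z P xis s N (t j) w =
  (\sum_(i < N) expR (xis i (s N + t j) w) - N%:R * expR ((s N + t j) * psi 1)) / sd j.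
Proof.
have u0 : 0 <= s N + t j by exact: ltW.
have [_ e] := sum_mean N u0; have ev := sum_variance N u0.
by rewrite /normalized_Z ExE e ev varE sqrtr_sqr gtr0_norm.
Qed.

Lemma normalized_Z_measurable j : measurable_fun setT (normalized_Z P xis s N (t j)).
Proof.
have u0 : 0 <= s N + t j by exact: ltW.
have -> : normalized_Z P xis s N (t j) = fun w =>
  (\sum_(i < N) expR (xis i (s N + t j) w) - N%:R * expR ((s N + t j) * psi 1)) / sd j.
  by apply/funext => w; rewrite normalized_ZE.
have [/intble_meas h _] := sum_mean N u0.
by apply: measurable_funM => //; exact: measurable_funB.
Qed.

Lemma normalized_Z_sqr j : intble P (fun w => normalized_Z P xis s N (t j) w ^+ 2) /\
  Ex P (fun w => normalized_Z P xis s N (t j) w ^+ 2) = 1.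
Proof.
have u0 : 0 <= s N + t j by exact: ltW.
have [i e] := sum_centered_sqr N u0.
have -> : (fun w => normalized_Z P xis s N (t j) w ^+ 2) = fun w => (sd j) ^- 2 *
  (\sum_(i < N) expR (xis i (s N + t j) w) - N%:R * expR ((s N + t j) * psi 1)) ^+ 2.
  by apply/funext => w; rewrite normalized_ZE expr_div_n mulrC.
split; first exact: intbleZ.
by rewrite ExZ// e varE mulVf// expf_neq0// gt_eqF.
Qed.

(** Exchanging the sums over times and over copies exposes a sum of [N] independent centred terms,
    the form needed by [trig_sum_cvg]. *)
Lemma normalized_Z_lin (a : 'I_k -> R) w :
  \sum_j a j * normalized_Z P xis s N (t j) w =
  \sum_(i < N) (scaled_term psi s a t (fun=> xis i) N w - scaled_mean psi s a t N).
Proof.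
rewrite sumrB sumr_const card_ord /scaled_term /scaled_mean exchange_big/= -sumrMnl -sumrB.
apply: eq_bigr => j _; rewrite normalized_ZE mulrBl mulrBr mulr_suml mulr_sumr; congr (_ - _).
by rewrite /mean_coef -/(sd j) -mulr_natl; ring.
Qed.

End FixedTimes.
End NormalizedSum.

(** * The Gaussian limit and conclusion *)

Section GaussianLimit.
Context {R : realType} {d : measure_display} {T : measurableType d}.
Variables (P : probability T R) (X : R -> T -> R) (C : R -> R -> R).
Hypothesis gauss : centered_gaussian_process P X C.

Lemma gaussian_Ex_cos (k : nat) (t a : 'I_k -> R) (c b : R) :
  let v := \sum_j \sum_l a j * a l * C (t j) (t l) in
  0 <= c -> 0 <= c * v ->
  Ex P (fun w => cos (\sum_j a j * (Num.sqrt c * X (t j) w) + b)) = expR (- (c * v / 2)) * cos b.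
Proof.
move=> v c0 cv0; have [mX law] := gauss.
have E w : \sum_j a j * (Num.sqrt c * X (t j) w) = Num.sqrt c * \sum_j a j * X (t j) w.
  by rewrite mulr_sumr; apply: eq_bigr => j _; rewrite mulrCA.
have -> : (fun w => cos (\sum_j a j * (Num.sqrt c * X (t j) w) + b)) =
   (fun w => cos (Num.sqrt c * (\sum_j a j * X (t j) w) + b)).
  by apply/funext => w; rewrite E.
have mW : measurable_fun setT (fun w => \sum_j a j * X (t j) w).
  by apply: measurable_sum => j; exact: measurable_funM.
have mphi : measurable_fun setT (fun x : R => cos (Num.sqrt c * x + b)).
  by apply: measurable_cos_comp; apply: measurable_funD => //; exact: measurable_funM.
(* Only [c * v >= 0] is known, which says nothing about the sign of [v] when [c = 0]; both sides are
   then [cos b]. *)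
have [->|cn0] := eqVneq c 0.
  rewrite sqrtr0 mul0r mul0r oppr0 expR0 mul1r.
  by rewrite -[RHS](Ex_cst P); apply: eq_Ex => w; rewrite mul0r add0r.
have c_gt0 : 0 < c by rewrite lt_def cn0.
have v0 : 0 <= v by move: cv0; rewrite pmulr_rge0.
have {}law B := law k t a B; rewrite -/v in law.
have mid : measurable_fun setT (idfun : measurableTypeR R -> R) by exact: measurable_id.
have [vz|vn0] := eqVneq v 0.
  pose Q : probability (measurableTypeR R) R := \d_(0 : measurableTypeR R).
  transitivity (Ex Q (fun x : measurableTypeR R => cos (Num.sqrt c * x + b))).
    apply: (@same_law_Ex _ _ _ _ _ P Q _ idfun mW mid _ _ mphi) => B mB.
    by rewrite law// vz eqxx.
  rewrite /Ex (integral_dirac (0 : measurableTypeR R) measurableT); last exact/measurable_EFinP.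
  rewrite diracT mul1e /= mulr0 add0r.
  by rewrite vz mulr0 mul0r oppr0 expR0 mul1r.
have s0 : Num.sqrt v != 0 by rewrite sqrtr_eq0 -ltNge lt_def vn0.
pose Q : probability (measurableTypeR R) R := normal_prob 0 (Num.sqrt v).
transitivity (Ex Q (fun x : measurableTypeR R => cos (Num.sqrt c * x + b))).
  apply: (@same_law_Ex _ _ _ _ _ P Q _ idfun mW mid _ _ mphi) => B mB.
  by rewrite law// (negbTE vn0).
by rewrite (Ex_normal_cos s0) !sqr_sqrtr// [v * c]mulrC.
Qed.

End GaussianLimit.

(** Equality in law at time 1 carries the exponent of [xi] over to [eta]. Positivity together with
    finiteness of the moment generating function lets the logarithm in [lmgf] be undone. *)
Lemma levy_exponent_lmgf {d : measure_display} {T : measurableType d} {R : realType}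
    (P : probability T R) (xi eta : R -> T -> R) :
  levy_process P xi -> (forall u : R, ('M_P (xi 1%R) u < +oo)%E) ->
  levy_process P eta -> same_fdd P eta xi ->
  levy_exponent P eta (lmgf P (xi 1)).
Proof.
move=> lx fin le sl; split => // u.
have M : ('M_P (xi 1%R) u = lmgfE P xi u 1)%E.
  by rewrite /mmt_gen_fun unlock; apply: eq_integral => w _; rewrite /= mulrC.
have -> : lmgfE P eta u 1 = lmgfE P xi u 1.
  apply: (@same_law_integral _ _ _ _ _ P P (eta 1) (xi 1) _ _ _ (fun x => expR (u * x))).
  - exact: (levy_measurable le).
  - exact: (levy_measurable lx).
  - move=> B mB; have := sl 1%N (fun=> 1) (fun=> B) (fun=> ler01) (fun=> mB).
    have cst (A : set T) : \bigcap_(j in [set: 'I_1]) A = A.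
      by apply: bigcap_const; exists ord0.
    by rewrite !cst.
  - by apply: measurable_expR_comp; exact: measurable_funM.
have := fin u; have := lmgfE_gt0 lx u ler01; rewrite /lmgf M.
by case: (lmgfE P xi u 1) => [r| |]//= r0 _; rewrite lnK// posrE -lte_fin.
Qed.

Theorem theorem1p3 (d : measure_display) (T : measurableType d) (R : realType)
  (P : probability T R) (xi : R -> T -> R) (xis : nat -> R -> T -> R)
  (s : nat -> R) (theta : R) :
  levy_process P xi ->
  (forall u : R, ('M_P (xi 1%R) u < +oo)%E) ->
  ~ (exists c : R, {ae P, forall w, xi 1 w = c}) ->
  (forall i, levy_process P (xis i) /\ same_fdd P (xis i) xi) ->
  mutually_independent P setT (fun i => sigma_proc (xis i)) ->
  (forall N, 0 <= s N) ->
  s N @[N --> \oo] --> +oo ->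
  let psi := lmgf P (xi 1) in
  let lambda2 := 2 * derive1 psi 2 - psi 2 in
  (fun N : nat => ln N%:R - lambda2 * s N
                  - 2 * theta * Num.sqrt (derive1n 2 psi 2 * s N))
    =o_\oo (fun N : nat => Num.sqrt (s N)) ->
  forall (d' : measure_display) (T' : measurableType d')
         (P' : probability T' R) (X : R -> T' -> R),
  centered_gaussian_process P' X
    (fun t1 t2 => expR ((psi 1 - psi 2 / 2) * `|t2 - t1|)) ->
  fdd_converge P (normalized_Z P xis s)
    P' (fun t w => Num.sqrt (std_normal_cdf theta) * X t w).
Proof.
move=> lx fin nonconst copies ind _ s_cvg psi lambda2 lnN d' T' P' X gauss k t f fc [M fM].
have lexp0 : levy_exponent P xi psi by apply: levy_exponent_lmgf => // n u B _ _.
have lexp i : levy_exponent P (xis i) psi.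
  by have [li si] := copies i; exact: levy_exponent_lmgf.
have v0 : 0 < derive1n 2 psi 2 by exact: (derive2_psi_gt0 lexp0 nonconst).
have gap : 2 * psi 1 < psi 2 by exact: (psi2_gt lexp0 nonconst).
have [mX _] := gauss.
pose Y N w : 'rV[R]_k := \row_j normalized_Z P xis s N (t j) w.
pose Y' w : 'rV[R]_k := \row_j (Num.sqrt (std_normal_cdf theta) * X (t j) w).
(* The [t j] may be negative; for large [N] all the times [s N + t j] are positive, and then the
   means and variances of the sums are given by [psi]. *)
have good : \forall N \near \oo, (0 < N)%N /\ forall j, 0 < s N + t j.
  have /cvgryPgt/(_ (\sum_j `|t j|)) h := s_cvg; near=> N; split.
    by near: N; exact: nbhs_infty_gt.
  move=> j; have sN : \sum_j `|t j| < s N by near: N.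
  have : `|t j| < s N by apply: le_lt_trans sN; rewrite (bigD1 j)//= lerDl sumr_ge0.
  by rewrite ltr_norml; lra.
have mY' j : measurable_fun setT (fun w => Y' w 0 j).
  by under eq_fun do rewrite mxE; exact: measurable_funM.
have lim : Ex P (fun w => 1 * f (Y N w)) @[N --> \oo] --> Ex P' (fun w => f (Y' w)).
  apply: (@bounded_continuous_cvg _ _ _ _ _ _ P P' (fun _ _ => 1) Y Y' 1 _ mY' _ _ f M) => //.
  - move: good; apply: filterS => N [N0 st]; split.
    + exact: intble_cst.
    + exact: Ex_cst.
    + move=> j; under eq_fun do rewrite mxE.
      exact: (normalized_Z_measurable lexp ind gap N0 st).
    move=> j; have [i e] := normalized_Z_sqr lexp ind gap N0 st j.
    have -> : (fun w => 1 * Y N w 0 j ^+ 2) = (fun w => normalized_Z P xis s N (t j) w ^+ 2).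
      by apply/funext => w; rewrite mul1r mxE.
    by split => //; rewrite e.
  move=> a b.
  have -> : Ex P' (fun w => cos (\sum_j a 0 j * Y' w 0 j + b)) =
     expR (- (std_normal_cdf theta * limit_var psi (a 0) t / 2)) * cos b.
    have /andP[c0 _] := std_normal_cdf_bounds theta.
    have cv := @limit_var_ge0 _ _ _ _ v0 gap s_cvg lnN _ (a 0) t _ _ _ _ lexp.
    rewrite -(@gaussian_Ex_cos _ _ _ P' X _ gauss k t (a 0) _ b c0 cv).
    by apply: eq_Ex => w; congr (cos (_ + _)); apply: eq_bigr => j _; rewrite mxE.
  apply: cvg_trans (@trig_sum_cvg _ _ _ P psi xis s theta lexp ind v0 gap s_cvg lnN k (a 0) t b).
  apply: near_eq_cvg; move: good; apply: filterS => N [N0 st].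
  apply: eq_Ex => w; rewrite mul1r -(normalized_Z_lin lexp ind gap N0 st); congr (cos (_ + _)).
  by apply: eq_bigr => j _; rewrite mxE.
have intE (d0 : measure_display) (T0 : measurableType d0) (Q : probability T0 R) (V : T0 -> 'rV[R]_k) :
    (forall j, measurable_fun setT (fun w => V w 0 j)) ->
    ('E_Q[fun w => f (V w)] = (Ex Q (fun w => f (V w)))%:E)%E.
  move=> mV; have i : intble Q (fun w => f (V w)).
    apply: (@intble_bounded _ _ _ _ _ M) => //.
    exact: (measurable_bounded_continuous mV fc fM).
  by rewrite unlock intble_int.
rewrite (intE _ _ P' Y' mY').
have limE : (Ex P (fun w => 1 * f (Y N w)))%:E @[N --> \oo] --> (Ex P' (fun w => f (Y' w)))%:E.
  exact: (cvg_comp _ _ lim).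
apply: cvg_trans limE; apply: near_eq_cvg; move: good; apply: filterS => N [N0 st].
rewrite (intE _ _ P (Y N)); last first.
  by move=> j; under eq_fun do rewrite mxE; exact: (normalized_Z_measurable lexp ind gap N0 st).
by congr EFin; apply: eq_Ex => w; rewrite mul1r.
Unshelve. all: by end_near. Qed.
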